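(* Let $A$ be a finite alphabet with at least two elements and let $\eta\in A^{\mathbb{Z}^2}$ be a configuration that contains all letters of $A$. If there exists a quasi-regular set $\mathcal{S}\in\mathcal{F}^{Vol}_{C}$ such that $P_\eta(\mathcal{S})\le \frac12|\mathcal{S}|+|A|-1$, then $\eta$ is periodic.
   Context: A configuration $\eta=(\eta_g)_{g\in\mathbb{Z}^2}\in A^{\mathbb{Z}^2}$ is periodic if there is $h\in\mathbb{Z}^2\setminus\{0\}$ with $\eta_{g+h}=\eta_g$ for all $g\in\mathbb{Z}^2$. For $u\in\mathbb{Z}^2$, $(T^u\eta)_g:=\eta_{g+u}$. For a nonempty set $\mathcal{S}\subset\mathbb{Z}^2$, $P_\eta(\mathcal{S})$ is the number of distinct restrictions $(T^u\eta)|_{\mathcal{S}}\in A^{\mathcal{S}}$, $u\in\mathbb{Z}^2$. A set $\mathcal{S}\subset\mathbb{Z}^2$ is convex if its convex hull $\mathrm{conv}(\mathcal{S})\subset\mathbb{R}^2$ is closed and $\mathcal{S}=\mathrm{conv}(\mathcal{S})\cap\mathbb{Z}^2$. $\mathcal{F}^{Vol}_{C}$ is the family of finite, nonempty, convex subsets of $\mathbb{Z}^2$ whose convex hull has positive area. $E(\mathcal{S})$ is the set of edges of the convex polygon $\mathrm{conv}(\mathcal{S})$, each oriented by the positive (counterclockwise) orientation of the boundary of $\mathrm{conv}(\mathcal{S})$; two oriented segments are antiparallel if they have opposite directions. A set $\mathcal{S}\in\mathcal{F}^{Vol}_{C}$ is quasi-regular if for every edge $w\in E(\mathcal{S})$ there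 is an edge $w'\in E(\mathcal{S})$ antiparallel to $w$ with $|w'\cap\mathcal{S}|=|w\cap\mathcal{S}|$. *)

(* Defs.v *)
From mathcomp Require Export all_boot all_order all_algebra finmap.
From mathcomp Require Export all_classical all_reals all_analysis.

Set Implicit Arguments.
Unset Strict Implicit.
Unset Printing Implicit Defensive.

Import Order.TTheory GRing.Theory Num.Theory.
Import numFieldNormedType.Exports.

Local Open Scope classical_set_scope.
Local Open Scope ring_scope.

Notation Z2 := (int * int)%type.

Definition periodic (A : Type) (eta : Z2 -> A) : Prop :=
  exists2 h : Z2, h != 0 & forall g : Z2, eta (g + h) = eta g.

Definition translate (A : Type) (u : Z2) (eta : Z2 -> A) : Z2 -> A :=
  fun g => eta (g + u).

Definition restriction (A : finType) (eta : Z2 -> A) (S : {fset Z2}) :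
  {ffun S -> A} := [ffun g : S => eta (val g)].

Definition pattern_complexity (A : finType) (eta : Z2 -> A) (S : {fset Z2}) :
  nat :=
  #|[pred p : {ffun S -> A} |
      `[< exists u : Z2, p = restriction (translate u eta) S >]]|.

Section Geometry.
Variable R : realType.

(* R^o rather than R, so that the product is an lmodType over R. *)
Local Notation plane := (R^o * R^o)%type.

Definition embed (g : Z2) : plane := (g.1%:~R, g.2%:~R).

Definition conv_hull (X : set plane) : set plane :=
  smallest (@convex_set R plane) X.

Definition hull (S : set Z2) : set plane := conv_hull (embed @` S).

Definition convexZ2 (S : set Z2) : Prop :=
  closed (hull S) /\ S = embed @^-1` (hull S).

Definition area (X : set plane) : \bar R :=
  ((@lebesgue_measure R) \x (@lebesgue_measure R))%E X.

Definition FCVol (S : {fset Z2}) : Prop :=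
  [/\ S != fset0, convexZ2 [set` S] & (0 < area (hull [set` S]))%E].

Definition segment (a b : plane) : set plane :=
  [set x | exists2 t : R, 0 <= t <= 1 & x = a + t *: (b - a)].

(* Positive, zero or negative according as c lies to the left of, on, or to the
   right of the line through a and b directed from a to b. *)
Definition orient (a b c : plane) : R :=
  (b.1 - a.1) * (c.2 - a.2) - (b.2 - a.2) * (c.1 - a.1).

(* An oriented edge (a, b) of a convex polygon C: a nondegenerate segment cut
   out of C by a supporting line. C lies to its left, which is the
   counterclockwise orientation of the boundary. *)
Definition oriented_edges (C : set plane) : set (plane * plane) :=
  [set w | [/\ w.1 <> w.2,
               forall x, C x -> 0 <= orient w.1 w.2 x
             & C `&` [set x | orient w.1 w.2 x = 0] = segment w.1 w.2]].

Definition edges (S : {fset Z2}) : set (plane * plane) :=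
  oriented_edges (hull [set` S]).

Definition antiparallel (w w' : plane * plane) : Prop :=
  exists2 t : R, 0 < t & w'.2 - w'.1 = - t *: (w.2 - w.1).

Definition edge_card (S : {fset Z2}) (w : plane * plane) : nat :=
  #|` [fset g in S | `[< segment w.1 w.2 (embed g) >]]%fset|.

Definition quasi_regular (S : {fset Z2}) : Prop :=
  FCVol S /\
  forall w, edges S w ->
    exists w', [/\ edges S w', antiparallel w w' &
                   edge_card S w' = edge_card S w].

End Geometry.

(* Main.v *)
Require Import Defs.
From mathcomp Require Import algC zify ring lra.

Set Implicit Arguments.
Unset Strict Implicit.
Unset Printing Implicit Defensive.

Import Order.TTheory GRing.Theory Num.Theory.

Local Open Scope ring_scope.

(* Let eta be aperiodic, c a numerical coding of it, X^u the shift by u. A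
   linear analogue of the Dyson e-transform gives a space Af of operators
   sum_(s in S) a_s X^(s - s0) with dim Af + P(S) >= |S| + |A|, each of them
   killed on c by a nonzero polynomial. If P(S) is small, Af contains a
   nonscalar operator, so c has an integer annihilator f. Modulo a large prime p
   one has f^p = f(X^p), hence f(X^k) c = 0 for all k free of small primes, and
   eliminating terms between these equations gives prod (X^w - 1) c = 0.
   Among the products of factors X^u - z over the algebraic numbers that make c
   doubly periodic take a shortest one, L. Each a in Af is constant on the union
   of the curves X^u = z, so dim Af <= 1 + |S_L|, where S_L is S eroded by the
   directions of L. Applying to c only the factors whose directions differ from
   two given ones u1, u2 yields c' with (X^(M u1) - 1)(X^(M' u2) - 1) c' = 0,
   periodic along neither u1 nor u2; a Morse-Hedlund argument on rows then gives
   P(S) >= |S'| + |A| - 1 for the eroded set S'. As |S_L| < |S'|, adding the two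
   bounds contradicts 2 P(S) <= |S| + 2 |A| - 2. *)

(** * Counting values *)

(** The factor 1/2 arises because neither bound suffices alone: the linear one loses |S_L| and the
    nonlinear one loses |S| - |S'|, but in their sum 2 P(S) >= |S| + 2 |A| - 2 + (|S'| - |S_L|)
    these losses compensate. An operator a in Af is constant on X^u = z for the following reason. By
    minimality of L the product of its other factors maps c to some e that is not doubly periodic
    although (X^u - z) e is. An operator nonzero somewhere on the curve cannot make such an e doubly
    periodic. A product of factors a - lam kills e, so one of them vanishes on the whole curve.
    Curves of independent directions meet, so the constants agree. The obstacle in the nonlinear
    bound is that c' may confuse letters, so its patterns alone would account for fewer than |A|
    letters. They are therefore refined by what c' locally reveals of the letter, and the missing
    letters are regained by counting the edges of a bipartite graph between refined patterns and
    letters. *)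

Definition value_set (I : Type) (F : finType) (f : I -> F) : {set F} :=
  [set y | `[< exists i, f i = y >]].

Definition nvalues (I : Type) (F : finType) (f : I -> F) : nat := #|value_set f|.

Lemma value_set_in (I : Type) (F : finType) (f : I -> F) i : f i \in value_set f.
Proof. by rewrite inE; apply/asboolP; exists i. Qed.

Lemma value_setP (I : Type) (F : finType) (f : I -> F) y :
  y \in value_set f -> exists i, f i = y.
Proof. by rewrite inE => /asboolP. Qed.

Lemma value_set_section (I : Type) (F : finType) (f : I -> F) (i0 : I) :
  exists r : F -> I, forall y, y \in value_set f -> f (r y) = y.
Proof.
have H y : exists i, y \in value_set f -> f i = y.
  case: (boolP (y \in value_set f)) => [/value_setP [i fi]|_]; last by exists i0.
  by exists i.
by have [r rP] := choice H; exists r.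
Qed.

Lemma nvalues_le_eq (I : Type) (F G : finType) (f : I -> F) (g : I -> G) :
  (forall i j, f i = f j -> g i = g j) ->
  (nvalues g <= nvalues f)%N /\
  ((nvalues f <= nvalues g)%N -> forall i j, g i = g j -> f i = f j).
Proof.
move=> fg.
case: (pselect (inhabited I)) => [[i0]|nI]; last first.
  split; last by move=> _ i; case: nI; constructor.
  rewrite (_ : nvalues g = 0%N)//; apply/eqP; rewrite cards_eq0 -finset.subset0.
  by apply/fintype.subsetP => y /value_setP[i _]; case: nI; constructor.
have [r rP] := value_set_section f i0.
have gr i : g (r (f i)) = g i by apply: fg; rewrite rP ?value_set_in.
have sub : value_set g \subset [set g (r y) | y in value_set f].
  apply/fintype.subsetP => y /value_setP[i <-]; apply/imsetP; exists (f i) => //.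
  exact: value_set_in.
have lei := leq_imset_card (fun y => g (r y)) (mem (value_set f)).
have le1 := subset_leq_card sub.
split; first exact: leq_trans le1 lei.
move=> le2 i j gij.
have /imset_injP inj : #|[set g (r y) | y in value_set f]| == #|value_set f|.
  by rewrite eqn_leq lei (leq_trans le2 le1).
by apply: inj; rewrite ?value_set_in // !gr.
Qed.

Lemma nvalues_le (I : Type) (F G : finType) (f : I -> F) (g : I -> G) :
  (forall i j, f i = f j -> g i = g j) -> (nvalues g <= nvalues f)%N.
Proof. by move=> /nvalues_le_eq[]. Qed.

Lemma nvalues_ker (I : Type) (F G : finType) (f : I -> F) (g : I -> G) :
  (forall i j, f i = f j -> g i = g j) -> (nvalues f <= nvalues g)%N ->
  forall i j, g i = g j -> f i = f j.
Proof. by move=> /nvalues_le_eq[]. Qed.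

Lemma nvalues_eq (I : Type) (F G : finType) (f : I -> F) (g : I -> G) :
  (forall i j, f i = f j <-> g i = g j) -> nvalues f = nvalues g.
Proof.
by move=> fg; apply/eqP; rewrite eqn_leq !nvalues_le// => i j /fg.
Qed.

Lemma nvalues_comp (I J : Type) (F : finType) (f : I -> F) (p : J -> I) :
  (nvalues (f \o p) <= nvalues f)%N.
Proof.
rewrite /nvalues; apply/subset_leq_card/fintype.subsetP => y /value_setP[j <-].
exact: value_set_in.
Qed.

(** Each value of [g] on the image of [p] has two lifts to values of [f]: the section of [g] gives
    [U], the second lifts give [V], and the two sets are disjoint. *)
Lemma nvalues_special (I J : Type) (F G : finType) (f : I -> F) (g : I -> G)
    (p : J -> I) :
  (forall i j, f i = f j -> g i = g j) ->
  (forall t, exists i, g (p t) = g i /\ f (p t) <> f i) ->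
  (nvalues g + nvalues (g \o p) <= nvalues f)%N.
Proof.
move=> fg sp.
case: (pselect (inhabited J)) => [[t0]|nJ]; last first.
  have -> : nvalues (g \o p) = 0%N.
    apply/eqP; rewrite cards_eq0 -finset.subset0; apply/fintype.subsetP => y /value_setP[i _].
    by case: nJ; constructor.
  by rewrite addn0 nvalues_le.
have [r rP] := value_set_section g (p t0).
have H y : exists i, y \in value_set (g \o p) -> g i = y /\ f i <> f (r y).
  case: (boolP (y \in value_set (g \o p))) => [/value_setP[t <-]|_]; last by exists (p t0).
  case: (pselect (f (p t) = f (r (g (p t))))) => [e|ne]; last by exists (p t).
  by have [i [gi fi]] := sp t; exists i => _; split=> // e'; apply: fi; rewrite e.
have [q qP] := choice H.
set U := [set f (r y) | y in value_set g]; set V := [set f (q y) | y in value_set (g \o p)].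
have cU : #|U| = nvalues g.
  by rewrite card_in_imset// => x y xi yi /fg; rewrite !rP.
have cV : #|V| = nvalues (g \o p).
  rewrite card_in_imset// => x y xi yi /fg.
  by have [-> _] := qP _ xi; have [-> _] := qP _ yi.
rewrite -cU -cV -cardsUI (_ : U :&: V = finset.set0) ?cards0 ?addn0.
  apply/subset_leq_card/fintype.subsetP => y; rewrite inE.
  by case/orP => /imsetP[x xi ->]; apply: value_set_in.
apply/eqP; rewrite -finset.subset0; apply/fintype.subsetP => z; rewrite inE.
case/andP => /imsetP[x xi zx] /imsetP[y yi zy].
have [gq fq] := qP _ yi.
have : g (r x) = g (q y) by apply: fg; rewrite -zx.
by rewrite gq rP// => xy; case: fq; rewrite -zy zx xy.
Qed.

Lemma deterministic_periodic (F : finType) (st : int -> F) :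
  (forall i j, st i = st j -> st (i + 1) = st (j + 1)) ->
  forall i, st (i + ((#|F|)`!)%:Z) = st i.
Proof.
move=> det i; set n := #|F|.
(* Determinism runs only forward, so the repetition is sought among the n + 1 times ending at i;
   then i itself lies on the cycle. The cycle length is at most n and hence divides n!. *)
have [t [t' [tt' e]]] : exists t t' : 'I_n.+1, (t < t')%N /\
    st (i - n%:Z + t%:Z) = st (i - n%:Z + t'%:Z).
  pose h (t : 'I_n.+1) := st (i - n%:Z + t%:Z).
  have /injectivePn[x [y xy hxy]] : ~~ injectiveb h.
    by apply/negP => /injectiveP /leq_card; rewrite card_ord ltnn.
  case: (ltngtP x y) => [l|l|/val_inj e]; last by rewrite e eqxx in xy.
    by exists x, y.
  by exists y, x.
have adv (m : nat) : st (i - n%:Z + t%:Z + m%:Z) = st (i - n%:Z + t'%:Z + m%:Z).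
  elim: m => [|m IH]; first by rewrite !addr0.
  by rewrite -(addn1 m) PoszD !addrA; apply: det.
have per (m : nat) : st (i + m%:Z + (t' - t)%N%:Z) = st (i + m%:Z).
  have tn : (t <= n)%N by rewrite -ltnS.
  have := adv (m + (n - t))%N.
  rewrite (_ : i - n%:Z + t%:Z + (m + (n - t))%N%:Z = i + m%:Z); last by lia.
  by rewrite (_ : i - n%:Z + t'%:Z + (m + (n - t))%N%:Z = i + m%:Z + (t' - t)%N%:Z); last by lia.
have mul (k : nat) : st (i + (k * (t' - t))%N%:Z) = st i.
  elim: k => [|k IH]; first by rewrite mul0n addr0.
  by rewrite mulSn addnC PoszD addrA per.
have /dvdnP[k ->] : (t' - t %| n`!)%N.
  apply: dvdn_fact; rewrite subn_gt0 tt' /= (leq_trans (leq_subr _ _))//.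
  by rewrite -ltnS.
exact: mul.
Qed.

(** * Growth of pattern counts, row by row *)

Lemma chain_stall (f : nat -> nat) n :
  (f n < f 0 + n)%N -> exists2 k, (k < n)%N & (f k.+1 <= f k)%N.
Proof.
elim: n => [|n IH]; first by rewrite addn0 ltnn.
move=> h; have [le|lt] := leqP (f n.+1) (f n); first by exists n.
have /IH[k kn fk] : (f n < f 0 + n)%N by lia.
by exists k => //; apply: ltnW.
Qed.

Section Patterns.
Variables (B : finType) (X : int -> int -> B).

Definition pat (D : seq Z2) (p : Z2) : (size D).-tuple B :=
  map_tuple (fun s => X (p.1 + s.1) (p.2 + s.2)) (in_tuple D).

Definition complexity (D : seq Z2) : nat := nvalues (pat D).

Lemma patP D p q :
  pat D p = pat D q <->
  (forall s : Z2, s \in D -> X (p.1 + s.1) (p.2 + s.2) = X (q.1 + s.1) (q.2 + s.2)).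
Proof.
split=> [e s sD|e].
  have /eq_in_map : map (fun s => X (p.1 + s.1) (p.2 + s.2)) D =
                    map (fun s => X (q.1 + s.1) (q.2 + s.2)) D.
    by have := congr1 val e.
  exact.
by apply/val_inj/eq_in_map.
Qed.

Lemma pat_sub D E p q :
  {subset D <= E} -> pat E p = pat E q -> pat D p = pat D q.
Proof. by move=> DE /patP e; apply/patP => s /DE; apply: e. Qed.

Lemma complexity_eq_mem D E : D =i E -> complexity D = complexity E.
Proof.
by move=> DE; apply: nvalues_eq => p q; split; apply: pat_sub => s; rewrite DE.
Qed.

Lemma complexity_ker D E : {subset D <= E} -> (complexity E <= complexity D)%N ->
  forall p q, pat D p = pat D q -> pat E p = pat E q.
Proof. by move=> DE le; apply: nvalues_ker le => p q; apply: pat_sub. Qed.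

Definition strip_periodic (p : Z2) (K lo hi : int) := forall i j : int, lo <= j < hi ->
  X (p.1 + i + K) (p.2 + j) = X (p.1 + i) (p.2 + j).

Lemma strip_periodic_mul p (K : int) lo hi (d : nat) :
  strip_periodic p K lo hi -> strip_periodic p (K * d%:Z) lo hi.
Proof.
move=> per i j jh; elim: d i => [|d IH] i; first by rewrite mulr0 addr0.
rewrite (_ : p.1 + i + K * d.+1%:Z = p.1 + (i + K * d%:Z) + K); last by lia.
by rewrite per// addrA IH.
Qed.

(* Two configurations agreeing on arbitrarily many rows below row 0 but not on
   row 0: the two-dimensional counterpart of a special word. *)
Definition upper_special := forall M : nat, exists p q : Z2,
  (forall i j : int, - M%:Z <= j < 0 ->
     X (p.1 + i) (p.2 + j) = X (q.1 + i) (q.2 + j)) /\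
  (exists i : int, X (p.1 + i) p.2 <> X (q.1 + i) q.2).

Definition no_strip_periodic (beta : nat) := forall p (K : int), 0 < K ->
  ~ strip_periodic p K 0 beta%:Z.

(* Morse-Hedlund on the top row: if adding a row of n + 1 points to T creates at
   most n new patterns, then n consecutive symbols of that row and the M rows
   below determine the whole row; the pigeonhole principle makes a strip
   periodic, and periodicity propagates upwards. *)
Section Top.
Variables (T Q : seq Z2) (h x0 : int) (M n : nat) (xr : int -> int).
Hypothesis TQ : {subset T <= Q}.
Hypothesis Qrow : forall i, (i < n.+1)%N -> (x0 + i%:Z, h) \in Q.
Hypothesis Qsplit : forall s : Z2, s \in Q ->
  s \in T \/ exists2 i, (i < n.+1)%N & s = (x0 + i%:Z, h).
Hypothesis Tlow : forall s : Z2, s \in T -> h - M%:Z <= s.2 < h.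
Hypothesis Trow : forall (r : int) i, h - M%:Z <= r < h -> (i < n)%N ->
  (xr r + i%:Z, r) \in T.
Hypothesis cxQ : (complexity Q <= complexity T + n)%N.

(** Adding the n + 1 points of the row to [T] from left to right creates at most n patterns, so some
    step creates none, and there the next symbol is forced. *)
Lemma right_det : exists2 k, (k <= n)%N & forall p q : Z2,
  (forall i j : int, h - M%:Z <= j < h ->
     X (p.1 + i) (p.2 + j) = X (q.1 + i) (q.2 + j)) ->
  forall x : int, (forall i, (i < k)%N ->
     X (p.1 + (x + i%:Z)) (p.2 + h) = X (q.1 + (x + i%:Z)) (q.2 + h)) ->
  X (p.1 + (x + k%:Z)) (p.2 + h) = X (q.1 + (x + k%:Z)) (q.2 + h).
Proof.
pose D k := T ++ [seq (x0 + i%:Z, h) | i <- iota 0 k].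
have D0 : complexity (D 0) = complexity T by apply: complexity_eq_mem => s; rewrite /D /= cats0.
have Dn : complexity (D n.+1) = complexity Q.
  apply: complexity_eq_mem => s; rewrite mem_cat; apply/orP/idP.
    case=> [/TQ//|/mapP[i]]; rewrite mem_iota => /andP[_ i_n] ->.
    exact: Qrow.
  case/Qsplit => [|[i i_n ->]]; first by left.
  by right; apply/mapP; exists i => //; rewrite mem_iota.
have [|k kn le] := @chain_stall (fun k => complexity (D k)) n.+1.
  by rewrite Dn D0; lia.
exists k => // p q strip x row.
have sub : {subset D k <= D k.+1}.
  move=> s; rewrite !mem_cat => /orP[->//|/mapP[i]].
  rewrite mem_iota => ik ->; apply/orP; right; apply/mapP; exists i => //.
  by rewrite mem_iota; lia.
have := @complexity_ker _ _ sub le (p.1 + (x - x0), p.2) (q.1 + (x - x0), q.2).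
have H : pat (D k) (p.1 + (x - x0), p.2) = pat (D k) (q.1 + (x - x0), q.2).
  apply/patP => s; rewrite mem_cat => /orP[/Tlow sT|/mapP[i]].
    by rewrite /= -!addrA strip.
  rewrite mem_iota => /andP[_ ik] -> /=; have := row _ ik.
  by rewrite (_ : x + i%:Z = x - x0 + (x0 + i%:Z)) ?addrA//; lia.
move=> /(_ H)/patP/(_ (x0 + k%:Z, h)) /=.
rewrite (_ : x + k%:Z = x - x0 + (x0 + k%:Z)); last by lia.
rewrite !addrA => -> //; rewrite mem_cat; apply/orP; right.
by apply/mapP; exists k => //; rewrite mem_iota; lia.
Qed.

Lemma left_det : exists2 k, (k <= n)%N & forall p q : Z2,
  (forall i j : int, h - M%:Z <= j < h ->
     X (p.1 + i) (p.2 + j) = X (q.1 + i) (q.2 + j)) ->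
  forall x : int, (forall i, (i < k)%N ->
     X (p.1 + (x - i%:Z)) (p.2 + h) = X (q.1 + (x - i%:Z)) (q.2 + h)) ->
  X (p.1 + (x - k%:Z)) (p.2 + h) = X (q.1 + (x - k%:Z)) (q.2 + h).
Proof.
pose x1 := x0 + n%:Z.
pose D k := T ++ [seq (x1 - i%:Z, h) | i <- iota 0 k].
have D0 : complexity (D 0) = complexity T by apply: complexity_eq_mem => s; rewrite /D /= cats0.
have Dn : complexity (D n.+1) = complexity Q.
  apply: complexity_eq_mem => s; rewrite mem_cat; apply/orP/idP.
    case=> [/TQ//|/mapP[i]]; rewrite mem_iota => /andP[_ i_n] ->.
    rewrite (_ : x1 - i%:Z = x0 + (n - i)%N%:Z); last by rewrite /x1; lia.
    by apply: Qrow; lia.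
  case/Qsplit => [|[i i_n ->]]; first by left.
  right; apply/mapP; exists (n - i)%N; first by rewrite mem_iota; lia.
  by congr (_, _); rewrite /x1; lia.
have [|k kn le] := @chain_stall (fun k => complexity (D k)) n.+1.
  by rewrite Dn D0; lia.
exists k => // p q strip x row.
have sub : {subset D k <= D k.+1}.
  move=> s; rewrite !mem_cat => /orP[->//|/mapP[i]].
  rewrite mem_iota => ik ->; apply/orP; right; apply/mapP; exists i => //.
  by rewrite mem_iota; lia.
have := @complexity_ker _ _ sub le (p.1 + (x - x1), p.2) (q.1 + (x - x1), q.2).
have H : pat (D k) (p.1 + (x - x1), p.2) = pat (D k) (q.1 + (x - x1), q.2).
  apply/patP => s; rewrite mem_cat => /orP[/Tlow sT|/mapP[i]].
    by rewrite /= -!addrA strip.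
  rewrite mem_iota => /andP[_ ik] -> /=; have := row _ ik.
  by rewrite (_ : x - i%:Z = x - x1 + (x1 - i%:Z)) ?addrA//; lia.
move=> /(_ H)/patP/(_ (x1 - k%:Z, h)) /=.
rewrite (_ : x - k%:Z = x - x1 + (x1 - k%:Z)); last by lia.
rewrite !addrA => -> //; rewrite mem_cat; apply/orP; right.
by apply/mapP; exists k => //; rewrite mem_iota; lia.
Qed.

(** Strong induction away from the known window in both directions: [right_det] and [left_det] need
    at most n known symbols each. *)
Lemma row_det (p q : Z2) :
  (forall i j : int, h - M%:Z <= j < h ->
     X (p.1 + i) (p.2 + j) = X (q.1 + i) (q.2 + j)) ->
  forall x : int, (forall i, (i < n)%N ->
     X (p.1 + (x + i%:Z)) (p.2 + h) = X (q.1 + (x + i%:Z)) (q.2 + h)) ->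
  forall y : int, X (p.1 + y) (p.2 + h) = X (q.1 + y) (q.2 + h).
Proof.
move=> strip x row y.
have [k kn detr] := right_det; have [l ln detl] := left_det.
have [xy|yx] := lerP x y.
  have -> : y = x + (absz (y - x))%:Z by lia.
  elim/ltn_ind: (absz _) => m IH.
  have [mn|nm] := ltnP m n; first exact: row.
  have -> : x + m%:Z = x + (m - k)%N%:Z + k%:Z by lia.
  apply: detr => // i ik.
  have -> : x + (m - k)%N%:Z + i%:Z = x + (m - k + i)%N%:Z by lia.
  by apply: IH; lia.
have -> : y = x + n%:Z - 1 - (absz (x + n%:Z - 1 - y)%R)%:Z by lia.
elim/ltn_ind: (absz _) => m IH.
have [mn|nm] := ltnP m n.
  have -> : x + n%:Z - 1 - m%:Z = x + (n - 1 - m)%N%:Z by lia.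
  by apply: row; lia.
have -> : x + n%:Z - 1 - m%:Z = x + n%:Z - 1 - (m - l)%N%:Z - l%:Z by lia.
apply: detl => // i il.
have -> : x + n%:Z - 1 - (m - l)%N%:Z - i%:Z = x + n%:Z - 1 - (m - l + i)%N%:Z by lia.
by apply: IH; lia.
Qed.

Lemma pigeon (F : finType) (g : nat -> F) :
  exists a b : nat, (a < b)%N /\ g a = g b.
Proof.
pose f (t : 'I_#|F|.+1) := g t.
have /injectivePn[x [y xy hxy]] : ~~ injectiveb f.
  by apply/negP => /injectiveP /leq_card; rewrite card_ord ltnn.
case: (ltngtP x y) => [l|l|/val_inj e]; last by rewrite e eqxx in xy.
  by exists x, y.
by exists y, x.
Qed.

(** Shifting by a multiple of K does not change the rows below. Two such shifts show the same n
    symbols in the new row, so by [row_det] they agree on all of it and their difference is a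
    period. *)
Lemma strip_periodic_up p K (b : nat) : 0 < K -> strip_periodic p K (h - M%:Z) (h + b%:Z) ->
  exists2 K', 0 < K' & strip_periodic p K' (h - M%:Z) (h + b.+1%:Z).
Proof.
move=> K0 per.
pose g (m : nat) := [tuple X (p.1 + m%:Z * K + i%:Z) (p.2 + h + b%:Z) | i < n].
have [m [m' [mm' e]]] := pigeon g.
exists (K * (m' - m)%N%:Z); first by nia.
move=> i j /andP[jl jh]; have [jb|bj] := ltrP j (h + b%:Z).
  by apply: (strip_periodic_mul (m' - m)%N per); rewrite jl jb.
have -> : j = h + b%:Z by lia.
have H := @row_det (p.1 + m%:Z * K, p.2 + b%:Z) (p.1 + m'%:Z * K, p.2 + b%:Z).
have strip : forall i j : int, h - M%:Z <= j < h ->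
    X (p.1 + m%:Z * K + i) (p.2 + b%:Z + j) =
    X (p.1 + m'%:Z * K + i) (p.2 + b%:Z + j).
  move=> i1 j1 j1h.
  have P a : X (p.1 + i1 + K * a%:Z) (p.2 + (b%:Z + j1)) = X (p.1 + i1) (p.2 + (b%:Z + j1)).
    by apply: (strip_periodic_mul a per); lia.
  have E a : p.1 + a%:Z * K + i1 = p.1 + i1 + K * a%:Z by ring.
  by rewrite !E -!addrA !(addrA p.1) !P.
have row : forall a, (a < n)%N ->
    X (p.1 + m%:Z * K + (0 + a%:Z)) (p.2 + b%:Z + h) =
    X (p.1 + m'%:Z * K + (0 + a%:Z)) (p.2 + b%:Z + h).
  move=> a an; have := congr1 (fun t => tnth t (Ordinal an)) e.
  by rewrite !tnth_mktuple /= !add0r (addrAC p.2).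
have := H strip 0 row (i - m%:Z * K); rewrite /= (addrAC p.2).
rewrite (_ : p.1 + m%:Z * K + (i - m%:Z * K) = p.1 + i); last by ring.
rewrite (_ : p.1 + m'%:Z * K + _ = p.1 + i + K * (m' - m)%N%:Z); last first.
  by rewrite -subzn 1?ltnW//; ring.
by rewrite !addrA => ->.
Qed.

Lemma top_row_growth beta : upper_special -> no_strip_periodic beta -> False.
Proof.
move=> sp nh.
have [p [q [low [x x_ne]]]] : exists p q : Z2,
    (forall i j : int, h - M%:Z <= j < h ->
       X (p.1 + i) (p.2 + j) = X (q.1 + i) (q.2 + j)) /\
    (exists x : int, X (p.1 + x) (p.2 + h) <> X (q.1 + x) (q.2 + h)).
  have [p0 [q0 [low0 [x x_ne]]]] := sp M.
  exists (p0.1, p0.2 - h), (q0.1, q0.2 - h); split; last first.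
    by exists x; rewrite /= !subrK.
  move=> i j jh; rewrite /= -!addrA (addrC _ j); apply: low0; lia.
(* Agreement on n consecutive symbols would spread to the whole row, so the rows of p and q differ
   inside every window. *)
have ne (y : int) : exists2 i, (i < n)%N &
    X (p.1 + (y + i%:Z)) (p.2 + h) <> X (q.1 + (y + i%:Z)) (q.2 + h).
  case: (pselect (forall i, (i < n)%N ->
     X (p.1 + (y + i%:Z)) (p.2 + h) = X (q.1 + (y + i%:Z)) (q.2 + h))).
    by move=> /(row_det low)/(_ x).
  move=> /existsNP[i /not_implyP[i_n neq]]; by exists i.
pose ps (s : int) : Z2 := (p.1 + s, p.2).
(* Hence every [T]-pattern met along the row of p extends to [Q] in two ways, once at p and once at
   q. Since [Q] has at most n more patterns than [T], at most n patterns are met. *)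
have special : (nvalues (pat T) + nvalues (pat T \o ps) <= nvalues (pat Q))%N.
  apply: nvalues_special; first by move=> i j; apply: pat_sub.
  move=> t; exists (q.1 + t, q.2); split.
    by apply/patP => s /Tlow sT; rewrite /= -!addrA low.
  move=> /patP e; have [i i_n] := ne (x0 + t); apply.
  have := e (x0 + i%:Z, h); rewrite Qrow 1?ltnW// => /(_ isT) /=.
  by rewrite (_ : x0 + t + i%:Z = t + (x0 + i%:Z)) ?addrA//; lia.
have le1 : (nvalues (pat T \o ps) <= n)%N.
  by move: cxQ special; rewrite /complexity; lia.
pose rows : seq int := [seq h - 1 - m%:Z | m <- iota 0 M].
have rowsP (r : int) : r \in rows = (h - M%:Z <= r < h).
  apply/mapP/idP => [[m]|rh]; first by rewrite mem_iota => mM ->; lia.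
  by exists (absz (h - 1 - r)%R); [rewrite mem_iota|]; lia.
(* [W k] takes k adjacent points in each of the M rows, and [W n] lies in [T]. The number of its
   patterns along p is positive for k = 0 and at most n for k = n, so it stalls; from there the
   windows move deterministically to the right. *)
pose W k := [seq (xr r + i%:Z, r) | r <- rows, i <- iota 0 k].
have WP k (s : Z2) : s \in W k <-> exists r i, [/\ h - M%:Z <= r < h, (i < k)%N & s = (xr r + i%:Z, r)].
  split=> [/allpairsP[[r i] /= [rr]]|[r [i [rr ik ->]]]].
    by rewrite mem_iota => ik ->; exists r, i; split=> //; rewrite -rowsP.
  by apply/allpairsP; exists (r, i); split; rewrite ?rowsP ?mem_iota.
pose f k := nvalues (pat (W k) \o ps).
have fn : (f n <= n)%N.
  apply: leq_trans le1; apply: nvalues_le => s t; apply: pat_sub => z /WP[r [i [rr i_n ->]]].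
  exact: Trow.
have f0 : (0 < f 0)%N.
  by apply/card_gt0P; exists ((pat (W 0%N) \o ps) 0); apply: value_set_in.
have [|k kn fk] := @chain_stall f n; first by lia.
have subW : {subset W k <= W k.+1}.
  move=> s /WP[r [i [rr ik ->]]]; apply/WP; exists r, i; split=> //; lia.
have det1 s t : pat (W k) (ps s) = pat (W k) (ps t) ->
    pat (W k.+1) (ps s) = pat (W k.+1) (ps t).
  apply: (@nvalues_ker _ _ _ (pat (W k.+1) \o ps) (pat (W k) \o ps) _ fk s t).
  by move=> a b; apply: pat_sub.
have det2 s t : pat (W k) (ps s) = pat (W k) (ps t) ->
    pat (W k) (ps (s + 1)) = pat (W k) (ps (t + 1)).
  move=> /det1/patP e; apply/patP => z /WP[r [i [rr ik ->]]].
  have /e : (xr r + i.+1%:Z, r) \in W k.+1 by apply/WP; exists r, i.+1.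
  rewrite /= (_ : p.1 + (s + 1) + (xr r + i%:Z) = p.1 + s + (xr r + i.+1%:Z)); last by lia.
  by rewrite (_ : p.1 + (t + 1) + (xr r + i%:Z) = p.1 + t + (xr r + i.+1%:Z)); last by lia.
have [K K0 perK] : exists2 K : int, 0 < K & strip_periodic p K (h - M%:Z) (h + 0%N%:Z).
  have := @deterministic_periodic _ (pat (W k) \o ps) det2.
  set K := _%:Z => perK; exists K; first by rewrite /K ltz_nat fact_gt0.
  move=> i j; rewrite addr0 => jh.
  have /patP e := det1 _ _ (perK (i - xr j)).
  have := e (xr j + 0%:Z, j); rewrite /= addr0.
  rewrite (_ : p.1 + _ + xr j = p.1 + i + K); last by lia.
  rewrite (_ : p.1 + _ + xr j = p.1 + i); last by lia.
  by apply; apply/WP; exists j, 0%N; rewrite addr0.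
have [K' K'0 perK'] : exists2 K : int, 0 < K & strip_periodic p K (h - M%:Z) (h + beta%:Z).
  elim: (beta) => [|b [K1 K10 per1]]; first by exists K.
  exact: strip_periodic_up per1.
apply: (nh (p.1, p.2 + h) K' K'0) => i j jb; have := perK' i (h + j).
rewrite /= addrA; apply; lia.
Qed.

End Top.
End Patterns.

(** * Lattice-convex sets *)

Definition lconv (Q : seq Z2) := forall (q1 q2 q3 q4 g : Z2) (w1 w2 w3 w4 : int),
  q1 \in Q -> q2 \in Q -> q3 \in Q -> q4 \in Q ->
  0 <= w1 -> 0 <= w2 -> 0 <= w3 -> 0 <= w4 -> 0 < w1 + w2 + w3 + w4 ->
  (w1 + w2 + w3 + w4) * g.1 = w1 * q1.1 + w2 * q2.1 + w3 * q3.1 + w4 * q4.1 ->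
  (w1 + w2 + w3 + w4) * g.2 = w1 * q1.2 + w2 * q2.2 + w3 * q3.2 + w4 * q4.2 ->
  g \in Q.

Lemma seq_argmax (f : Z2 -> int) (Q : seq Z2) : Q != [::] ->
  exists2 q : Z2, q \in Q & forall s : Z2, s \in Q -> f s <= f q.
Proof.
elim: Q => // a [|b Q] IH _.
  by exists a => [|s]; rewrite inE // => /eqP->.
have [//|q qQ qm] := IH.
have [fa|fa] := lerP (f a) (f q).
  exists q => [|s]; first by rewrite inE qQ orbT.
  by rewrite inE => /orP[/eqP->//|/qm].
exists a => [|s]; first by rewrite inE eqxx.
by rewrite inE => /orP[/eqP->//|/qm le]; apply: le_trans le (ltW fa).
Qed.

Definition hrow (h : int) (Q : seq Z2) := [seq s <- Q | s.2 == h].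

Lemma row_interval (Q : seq Z2) h : uniq Q -> lconv Q -> hrow h Q != [::] ->
  exists x0 : int, (forall i, (i < size (hrow h Q))%N -> (x0 + i%:Z, h) \in Q) /\
    (forall s : Z2, s \in Q -> s.2 = h ->
       exists2 i, (i < size (hrow h Q))%N & s = (x0 + i%:Z, h)).
Proof.
move=> uQ cQ ne.
have [a aQ am] := seq_argmax (fun s => - s.1) ne.
have [b bQ bm] := seq_argmax (fun s => s.1) ne.
move: aQ bQ; rewrite !mem_filter => /andP[/eqP ah aQ] /andP[/eqP bh bQ].
have ab : a.1 <= b.1 by apply: bm; rewrite mem_filter ah eqxx.
pose m := (absz (b.1 - a.1)%R).+1.
have mem i : (i < m)%N -> (a.1 + i%:Z, h) \in Q.
  move=> im; have [e|ne1] := eqVneq (b.1 - a.1) 0.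
    have -> : i = 0%N by move: im; rewrite /m e; lia.
    by rewrite addr0 -ah -surjective_pairing.
  move: im; rewrite /m => im.
  apply: (cQ a a b b _ (b.1 - a.1 - i%:Z) 0 i%:Z 0) => //=; rewrite ?ah ?bh;
    by [lia|ring].
have mem2 (s : Z2) : s \in Q -> s.2 = h -> exists2 i, (i < m)%N & s = (a.1 + i%:Z, h).
  move=> sQ sh; have s1 : s \in hrow h Q by rewrite mem_filter sh eqxx.
  exists (absz (s.1 - a.1)%R); first by have := am _ s1; have := bm _ s1; rewrite /m; lia.
  have := am _ s1; case: s sh {sQ s1} => s1 s2 /= -> le; congr (_, _); lia.
have sz : size (hrow h Q) = m.
  have -> : m = size [seq (a.1 + i%:Z, h) | i <- iota 0 m] by rewrite size_map size_iota.
  apply/perm_size/uniq_perm.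
  - exact: filter_uniq.
  - by rewrite map_inj_uniq ?iota_uniq// => i j [] /addrI [].
  move=> s; rewrite mem_filter; apply/andP/mapP.
    by case=> /eqP sh /mem2 /(_ sh)[i im ->]; exists i => //; rewrite mem_iota.
  by case=> i; rewrite mem_iota => im ->; split=> //; apply: mem.
by rewrite sz; exists a.1.
Qed.

Section Bound.
Variables (B : finType) (X : int -> int -> B).

Lemma ceil_exists (N d : int) : 0 < d -> exists x : int, N <= d * x < N + d.
Proof.
move=> d0; exists (- ((- N) %/ d)%Z).
have dn : d != 0 by lia.
have := divz_eq (- N) d; have := ltz_pmod (- N) d0; have := modz_ge0 (- N) dn.
by nia.
Qed.

Lemma top_row_step (Q : seq Z2) hi lo beta :
  upper_special X -> no_strip_periodic X beta ->
  uniq Q -> lconv Q -> lo < hi ->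
  (forall s : Z2, s \in Q -> lo <= s.2 <= hi) ->
  hrow hi Q != [::] -> (size (hrow hi Q) <= size (hrow lo Q))%N ->
  (complexity X [seq s <- Q | s.2 != hi] + size (hrow hi Q) <= complexity X Q)%N.
Proof.
move=> sp nh uQ cQ lohi bd ne le.
have ne' : hrow lo Q != [::].
  by rewrite -size_eq0 -lt0n (leq_trans _ le)// lt0n size_eq0.
have [xt [top1 top2]] := row_interval uQ cQ ne.
have [xb [bot1 _]] := row_interval uQ cQ ne'.
have [n nE] : exists n, size (hrow hi Q) = n.+1.
  by case: (hrow hi Q) ne => // a l _; exists (size l).
rewrite leqNgt; apply/negP => lt.
rewrite nE in top1 top2 le lt.
pose d := hi - lo.
(* Interpolating between n + 1 points of the top row and as many of the bottom row gives, at height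
   r, a real interval of length n. Starting from the ceiling of its left end it contains n
   consecutive integers; this is where the bottom row must not be the shorter one. *)
have Hx (r : int) : exists x : int, lo <= r < hi -> forall i, (i < n)%N -> (x + i%:Z, r) \in Q.
  have d0 : 0 < d by rewrite /d; lia.
  have [x xP] := ceil_exists ((hi - r) * xb + (r - lo) * xt) d0.
  exists x => rr i i_n.
  pose D := d * n%:Z; pose y := d * (x + i%:Z) - ((hi - r) * xb + (r - lo) * xt).
  have D0 : 0 < D by rewrite /D; nia.
  have y0 : 0 <= y by rewrite /y; nia.
  have yD : y <= D by rewrite /y /D; nia.
  have t1 := top1 0%N isT; have t2 := top1 n (ltnSn n).
  have b1 := bot1 0%N (leq_trans (ltn0Sn _) le); have b2 := bot1 n le.
  (* The weights are bilinear: height between the two rows times position y out of D along them.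
     They involve two ends of each row, hence four points in [lconv]. *)
  apply: (cQ _ _ _ _ _ ((r - lo) * (D - y)) ((r - lo) * y) ((hi - r) * (D - y)) ((hi - r) * y) t1 t2 b1 b2).
  - by nia.
  - by nia.
  - by nia.
  - by nia.
  - have : 0 < (hi - lo) * D by rewrite pmulr_rgt0//; lia.
    by congr (_ < _); ring.
  - by rewrite /= /D /y /d; ring.
  - by rewrite /= /D /y /d; ring.
have [xr xrP] := choice Hx.
have := @top_row_growth _ X [seq s <- Q | s.2 != hi] Q hi xt (absz d) n xr.
have dE : (absz d)%:Z = hi - lo by rewrite /d; lia.
apply.
- by move=> s; rewrite mem_filter => /andP[].
- by [].
- move=> s sQ; have [sh|sh] := eqVneq s.2 hi; last by left; rewrite mem_filter sh.
  by right; apply: top2.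
- by case=> s1 s2; rewrite mem_filter dE => /andP[/= sh /bd /=]; lia.
- move=> r i; rewrite dE => rr i_n; rewrite mem_filter /= xrP//; last by lia.
  by rewrite andbT; lia.
- lia.
- exact: sp.
- exact: nh.
Qed.

(** One-dimensional Morse-Hedlund. A stalled step makes every row of X periodic; the period from
    [deterministic_periodic] depends only on the number of possible states, so it is the same for
    all rows. *)
Lemma single_row_bound (Q : seq Z2) h beta : no_strip_periodic X beta ->
  uniq Q -> lconv Q -> hrow h Q != [::] -> (forall s : Z2, s \in Q -> s.2 = h) ->
  (size Q + complexity X [:: (0%R, 0%R)] <= complexity X Q + 1)%N.
Proof.
move=> nh uQ cQ ne hQ.
have rQ : hrow h Q = Q.
  by apply/all_filterP/allP => s /hQ ->.
have [x0 [mem1 mem2]] := row_interval uQ cQ ne.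
rewrite rQ in mem1 mem2 ne.
have [n nE] : exists n, size Q = n.+1.
  by case: (Q) ne => // a l _; exists (size l).
rewrite leqNgt; apply/negP => lt.
pose D k := [seq (x0 + i%:Z, h) | i <- iota 0 k.+1].
have Dn : complexity X (D n) = complexity X Q.
  apply: complexity_eq_mem => s; apply/mapP/idP => [[i]|sQ].
    by rewrite mem_iota => i_n ->; apply: mem1; rewrite nE.
  by have [i i_n ->] := mem2 _ sQ (hQ _ sQ); exists i => //; rewrite mem_iota -nE.
have D0 : complexity X (D 0%N) = complexity X [:: (0%R, 0%R)].
  apply/eqP; rewrite eqn_leq; apply/andP; split.
    rewrite [X in (_ <= X)%N](_ : _ = nvalues (pat X [:: (0%R, 0%R)])) //.
    have := @nvalues_comp _ _ _ (pat X [:: (0%R, 0%R)]) (fun p : Z2 => (p.1 + x0, p.2 + h)).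
    apply: leq_trans; apply: nvalues_le => p q; rewrite /comp => /patP e; apply/patP => s.
    rewrite inE => /eqP->; have := e (0, 0); rewrite inE eqxx /= !addr0 => /(_ isT).
    by [].
  have := @nvalues_comp _ _ _ (pat X (D 0%N)) (fun p : Z2 => (p.1 - x0, p.2 - h)).
  apply: leq_trans; apply: nvalues_le => p q; rewrite /comp => /patP e; apply/patP => s.
  rewrite inE => /eqP->; have := e (x0 + 0, h); rewrite inE eqxx /= !addr0 !subrK.
  exact.
have [|k kn le] := @chain_stall (fun k => complexity X (D k)) n.
  by rewrite Dn D0; lia.
have sub : {subset D k <= D k.+1}.
  move=> s /mapP[i]; rewrite mem_iota => ik ->; apply/mapP; exists i => //.
  by rewrite mem_iota; lia.
have det := complexity_ker sub le.
have per j (i : int) : pat X (D k) (i + ((#|{: (size (D k)).-tuple B}|)`!)%:Z, j) = pat X (D k) (i, j).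
  apply: (@deterministic_periodic _ (fun i => pat X (D k) (i, j))) => a b /det /patP e.
  apply/patP => s /mapP[l]; rewrite mem_iota => lk -> /=.
  have /e : (x0 + l.+1%:Z, h) \in D k.+1.
    by apply/mapP; exists l.+1 => //; rewrite mem_iota; lia.
  rewrite /= (_ : a + 1 + (x0 + l%:Z) = a + (x0 + l.+1%:Z)); last by lia.
  by rewrite (_ : b + 1 + (x0 + l%:Z) = b + (x0 + l.+1%:Z)); last by lia.
move: per; set K := _%:Z => per.
have K0 : 0 < K by rewrite /K ltz_nat fact_gt0.
apply: (nh (0, 0) K K0) => i j _; rewrite /= !add0r.
have /patP/(_ (x0 + 0%:Z, h)) := per (j - h) (i - x0).
rewrite /= addr0 subrK (addrAC i) subrK subrK; apply.
by apply/mapP; exists 0%N; rewrite ?mem_iota ?addr0.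
Qed.

End Bound.

Definition vflip (B : finType) (X : int -> int -> B) := fun i j => X i (- j).
Definition pflip (s : Z2) : Z2 := (s.1, - s.2).

Lemma pflipK : involutive pflip.
Proof. by case=> a b; rewrite /pflip /= opprK. Qed.

Lemma mem_pflip (Q : seq Z2) s : (s \in map pflip Q) = (pflip s \in Q).
Proof. by rewrite -{1}(pflipK s) (mem_map (inv_inj pflipK)). Qed.

Lemma complexity_vflip (B : finType) (X : int -> int -> B) (Q : seq Z2) :
  complexity (vflip X) (map pflip Q) = complexity X Q.
Proof.
have H (Y : int -> int -> B) (P : seq Z2) : (complexity (vflip Y) (map pflip P) <= complexity Y P)%N.
  have := @nvalues_comp _ _ _ (pat Y P) pflip; apply: leq_trans.
  apply: nvalues_le => p q; rewrite /comp => /patP e; apply/patP => s.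
  rewrite mem_pflip => /e; rewrite /vflip /pflip /= !opprD.
  by [].
apply/eqP; rewrite eqn_leq H /=.
have := H (vflip X) (map pflip Q); rewrite -map_comp (eq_map (g := id)) ?map_id//; last exact: pflipK.
rewrite (_ : vflip (vflip X) = X) //.
by apply: funext => i; apply: funext => j; rewrite /vflip opprK.
Qed.

Lemma lconv_pflip Q : lconv Q -> lconv (map pflip Q).
Proof.
move=> cQ q1 q2 q3 q4 g w1 w2 w3 w4; rewrite !mem_pflip => h1 h2 h3 h4 p1 p2 p3 p4 W e1 e2.
apply: (cQ _ _ _ _ _ w1 w2 w3 w4 h1 h2 h3 h4) => //=.
by rewrite mulrN e2; ring.
Qed.

Lemma no_strip_periodic_vflip (B : finType) (X : int -> int -> B) beta :
  no_strip_periodic X beta -> no_strip_periodic (vflip X) beta.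
Proof.
(* Reflection reverses the [beta] rows of the strip, whose lowest row becomes - p.2 - beta + 1. *)
move=> nh p K K0 per; apply: (nh (p.1, - p.2 - beta%:Z + 1) K K0) => i j jb /=.
have := per i (beta%:Z - 1 - j); rewrite /vflip.
rewrite (_ : - (p.2 + (beta%:Z - 1 - j)) = - p.2 - beta%:Z + 1 + j); last by lia.
by apply; lia.
Qed.

(** The top row is a face: weighted means of points at height at most hi - 1 stay at height at most
    hi - 1. *)
Lemma lconv_filter_lt (Q : seq Z2) hi : lconv Q ->
  (forall s : Z2, s \in Q -> s.2 <= hi) -> lconv [seq s <- Q | s.2 != hi].
Proof.
move=> cQ bd [a1 b1] [a2 b2] [a3 b3] [a4 b4] [g1 g2] w1 w2 w3 w4.
rewrite !mem_filter /= => /andP[n1 h1] /andP[n2 h2] /andP[n3 h3] /andP[n4 h4].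
move=> p1 p2 p3 p4 W e1 e2.
rewrite (cQ _ _ _ _ _ w1 w2 w3 w4 h1 h2 h3 h4)// andbT.
have /= l1 := bd _ h1; have /= l2 := bd _ h2.
have /= l3 := bd _ h3; have /= l4 := bd _ h4.
have k1 : w1 * b1 <= w1 * (hi - 1) by apply: ler_wpM2l => //; lia.
have k2 : w2 * b2 <= w2 * (hi - 1) by apply: ler_wpM2l => //; lia.
have k3 : w3 * b3 <= w3 * (hi - 1) by apply: ler_wpM2l => //; lia.
have k4 : w4 * b4 <= w4 * (hi - 1) by apply: ler_wpM2l => //; lia.
by apply/eqP => ge; rewrite ge in e2; lia.
Qed.

(** Induction on the size of Q. Of the top and the bottom row the one that is not longer is removed,
    as [top_row_step] requires; a reflection reduces the bottom to the top. *)
Lemma lconv_complexity (B : finType) (X : int -> int -> B) beta Q :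
  upper_special X -> upper_special (vflip X) -> no_strip_periodic X beta ->
  uniq Q -> lconv Q -> Q != [::] ->
  (size Q + complexity X [:: (0%R, 0%R)] <= complexity X Q + 1)%N.
Proof.
move=> up dn nh; elim/(ltn_ind) : {Q}(size Q) {-2}Q (erefl (size Q)) => m IH Q sQ uQ cQ ne.
have [a aQ am] := seq_argmax (fun s => - s.2) ne.
have [b bQ bm] := seq_argmax (fun s => s.2) ne.
pose lo := a.2; pose hi := b.2.
have bd (s : Z2) : s \in Q -> lo <= s.2 <= hi.
  by move=> sQ1; rewrite /lo /hi bm// andbT; have := am _ sQ1; rewrite lerN2.
have rhi : hrow hi Q != [::].
  have hb : b \in hrow hi Q by rewrite mem_filter eqxx.
  by apply/eqP => e; rewrite e in hb.
have rlo : hrow lo Q != [::].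
  have ha : a \in hrow lo Q by rewrite mem_filter eqxx.
  by apply/eqP => e; rewrite e in ha.
have [e|lohi] := eqVneq lo hi.
  apply: (single_row_bound nh uQ cQ rhi) => s /bd; rewrite e; lia.
have lt : lo < hi by have := bd _ aQ; rewrite -/lo; lia.
have szs h : (size [seq s <- Q | s.2 != h] + size (hrow h Q) = size Q)%N.
  by rewrite /hrow !size_filter addnC -(count_predC (fun s : Z2 => s.2 == h)).
have [le|gt] := leqP (size (hrow hi Q)) (size (hrow lo Q)).
  have st := top_row_step up nh uQ cQ lt bd rhi le.
  have r0 : (0 < size (hrow hi Q))%N by rewrite lt0n size_eq0.
  have aT : a \in [seq s <- Q | s.2 != hi] by rewrite mem_filter aQ andbT.
  have H : (size [seq s <- Q | s.2 != hi] + complexity X [:: (0%R, 0%R)] <=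
     complexity X [seq s <- Q | s.2 != hi] + 1)%N.
    apply: (IH (size [seq s <- Q | s.2 != hi])) => //.
    - by rewrite -sQ -(szs hi); lia.
    - exact: filter_uniq.
    - by apply: lconv_filter_lt => // s /bd /andP[].
    - by apply/negP => /eqP e; rewrite e in aT.
  rewrite -(szs hi) addnAC (leq_trans (leq_add H (leqnn _)))//.
  by rewrite addnAC leq_add2r.
have st := @top_row_step _ (vflip X) (map pflip Q) (- lo) (- hi) beta dn (no_strip_periodic_vflip nh).
have rowE h : hrow (- h) (map pflip Q) = map pflip (hrow h Q).
  by rewrite /hrow filter_map; congr map; apply: eq_filter => s /=; rewrite eqr_opp.
have TE : [seq s <- map pflip Q | s.2 != - lo] = map pflip [seq s <- Q | s.2 != lo].
  by rewrite filter_map; congr map; apply: eq_filter => s /=; rewrite eqr_opp.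
move: st; rewrite TE !rowE !size_map !complexity_vflip => st.
have {}st : (complexity X [seq s <- Q | s.2 != lo] + size (hrow lo Q) <= complexity X Q)%N.
  apply: st.
  - by rewrite map_inj_uniq//; apply: inv_inj pflipK.
  - exact: lconv_pflip.
  - lia.
  - by move=> s; rewrite mem_pflip => /bd /=; lia.
  - by case: (hrow lo Q) rlo.
  - exact: ltnW.
have r0 : (0 < size (hrow lo Q))%N by rewrite lt0n size_eq0.
have bT : b \in [seq s <- Q | s.2 != lo] by rewrite mem_filter bQ andbT eq_sym.
have H : (size [seq s <- Q | s.2 != lo] + complexity X [:: (0%R, 0%R)] <=
     complexity X [seq s <- Q | s.2 != lo] + 1)%N.
  apply: (IH (size [seq s <- Q | s.2 != lo])) => //.
  - by rewrite -sQ -(szs lo); lia.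
  - exact: filter_uniq.
  - have -> : [seq s <- Q | s.2 != lo] = map pflip [seq s <- map pflip Q | s.2 != - lo].
      by rewrite TE -map_comp (eq_map (g := id)) ?map_id//; exact: pflipK.
    apply: lconv_pflip; apply: lconv_filter_lt; first exact: lconv_pflip.
    by move=> s; rewrite mem_pflip => /bd /=; lia.
  - by apply/negP => /eqP e; rewrite e in bT.
rewrite -(szs lo) addnAC (leq_trans (leq_add H (leqnn _)))//.
by rewrite addnAC leq_add2r.
Qed.

(** * Complexity of a solution of (X^u - 1)(X^b - 1) c = 0 *)

(** Reduces a consequence of a linear relation z = t to an identity that [ring] can prove. *)
Lemma eq_by_sub (V : zmodType) (x y z t : V) : z = t -> x - y = z - t -> x = y.
Proof. by move=> ->; rewrite subrr => /eqP; rewrite subr_eq0 => /eqP. Qed.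

Section Special.
Variables (V : comNzRingType) (c : int -> int -> V) (a b : nat) (b1 : int).
Variable vals : seq V.
Hypothesis cvals : forall i j, c i j \in vals.
Hypothesis a0 : (0 < a)%N.
Hypothesis b0 : (0 < b)%N.
Hypothesis rel : forall i j : int,
  c (i + a%:Z + b1) (j + b%:Z) + c i j = c (i + a%:Z) j + c (i + b1) (j + b%:Z).
Hypothesis nper1 : forall K : nat, (0 < K)%N ->
  ~ (forall i j : int, c (i + K%:Z) j = c i j).
Hypothesis nper2 : forall K : nat, (0 < K)%N ->
  ~ (forall i j : int, c (i + K%:Z * b1) (j + K%:Z * b%:Z) = c i j).

Variables (B : finType) (X : int -> int -> B) (rho : nat).
Hypothesis Xc : forall i j i' j', X i j = X i' j' -> c i j = c i' j'.
Hypothesis Xloc : forall i j i' j' : int,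
  (forall x y : int, - rho%:Z <= y <= rho%:Z -> c (i + x) (j + y) = c (i' + x) (j' + y)) ->
  X i j = X i' j'.

Lemma rel_a (m : nat) i j :
  c (i + (m * a)%N%:Z + b1) (j + b%:Z) - c (i + (m * a)%N%:Z) j =
  c (i + b1) (j + b%:Z) - c i j.
Proof.
elim: m i => [|m IH] i; first by rewrite mul0n addr0.
have r := rel (i + (m * a)%N%:Z) j.
rewrite -(IH i) mulSn PoszD (addrC a%:Z) addrA.
by apply: (eq_by_sub r); ring.
Qed.

(** For k = |K| a the difference E = (X^k - 1) c is invariant under (b1, b), because X^a - 1 divides
    X^k - 1. If b consecutive rows had period K, then E would vanish there and, by invariance,
    everywhere. *)
Lemma special_no_strip_periodic : no_strip_periodic X b.
Proof.
move=> p K K0 per.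
pose k := (absz K * a)%N.
have k0 : (0 < k)%N by rewrite /k; nia.
pose E i j := c (i + k%:Z) j - c i j.
have Eb i j : E (i + b1) (j + b%:Z) = E i j.
  rewrite /E; have := rel_a (absz K) i j; rewrite -/k => e.
  by rewrite (addrAC i); apply: (eq_by_sub e); ring.
have Ebm (m : nat) i j : E (i + m%:Z * b1) (j + m%:Z * b%:Z) = E i j.
  elim: m => [|m IH]; first by rewrite !mul0r !addr0.
  rewrite -IH -[RHS]Eb; congr E; rewrite -(addn1 m) PoszD; ring.
have Ebz (m : int) i j : E (i + m * b1) (j + m * b%:Z) = E i j.
  case: (lerP 0 m) => m0.
    by have := Ebm (absz m) i j; rewrite (_ : (absz m)%:Z = m); last by lia.
  have := Ebm (absz m) (i + m * b1) (j + m * b%:Z).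
  rewrite (_ : (absz m)%:Z = - m); last by lia.
  by rewrite !mulNr !addrK => ->.
have E0 i j : 0 <= j < b%:Z -> E (p.1 + i) (p.2 + j) = 0.
  move=> jb; rewrite /E /k; apply/eqP; rewrite subr_eq0; apply/eqP/Xc.
  have := strip_periodic_mul a per i jb.
  have -> : K * a%:Z = (absz K * a)%N%:Z by rewrite PoszM; congr (_ * _); lia.
  exact.
apply: (nper1 k0) => i j; apply/eqP; rewrite -subr_eq0 -/(E i j).
have bn : b%:Z != 0 by lia.
have dE := divz_eq (j - p.2) b%:Z; set q := (_ %/ _)%Z in dE.
have jr : 0 <= ((j - p.2) %% b%:Z)%Z < b%:Z by rewrite modz_ge0//= ltz_pmod.
have := E0 (i - q * b1 - p.1) _ jr; rewrite -(Ebz q).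
rewrite (_ : p.1 + (i - q * b1 - p.1) + q * b1 = i); last by ring.
by rewrite (_ : p.2 + ((j - p.2) %% b%:Z)%Z + q * b%:Z = j) ?(rwP eqP)//; lia.
Qed.

Lemma special_upper : upper_special X.
Proof.
pose m := (size vals).+1.
(* The state n records c on the a x b box at n (b1, b). By [rel] the change of c under n (b1, b) is
   horizontally a-periodic, so equal states force equality on b full rows. *)
pose s (n : int) : {ffun 'I_a * 'I_b -> 'I_m} :=
  [ffun z : 'I_a * 'I_b =>
     inord (index (c (n * b1 + (z.1 : nat)%:Z) (n * b%:Z + (z.2 : nat)%:Z)) vals)].
have sE (n n' : int) : s n = s n' -> forall i j : int, 0 <= j < b%:Z ->
    c (n * b1 + i) (n * b%:Z + j) = c (n' * b1 + i) (n' * b%:Z + j).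
  move=> e.
  have base x y : (x < a)%N -> (y < b)%N ->
      c (n * b1 + x%:Z) (n * b%:Z + y%:Z) = c (n' * b1 + x%:Z) (n' * b%:Z + y%:Z).
    move=> xa yb; have := congr1 (fun f : {ffun _ -> _} => val (f (Ordinal xa, Ordinal yb))) e.
    rewrite !ffunE /= !inordK ?ltnS ?index_size// => ei.
    by rewrite -(nth_index 0 (cvals (n * b1 + x%:Z) (n * b%:Z + y%:Z))) ei nth_index.
  pose D n i j := c (i + n * b1) (j + n * b%:Z) - c i j.
  have D1 (k : nat) i j : D k%:Z (i + a%:Z) j = D k%:Z i j.
    elim: k => [|k IH]; first by rewrite /D !mul0r !addr0 !subrr.
    have r := rel_a 1 (i + k%:Z * b1) (j + k%:Z * b%:Z); rewrite mul1n in r.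
    move: IH; rewrite /D -(addn1 k) !PoszD !mulrDl !mul1r !addrA.
    rewrite (addrAC i a%:Z) => IH.
    by apply: (eq_by_sub (congr2 +%R r IH)); ring.
  have Da n0 i j : D n0 (i + a%:Z) j = D n0 i j.
    case: (lerP 0 n0) => n00.
      by rewrite (_ : n0 = (absz n0)%:Z); last by lia.
    have := D1 (absz n0) (i + n0 * b1) (j + n0 * b%:Z); rewrite /D.
    rewrite (_ : (absz n0)%:Z = - n0); last by lia.
    rewrite !mulNr !addrK (addrAC i) addrK => e1.
    by apply: (eq_by_sub (esym e1)); ring.
  have Daz (k : int) i j : D n (i + k * a%:Z) j - D n' (i + k * a%:Z) j = D n i j - D n' i j.
    have H (l : nat) i0 : D n (i0 + l%:Z * a%:Z) j - D n' (i0 + l%:Z * a%:Z) j = D n i0 j - D n' i0 j.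
      elim: l => [|l IH]; first by rewrite mul0r addr0.
      by rewrite -(addn1 l) PoszD mulrDl mul1r addrA !Da.
    case: (lerP 0 k) => k0.
      by rewrite (_ : k = (absz k)%:Z) ?H; last by lia.
    have := H (absz k) (i + k * a%:Z); rewrite (_ : (absz k)%:Z = - k); last by lia.
    by rewrite mulNr addrK => ->.
  move=> i j jb.
  have an : a%:Z != 0 by lia.
  have iE := divz_eq i a%:Z; set q := (_ %/ _)%Z in iE; set r := (_ %% _)%Z in iE.
  have r0 : 0 <= r by apply: modz_ge0.
  have ra : r < a%:Z by apply: ltz_pmod; lia.
  have := Daz q r j; rewrite /D (addrC r) -iE.
  have ra' : (absz r < a)%N by lia.
  have jb' : (absz j < b)%N by lia.
  have := base _ _ ra' jb'; rewrite (_ : (absz r)%:Z = r) 1?(_ : (absz j)%:Z = j); try lia.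
  rewrite ![_ * _ + _]addrC => ->; rewrite subrr => /eqP; rewrite subr_eq0 => /eqP /addIr.
  exact.
have sper (K : nat) : (0 < K)%N -> ~ (forall n : int, s (n + K%:Z) = s n).
  move=> K0 per; apply: (nper2 K0) => i j.
  have jE := divz_eq j b%:Z; set q := (_ %/ _)%Z in jE; set r := (_ %% _)%Z in jE.
  have bn : b%:Z != 0 by lia.
  have r0 : 0 <= r < b%:Z by rewrite modz_ge0//= ltz_pmod//; lia.
  have := sE _ _ (per q) (i - q * b1) r r0.
  rewrite (_ : q * b1 + (i - q * b1) = i); last by ring.
  rewrite -jE (_ : (q + K%:Z) * b1 + (i - q * b1) = i + K%:Z * b1); last by ring.
  by rewrite (_ : (q + K%:Z) * b%:Z + r = j + K%:Z * b%:Z)//; rewrite [in RHS]jE; ring.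
(* A row of X sees c up to rho rows away, and X first differs no lower than row - rho. The M rows
   below that difference involve c down to depth M + 2 rho at most. *)
move=> M; pose W := (M + 2 * rho).+1.
pose st (n : int) : {ffun 'I_W -> {ffun 'I_a * 'I_b -> 'I_m}} :=
  [ffun k : 'I_W => s (n - (k : nat)%:Z - 1)].
have stE (n n' : int) : st n = st n' -> forall k : nat, (k < W)%N ->
    s (n - k%:Z - 1) = s (n' - k%:Z - 1).
  move=> e k kW; have := congr1 (fun f : {ffun _ -> _} => f (Ordinal kW)) e.
  by rewrite !ffunE.
(* If W past states always determined the next one, the states would be periodic, and with them c
   along (b1, b). *)
have [n [n' [ste sne]]] : exists n n' : int, st n = st n' /\ s n <> s n'.
  apply: contrapT => no.
  have det (n n' : int) : st n = st n' -> st (n + 1) = st (n' + 1).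
    move=> e; apply/ffunP => -[[|k] kW]; rewrite !ffunE /= ?subr0 ?addrK.
      by apply: contrapT => ne; apply: no; exists n, n'.
    rewrite (_ : n + 1 - k.+1%:Z - 1 = n - k%:Z - 1); last by lia.
    rewrite (_ : n' + 1 - k.+1%:Z - 1 = n' - k%:Z - 1); last by lia.
    by apply: stE => //; apply: ltnW.
  have [K K0 per] : exists2 K, (0 < K)%N & forall i, st (i + K%:Z) = st i.
    by eexists; last exact: deterministic_periodic det; exact: fact_gt0.
  apply: (sper _ K0) => n.
  by have := stE _ _ (per (n + 1)) 0%N isT; rewrite !subr0 (addrAC n) !addrK.
have low : forall i j : int, - (W * b)%N%:Z <= j < 0 ->
    c (n * b1 + i) (n * b%:Z + j) = c (n' * b1 + i) (n' * b%:Z + j).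
  move=> i j jW.
  have jE := divz_eq j b%:Z; set q := (_ %/ _)%Z in jE; set r := (_ %% _)%Z in jE.
  have bn : b%:Z != 0 by lia.
  have r0 : 0 <= r < b%:Z by rewrite modz_ge0//= ltz_pmod//; lia.
  have q0 : q < 0 by nia.
  have qW : - W%:Z <= q by nia.
  have kW : (absz (- q - 1)%R < W)%N by lia.
  have := stE _ _ ste _ kW.
  rewrite (_ : n - (absz (- q - 1)%R)%:Z - 1 = n + q); last by lia.
  rewrite (_ : n' - (absz (- q - 1)%R)%:Z - 1 = n' + q); last by lia.
  move=> /sE/(_ (i - q * b1) _ r0).
  rewrite (_ : (n + q) * b1 + (i - q * b1) = n * b1 + i); last by ring.
  rewrite (_ : (n' + q) * b1 + (i - q * b1) = n' * b1 + i); last by ring.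
  by rewrite jE !mulrDl -!addrA.
have [x [y [yb xy]]] : exists x y : int, 0 <= y < b%:Z /\
    c (n * b1 + x) (n * b%:Z + y) <> c (n' * b1 + x) (n' * b%:Z + y).
  apply: contrapT => no; apply: sne; apply/ffunP => z; rewrite !ffunE.
  congr (inord (index _ _)); apply: contrapT => ne; apply: no.
  by exists (z.1 : nat)%:Z, (z.2 : nat)%:Z; split=> //; have := ltn_ord z.2; lia.
(* The lowest row, counted from - rho, where X differs. Below it X agrees by minimality down to -
   rho and by locality further down. *)
pose bad (k : nat) := `[< exists i : int,
  X (n * b1 + i) (n * b%:Z - rho%:Z + k%:Z) <> X (n' * b1 + i) (n' * b%:Z - rho%:Z + k%:Z) >].
have exbad : exists k, bad k.
  exists (absz (y + rho%:Z)); apply/asboolP; exists x.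
  rewrite (_ : (absz (y + rho%:Z))%:Z = y + rho%:Z); last by lia.
  rewrite (_ : n * b%:Z - rho%:Z + (y + rho%:Z) = n * b%:Z + y); last by ring.
  by rewrite (_ : n' * b%:Z - rho%:Z + (y + rho%:Z) = n' * b%:Z + y); [move/Xc|ring].
case: (ex_minnP exbad) => t /asboolP[x0 xt] tmin.
exists (n * b1, n * b%:Z - rho%:Z + t%:Z), (n' * b1, n' * b%:Z - rho%:Z + t%:Z).
split; last by exists x0.
move=> i j jM /=.
case: (lerP 0 (t%:Z + j)) => tj.
  apply: contrapT => ne; have : bad (absz (t%:Z + j)).
    apply/asboolP; exists i; rewrite (_ : (absz (t%:Z + j))%:Z = t%:Z + j); last by lia.
    by rewrite !addrA.
  by move=> /tmin; lia.
apply: Xloc => u v uv; rewrite -!addrA; apply: low.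
by rewrite /W; nia.
Qed.

End Special.

Section SpecialBound.
Variables (V : comNzRingType) (c : int -> int -> V) (a : nat).
Variable vals : seq V.
Hypothesis cvals : forall i j, c i j \in vals.
Hypothesis a0 : (0 < a)%N.
Hypothesis nper1 : forall K : nat, (0 < K)%N ->
  ~ (forall i j : int, c (i + K%:Z) j = c i j).
Variables (B : finType) (X : int -> int -> B) (rho : nat).
Hypothesis Xc : forall i j i' j', X i j = X i' j' -> c i j = c i' j'.
Hypothesis Xloc : forall i j i' j' : int,
  (forall x y : int, - rho%:Z <= y <= rho%:Z -> c (i + x) (j + y) = c (i' + x) (j' + y)) ->
  X i j = X i' j'.

Lemma special_bound (b b1 : int) (Q : seq Z2) :
  b != 0 ->
  (forall i j : int,
    c (i + a%:Z + b1) (j + b) + c i j = c (i + a%:Z) j + c (i + b1) (j + b)) ->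
  (forall K : nat, (0 < K)%N ->
    ~ (forall i j : int, c (i + K%:Z * b1) (j + K%:Z * b) = c i j)) ->
  uniq Q -> lconv Q -> Q != [::] ->
  (size Q + complexity X [:: (0%R, 0%R)] <= complexity X Q + 1)%N.
Proof.
move=> b0 rel nper2; wlog bpos : b b1 b0 rel nper2 / 0 < b.
  move=> H; case: (ltrP 0 b) => bs; first exact: (H b b1).
  apply: (H (- b) (- b1)); rewrite ?oppr_eq0//; last by lia.
    move=> i j; have := rel (i - b1) (j - b).
    rewrite !subrK (_ : i - b1 + a%:Z + b1 = i + a%:Z); last by ring.
    rewrite (_ : i - b1 + a%:Z = i + a%:Z - b1); last by ring.
    by move=> e; apply: (eq_by_sub (esym e)); ring.
  move=> K K0 per. apply: (nper2 _ K0) => i j.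
  have := per (i + K%:Z * b1) (j + K%:Z * b).
  by rewrite !mulrN !addrK => ->.
have bE : b = (absz b)%:Z by lia.
have b0' : (0 < absz b)%N by lia.
rewrite bE in rel nper2.
apply: (@lconv_complexity _ X (absz b)).
- exact: (special_upper cvals a0 b0' rel nper2 Xc Xloc).
(* Reflection turns (b1, b) into (b1, - b); its negative (- b1, b) has positive height again. *)
- apply: (@special_upper V (fun i j => c i (- j)) a (absz b) (- b1) vals _ a0 b0' _ _ _ (vflip X) rho).
  + by move=> i j.
  + move=> i j; have := rel (i - b1) (- j - (absz b)%:Z).
    rewrite !subrK (_ : i - b1 + a%:Z + b1 = i + a%:Z); last by ring.
    rewrite (_ : i - b1 + a%:Z = i + a%:Z - b1); last by ring.
    by rewrite !opprD => e; apply: (eq_by_sub (esym e)); ring.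
  + move=> K K0 per; apply: (nper2 _ K0) => i j.
    have := per (i + K%:Z * b1) (- j - K%:Z * (absz b)%:Z).
    rewrite mulrN addrK (_ : - (- j - K%:Z * (absz b)%:Z + K%:Z * (absz b)%:Z) = j); last by ring.
    by rewrite (_ : - (- j - K%:Z * (absz b)%:Z) = j + K%:Z * (absz b)%:Z) => [->|]; last by ring.
  + by move=> i j i' j' /Xc.
  + move=> i j i' j' H; apply: Xloc => x y xy.
    have := H x (- y); rewrite !opprD !opprK; apply; lia.
- exact: (special_no_strip_periodic a0 b0' rel nper1 Xc).
Qed.

End SpecialBound.

(* Bipartite counting: a connected bipartite graph with nvalues g + nvalues l
   vertices has at least as many edges minus one; kappa indexes the components.
   *)
Lemma nvalues_components (I : Type) (G F K : finType) (g : I -> G) (l : I -> F)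
    (kappa : F -> K) :
  (forall p q, g p = g q -> kappa (l p) = kappa (l q)) ->
  (forall h : F -> F, (forall p q, g p = g q -> h (l p) = h (l q)) ->
     forall p q, kappa (l p) = kappa (l q) -> h (l p) = h (l q)) ->
  (nvalues g + nvalues l <= nvalues (fun i => (g i, l i)) + nvalues (kappa \o l))%N.
Proof.
elim/ltn_ind : {l}(nvalues l) {-2}l (erefl (nvalues l)) => m IH l lm gk fine.
case: (pselect (forall p q, g p = g q -> l p = l q)) => [inj|].
  have := fine id inj => {}fine.
  by rewrite leq_add// nvalues_le// => i j []//.
move=> /existsNP[p0 /existsNP[q0 /not_implyP[g0 l0]]].
(* Contract two vertices with a common neighbour: one vertex and at least one edge disappear, the
   components stay. *)
pose mg a := if a == l q0 then l p0 else a.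
pose l' i := mg (l i).
have kl : kappa \o l' = kappa \o l.
  apply: funext => i; rewrite /= /l' /mg; case: eqP => // ->; exact: gk.
have c1 : (nvalues l <= (nvalues l').+1)%N.
  have sub : value_set l \subset l q0 |: value_set l'.
    apply/fintype.subsetP => y /value_setP[i <-]; rewrite !inE.
    have [->//|ne] := eqVneq (l i) (l q0); apply/asboolP; exists i.
    by rewrite /l' /mg (negPf ne).
  apply: (leq_trans (subset_leq_card sub)).
  by rewrite cardsU1; case: (_ \notin _).
have c2 : (nvalues (fun i => (g i, l' i)) < nvalues (fun i => (g i, l i)))%N.
  rewrite ltnNge; apply/negP => le; apply: l0.
  suff [] : (g p0, l p0) = (g q0, l q0) by [].
  apply: (nvalues_ker _ le) => [i j [-> e]|]; first by rewrite /l' e.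
  rewrite /l' /mg g0 eqxx; case: eqP => //.
have c3 : (nvalues l' < m)%N.
  rewrite -lm ltnNge; apply/negP => le; apply: l0.
  apply: (nvalues_ker _ le) => [i j e|]; first by rewrite /l' e.
  by rewrite /l' /mg eqxx; case: eqP.
have := IH _ c3 l' erefl; rewrite kl => IHl.
have {}IHl : (nvalues g + nvalues l' <= nvalues (fun i => (g i, l' i)) + nvalues (kappa \o l))%N.
  apply: IHl => [p q gpq|h hg p q kpq].
    by have := gk _ _ gpq; rewrite -[_ (l p)]/((kappa \o l) p) -[_ (l q)]/((kappa \o l) q) -kl.
  apply: (fine (h \o mg) hg).
  by move: kpq; rewrite -[LHS]/((kappa \o l') p) -[RHS]/((kappa \o l') q) kl.
lia.
Qed.

(** * From patterns of c to patterns of eta *)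

Section Nonlinear.
Variables (A : finType) (eta : Z2 -> A) (V : comNzRingType) (c : Z2 -> V).
Variable vals : seq V.
Hypothesis eta_surj : forall a, exists g, eta g = a.
Hypothesis cvals : forall g, c g \in vals.

Definition box (rho : nat) (s : Z2) := (absz s.1 <= rho)%N && (absz s.2 <= rho)%N.

(* Letters are indistinguishable if no finite window of c separates their
   occurrences; chi is the finest function of the letter that c determines
   locally. *)
Definition indist (a a' : A) := `[< forall rho : nat, exists p q : Z2,
  [/\ forall s, box rho s -> c (p + s) = c (q + s), eta p = a & eta q = a'] >].

Lemma indist_sym : symmetric indist.
Proof.
move=> a a'; apply/asboolP/asboolP => H rho; have [p [q [e h h']]] := H rho;
  by exists q, p; split=> // s /e.
Qed.

(** There are finitely many pairs of letters, so the largest of their separating radii serves for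
    all. *)
Lemma indist_radius : exists rho : nat, forall p q : Z2,
  (forall s, box rho s -> c (p + s) = c (q + s)) -> indist (eta p) (eta q).
Proof.
have H (x : A * A) : exists rho : nat, ~~ indist x.1 x.2 -> forall p q : Z2,
    (forall s, box rho s -> c (p + s) = c (q + s)) -> eta p = x.1 -> eta q = x.2 -> False.
  case: (boolP (indist x.1 x.2)) => [_|/asboolP]; first by exists 0%N.
  move=> /existsNP[rho no]; exists rho => _ p q e ep eq.
  by apply: no; exists p, q.
have [r rP] := choice H.
exists (\max_(x : A * A) r x)%N => p q e.
apply/contraT => ni.
case: (rP (eta p, eta q) ni p q) => // s sb; apply: e.
have le := leq_bigmax (F := r) (eta p, eta q).
by case/andP: sb => b1 b2; rewrite /box !(leq_trans _ le).
Qed.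

Definition chi (a : A) : A := fingraph.root indist a.

Lemma chi_fine (T : eqType) (h : A -> T) a a' :
  (forall b b', indist b b' -> h b = h b') -> chi a = chi a' -> h a = h a'.
Proof.
move=> hi e.
have : connect indist a a'.
  by rewrite -(root_connect (sym_connect_sym indist_sym)); apply/eqP.
move=> /connectP[p]; elim: p a {e} => [|b p IH] a /=; first by move=> _ ->.
by move=> /andP[/hi -> /IH]; apply.
Qed.

Lemma chi_indist a a' : indist a a' -> chi a = chi a'.
Proof.
move=> i; apply/eqP; rewrite /chi (root_connect (sym_connect_sym indist_sym)).
exact: connect1.
Qed.

Variables (u w b : Z2) (N : nat).
Hypothesis N0 : (0 < N)%N.
Hypothesis uw : u.1 * w.2 - u.2 * w.1 = 1.
Hypothesis ub : u.1 * b.2 - u.2 * b.1 != 0.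
Hypothesis rel : forall g, c (g + u *+ N + b) + c g = c (g + u *+ N) + c (g + b).
Hypothesis nperu : forall K : nat, (0 < K)%N -> ~ (forall g, c (g + u *+ K) = c g).
Hypothesis nperb : forall K : nat, (0 < K)%N -> ~ (forall g, c (g + b *+ K) = c g).

Variables (S S' : seq Z2).
Hypothesis uS' : uniq S'.
Hypothesis cS' : lconv S'.
Hypothesis neS' : S' != [::].
Hypothesis SS' : {subset S' <= S}.
Hypothesis cdet : forall p q, (forall s, s \in S -> eta (p + s) = eta (q + s)) ->
  forall s, s \in S' -> c (p + s) = c (q + s).

Let m := (size vals).+1.
(** The coding fed to [special_bound]: it determines c and is locally determined by c, and it
    carries the component [chi] that patterns and letters share. *)
Definition xi (g : Z2) : 'I_m * A := (inord (index (c g) vals), chi (eta g)).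

Lemma xi_c g g' : xi g = xi g' -> c g = c g'.
Proof.
move=> [/(congr1 val) /=]; rewrite !inordK ?ltnS ?index_size// => e _.
by rewrite -(nth_index 0 (cvals g)) e nth_index.
Qed.

(* In the basis (u, w) of Z^2 the direction u becomes horizontal. *)
Definition lattice (i j : int) : Z2 := (i * u.1 + j * w.1, i * u.2 + j * w.2).
Definition coord (s : Z2) : Z2 := (s.1 * w.2 - s.2 * w.1, u.1 * s.2 - u.2 * s.1).

Lemma coordK s : lattice (coord s).1 (coord s).2 = s.
Proof.
case: s => x y; rewrite /lattice /coord /=; congr (_, _).
  rewrite (_ : _ + _ = x * (u.1 * w.2 - u.2 * w.1)); last by ring.
  by rewrite uw mulr1.
rewrite (_ : _ + _ = y * (u.1 * w.2 - u.2 * w.1)); last by ring.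
by rewrite uw mulr1.
Qed.

Lemma latticeK i j : coord (lattice i j) = (i, j).
Proof.
rewrite /lattice /coord /=; congr (_, _).
  rewrite (_ : _ - _ = i * (u.1 * w.2 - u.2 * w.1)); last by ring.
  by rewrite uw mulr1.
rewrite (_ : _ - _ = j * (u.1 * w.2 - u.2 * w.1)); last by ring.
by rewrite uw mulr1.
Qed.

Lemma latticeD i j i' j' : lattice (i + i') (j + j') = lattice i j + lattice i' j'.
Proof. by rewrite /lattice; congr (_, _) => /=; ring. Qed.

Lemma pairMn (s : Z2) n : s *+ n = (s.1 * n%:Z, s.2 * n%:Z).
Proof.
elim: n => [|n IH]; first by rewrite mulr0n !mulr0.
by rewrite mulrS IH; case: s {IH} => x y /=; congr (_, _) => /=; rewrite -addn1 PoszD; ring.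
Qed.

(** In the bipartite graph of [xi]-patterns on [S'] and letters at g0, each edge comes from a
    pattern of eta on [S], and the components are indexed by [chi]. There are at most as many
    components as values of [xi] at one point, and that number cancels against the same term in
    [bound]. *)
Lemma nonlinear_bound :
  (size S' + #|A| <= complexity (fun i j => eta (i, j)) S + 1)%N.
Proof.
pose X i j := xi (lattice i j).
pose Q := map coord S'.
have [rho0 rho0P] := indist_radius.
(* In the new basis the height of a point of the box of radius rho0 is at most this. *)
pose rho := (rho0 * (absz u.1 + absz u.2))%N.
have b1E : lattice (coord b).1 (coord b).2 = b := coordK b.
have uE (K : nat) : lattice K%:Z 0 = u *+ K.
  by rewrite pairMn /lattice; congr (_, _); ring.
have bE (K : nat) : lattice (K%:Z * (coord b).1) (K%:Z * (coord b).2) = b *+ K.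
  by rewrite -{3}(coordK b) pairMn /lattice; congr (_, _) => /=; ring.
have uQ : uniq Q.
  by rewrite map_inj_uniq// => s t e; rewrite -(coordK s) e coordK.
have QE s : (s \in Q) = (lattice s.1 s.2 \in S').
  apply/mapP/idP => [[t tS ->]|sS]; first by rewrite coordK.
  by exists (lattice s.1 s.2) => //; rewrite latticeK -surjective_pairing.
have cQ : lconv Q.
  move=> q1 q2 q3 q4 g w1 w2 w3 w4; rewrite !QE => h1 h2 h3 h4 p1 p2 p3 p4 W e1 e2.
  apply: (cS' h1 h2 h3 h4 p1 p2 p3 p4 W) => /=.
    by rewrite mulrDr !mulrA e1 e2; ring.
  by rewrite mulrDr !mulrA e1 e2; ring.
have neQ : Q != [::] by rewrite /Q; case: (S') neS'.
have H1 : forall i j, c (lattice i j) \in vals by [].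
have H2 : forall K, (0 < K)%N -> ~ (forall i j : int, c (lattice (i + K%:Z) j) = c (lattice i j)).
  move=> K K0 per; apply: (nperu K0) => g.
  have := per (coord g).1 (coord g).2; rewrite coordK -uE => <-.
  by rewrite -{1}(addr0 (coord g).2) latticeD coordK.
have H3 : forall i j i' j', X i j = X i' j' -> c (lattice i j) = c (lattice i' j').
  by move=> i j i' j' /xi_c.
have H4 : forall i j i' j' : int,
  (forall x y : int, - rho%:Z <= y <= rho%:Z ->
     c (lattice (i + x) (j + y)) = c (lattice (i' + x) (j' + y))) -> X i j = X i' j'.
  move=> i j i' j' e.
  have e' s : box rho0 s -> c (lattice i j + s) = c (lattice i' j' + s).
    move=> /andP[s1 s2]; rewrite -(coordK s) -!latticeD; apply: e.
    rewrite /coord /= /rho.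
    have h1 : `|u.1 * s.2| <= (rho0 * absz u.1)%N%:Z.
      by rewrite normrM PoszM mulrC ler_pM// -abszE lez_nat.
    have h2 : `|u.2 * s.1| <= (rho0 * absz u.2)%N%:Z.
      by rewrite normrM PoszM mulrC ler_pM// -abszE lez_nat.
    move: h1 h2; rewrite mulnDr PoszD !ler_norml.
    by move: (u.1 * s.2) (u.2 * s.1) => x y /andP[? ?] /andP[? ?]; lia.
  have := e' 0; rewrite /box /= !addr0 /X /xi => -> //.
  by congr (_, _); apply/chi_indist/rho0P.
have H5 : forall i j : int,
    c (lattice (i + N%:Z + (coord b).1) (j + (coord b).2)) + c (lattice i j) =
    c (lattice (i + N%:Z) j) + c (lattice (i + (coord b).1) (j + (coord b).2)).
  move=> i j; rewrite (latticeD (i + N%:Z) j) (latticeD i j) b1E.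
  have -> : lattice (i + N%:Z) j = lattice i j + u *+ N.
    by rewrite -{1}(addr0 j) latticeD uE.
  exact: rel.
have H6 : forall K, (0 < K)%N -> ~ (forall i j : int,
    c (lattice (i + K%:Z * (coord b).1) (j + K%:Z * (coord b).2)) = c (lattice i j)).
  move=> K K0 per; apply: (nperb K0) => g.
  by have := per (coord g).1 (coord g).2; rewrite coordK => <-; rewrite latticeD coordK bE.
have bound := special_bound H1 N0 H2 H3 H4 (ub : (coord b).2 != 0) H5 H6 uQ cQ neQ.
have [g0 g0S] : exists g0, g0 \in S' by case: (S') neS' => // g0 ? _; exists g0; rewrite inE eqxx.
pose g (p : Z2) := [ffun k : 'I_(size S') => xi (p + tnth (in_tuple S') k)].
have gP p q : g p = g q <-> (forall s, s \in S' -> xi (p + s) = xi (q + s)).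
  split=> [e s sS|e]; last first.
    by apply/ffunP => k; rewrite !ffunE e// mem_tnth.
  have /tnthP[k ->] : s \in in_tuple S' by [].
  by have := congr1 (fun f : {ffun _ -> _} => f k) e; rewrite !ffunE.
pose l (p : Z2) := eta (p + g0).
have cg : nvalues g = complexity X Q.
  have E1 p s : X ((coord p).1 + (coord s).1) ((coord p).2 + (coord s).2) = xi (p + s).
    by rewrite /X latticeD !coordK.
  apply/eqP; rewrite eqn_leq; apply/andP; split.
    have := @nvalues_comp _ _ _ (pat X Q) coord; apply: leq_trans.
    apply: nvalues_le => p q; rewrite /comp => /patP e; apply/gP => s sS.
    by rewrite -!E1; apply: (e (coord s)); apply: map_f.
  have := @nvalues_comp _ _ _ g (fun p : Z2 => lattice p.1 p.2); apply: leq_trans.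
  apply: nvalues_le => p q; rewrite /comp => /gP e; apply/patP => s /mapP[t tS ->].
  by rewrite /X (latticeD p.1) (latticeD q.1) coordK; apply: e.
have cl : nvalues l = #|A|.
  rewrite /nvalues -cardsT; congr #|pred_of_set _|; apply/setP => a; rewrite !inE.
  by apply/asboolP; have [p <-] := eta_surj a; exists (p - g0); rewrite /l subrK.
have ck : (nvalues (chi \o l) <= complexity X [:: (0%R, 0%R)])%N.
  have := @nvalues_comp _ _ _ (pat X [:: (0%R, 0%R)]) (fun p : Z2 => coord (p + g0)).
  apply: leq_trans; apply: nvalues_le => p q; rewrite /comp => /patP/(_ (0, 0)).
  rewrite inE eqxx => /(_ isT) e.
  have E' (r : Z2) : X ((coord r).1 + 0) ((coord r).2 + 0) = xi r.
    by rewrite !addr0 /X coordK.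
  have {}e : xi (p + g0) = xi (q + g0) by rewrite -!E'; exact: e.
  by case: e.
have := @nvalues_components _ _ _ _ g l chi.
have K1 : forall p q, g p = g q -> chi (l p) = chi (l q).
  by move=> p q /gP/(_ _ g0S) [].
have K2 : forall h : A -> A, (forall p q, g p = g q -> h (l p) = h (l q)) ->
     forall p q, chi (l p) = chi (l q) -> h (l p) = h (l q).
  move=> h hg p q; apply: chi_fine => b0 b' /asboolP ind.
  (* Indistinguishable letters need occurrences around which c agrees far enough to compare all [xi]
     values on [S'], moved by - g0, each with its own radius rho0. *)
  pose M := (\max_(s <- S') (absz s.1 + absz s.2) + absz g0.1 + absz g0.2)%N.
  have [p1 [q1 [e <- <-]]] := ind (rho0 + M)%N.
  have := hg (p1 - g0) (q1 - g0); rewrite /l !subrK; apply; apply/gP => s sS.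
  have sM : (absz s.1 + absz s.2 <= \max_(s <- S') (absz s.1 + absz s.2))%N.
    by rewrite (big_rem s)//= leq_maxl.
  have e' t : box rho0 t -> c (p1 - g0 + s + t) = c (q1 - g0 + s + t).
    move=> /andP[t1 t2]; rewrite -!addrA; apply: e; apply/andP.
    by move: s g0 t sM t1 t2 {sS g0S l cl ck K1 hg} @M => [x y] [x0 y0] [x1 y1] /= ? ? ?; split; lia.
  rewrite /xi; congr (_, _); last exact/chi_indist/rho0P.
  by have := e' 0; rewrite !addr0 => -> //; rewrite /box.
move=> /(_ K1 K2); rewrite cg cl => comp.
have PP : (nvalues (fun i => (g i, l i)) <= complexity (fun i j => eta (i, j)) S)%N.
  apply: nvalues_le => p q /patP e.
  have e' s : s \in S -> eta (p + s) = eta (q + s) by move=> /e.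
  congr (_, _); last exact/e'/SS'.
  by apply/gP => s sS; rewrite /xi (cdet e' sS) e'//; apply: SS'.
have := leq_trans comp (leq_add PP ck).
move: bound; rewrite size_map; clear; move: (complexity X Q) (complexity X [:: _]) (complexity _ S); lia.
Qed.

End Nonlinear.

Lemma value_set_index (I : Type) (F : finType) (f : I -> F) (i0 : I) :
  exists (cls : I -> 'I_(nvalues f)) (r : 'I_(nvalues f) -> I),
    (forall k, cls (r k) = k) /\ (forall p q, cls p = cls q <-> f p = f q).
Proof.
pose cls p : 'I_(nvalues f) := enum_rank_in (value_set_in f i0) (f p).
have clsK p : enum_val (cls p) = f p by rewrite enum_rankK_in ?value_set_in.
have H k : exists i, cls i = k.
  have /value_setP[i e] := enum_valP k; exists i.
  by rewrite /cls e enum_valK_in.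
have [r rP] := choice H.
exists cls, r; split=> // p q; split=> [e|e]; last by rewrite /cls e.
by rewrite -!clsK e.
Qed.

(** * Operators acting on pattern functions *)

Definition row_op (F : pzRingType) n (a : 'rV[F]_n) (d : 'I_n -> Z2) (e : Z2 -> F) :=
  fun g => \sum_k a 0 k * e (g + d k).

Section Transform.
Variables (F : fieldType) (n P : nat) (d : 'I_n -> Z2).
Variables (cls : Z2 -> 'I_P) (r : 'I_P -> Z2).
Hypothesis rK : forall k, cls (r k) = k.

(** Functions constant on the P pattern classes ([meas]) are identified with row vectors: [ev]
    extends a vector to Z^2, [vec] samples a function at representatives. *)
Let ev (e : 'rV[F]_P) (g : Z2) : F := e 0 (cls g).
Let meas (e : Z2 -> F) := forall g g', cls g = cls g' -> e g = e g'.
Let vec (e : Z2 -> F) : 'rV[F]_P := \row_j e (r j).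

Lemma vecK e : meas e -> ev (vec e) = e.
Proof. by move=> me; apply: funext => g; rewrite /ev mxE; apply: me; rewrite rK. Qed.

Let Phi (e : 'rV[F]_P) : 'M[F]_(n, P) := \matrix_(k, j) ev e (r j + d k).

Lemma PhiE a e : a *m Phi e = vec (row_op a d (ev e)).
Proof.
by apply/rowP => j; rewrite !mxE; apply: eq_bigr => k _; rewrite mxE.
Qed.

Lemma row_opC (a a' : 'rV[F]_n) (e : Z2 -> F) :
  row_op a d (row_op a' d e) = row_op a' d (row_op a d e).
Proof.
apply: funext => g; rewrite /row_op.
under eq_bigr do rewrite big_distrr /=.
rewrite exchange_big /=; apply: eq_bigr => k' _.
rewrite big_distrr /=; apply: eq_bigr => k _.
by rewrite mulrCA (addrAC g).
Qed.

Lemma row_opD (a : 'rV[F]_n) (e1 e2 : Z2 -> F) g :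
  row_op a d (fun x => e1 x + e2 x) g = row_op a d e1 g + row_op a d e2 g.
Proof. by rewrite /row_op -big_split /=; apply: eq_bigr => k _; rewrite mulrDr. Qed.

(* Analogue of the Dyson e-transform: as long as A e is not contained in B for
   some e in B, replace A by {a in A | a e in B} and B by B + A e; the sum of
   the dimensions does not change. *)
Lemma e_transform (m : nat) (A0 : 'M[F]_n) (B0 : 'M[F]_P) : (\rank A0 <= m)%N ->
  (forall a e : 'rV_ _, (a <= A0)%MS -> (e <= B0)%MS -> meas (row_op a d (ev e))) ->
  exists (A : 'M[F]_n) (B : 'M[F]_P),
    [/\ (\rank A0 + \rank B0 <= \rank A + \rank B)%N, (B0 <= B)%MS,
        (forall a e : 'rV_ _, (a <= A)%MS -> (e <= B)%MS -> meas (row_op a d (ev e))) &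
        (forall a e : 'rV_ _, (a <= A)%MS -> (e <= B)%MS ->
           (vec (row_op a d (ev e)) <= B)%MS)].
Proof.
elim: m A0 B0 => [|m IH] A B rA mAB.
  exists A, B; split=> // a e aA _.
  have A0 : A = 0 by apply/eqP; rewrite -mxrank_eq0 -leqn0.
  by move: aA; rewrite A0 => /submx0null ->; rewrite -PhiE mul0mx sub0mx.
case: (pselect (forall e : 'rV_P, (e <= B)%MS -> (A *m Phi e <= B)%MS)) => [st|].
  exists A, B; split=> // a e aA eB.
  by rewrite -PhiE; apply: submx_trans (st _ eB); apply: submxMr.
move=> /existsNP[e /not_implyP[eB nst]].
(* [cokermx B] computes modulo B. The rank lost from A to [A'] is the rank of A e modulo B, which is
   gained by [B']; it is positive by the choice of e, so the induction proceeds. *)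
pose A' := (A :&: kermx (Phi e *m cokermx B))%MS.
pose B' := (B + A *m Phi e)%MS.
have rk1 := mxrank_mul_ker A (Phi e *m cokermx B); rewrite -/A' mulmxA in rk1.
have nz : (0 < \rank (A *m Phi e *m cokermx B))%N.
  by rewrite lt0n mxrank_eq0 -sub_kermx; apply: contra_notN nst => /eqP h; rewrite submxE -sub_kermx; apply/eqP.
have A'P (a : 'rV_n) : (a <= A')%MS -> (a <= A)%MS /\ (vec (row_op a d (ev e)) <= B)%MS.
  rewrite sub_capmx => /andP[-> /sub_kermxP]; rewrite mulmxA => h; split=> //.
  by rewrite -PhiE submxE h.
have rk2 : (\rank (A *m Phi e *m cokermx B) + \rank B <= \rank B')%N.
  have := mxrank_mul_ker (B + A *m Phi e)%MS (cokermx B); rewrite -/B' => <-.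
  apply: leq_add; apply: mxrankS.
    by apply: submxMr; apply: addsmxSr.
  by rewrite sub_capmx addsmxSl; apply/sub_kermxP; rewrite mulmx_coker.
have [||A1 [B1 [r1 s1 m1 t1]]] := IH A' B'.
- lia.
- move=> a e' aA' /sub_addsmxP[[b y] /= ->]; rewrite mulmxA.
  set a1 := y *m A; set b1 := b *m B.
  have [aA aeB] := A'P _ aA'.
  have a1A : (a1 <= A)%MS by apply: submxMl.
  have -> : ev (b1 + a1 *m Phi e) = (fun x => ev b1 x + row_op a1 d (ev e) x).
    apply: funext => g; rewrite PhiE /ev mxE -!/(ev _ _) vecK//; exact: mAB.
  move=> g g' gg; rewrite !row_opD; congr (_ + _).
    by apply: mAB => //; apply: submxMl.
  (* Operators commute: a (a1 e) = a1 (a e), and a e lies in B because a lies in [A']. *)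
  rewrite row_opC -(vecK (mAB _ _ aA eB)).
  exact: mAB.
exists A1, B1; split=> //; first by rewrite (leq_trans _ r1)//; lia.
exact: submx_trans (addsmxSl _ _) s1.
Qed.

End Transform.

Lemma mx_annihilator (F : fieldType) (P : nat) (M : 'M[F]_P) :
  exists2 q : {poly F}, q != 0 &
    forall e : 'rV_P, \sum_(i < size q) q`_i *: iter i (mulmxr M) e = 0.
Proof.
case: P M => [|P] M.
  by exists 1; [exact: oner_neq0 | move=> e; apply: thinmx0].
exists (char_poly M); first exact: monic_neq0 (char_poly_monic M).
move=> e; have := congr1 (mulmx e) (Cayley_Hamilton M).
rewrite mulmx0 => E; rewrite -[RHS]E /horner_mx /horner_morph horner_coef size_map_poly_id0.
  rewrite mulmx_sumr; apply: eq_bigr => i _.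
  rewrite coef_map /= -mulmxE mul_scalar_mx -scalemxAr; congr (_ *: _).
  elim: (i : nat) => [|k IH] /=; first by rewrite expr0 mulmx1.
  by rewrite IH exprSr mulmxA.
by rewrite /= (monicP (char_poly_monic M)) oner_neq0.
Qed.

Section Annihilator.
Variables (F : fieldType) (A : finType) (eta : Z2 -> A) (S : seq Z2) (s0 : Z2).
Hypothesis eta_surj : forall a, exists g, eta g = a.
Hypothesis s0S : s0 \in S.

Let d (k : 'I_(size S)) : Z2 := tnth (in_tuple S) k - s0.

(* Start from all operators supported on S and from the functions of the letter
   at s0, the span of which has dimension #|A|. *)
Lemma pattern_operators : exists Af : 'M[F]_(size S),
  (size S + #|A| <= \rank Af + complexity (fun i j => eta (i, j)) S)%N /\
  forall a : 'rV[F]_(size S), (a <= Af)%MS -> exists2 q : {poly F}, q != 0 &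
    forall (phi : A -> F) g,
      \sum_(i < size q) q`_i * iter i (row_op a d) (phi \o eta) g = 0.
Proof.
have [cls [r [rK clsP]]] := value_set_index (pat (fun i j => eta (i, j)) S) (0 : Z2).
set P := nvalues _ in cls r rK clsP.
have clsS p q : cls p = cls q -> forall s, s \in S -> eta (p + s) = eta (q + s).
  by move=> /clsP/patP e s /e.
pose B0 : 'M[F]_(#|A|, P) := \matrix_(a, j) (eta (r j + s0) == enum_val a)%:R.
have B0free : row_free B0.
  apply: inj_row_free => v v0; apply/rowP => a; rewrite mxE.
  have [g ga] := eta_surj (enum_val a).
  have := congr1 (fun M : 'rV_P => M 0 (cls (g - s0))) v0; rewrite !mxE (bigD1 a)//= mxE.
  rewrite (clsS (r (cls (g - s0))) (g - s0)) ?rK// subrK ga eqxx mulr1 big1 ?addr0// => b ba.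
  rewrite mxE (clsS (r (cls (g - s0))) (g - s0)) ?rK// subrK ga.
  by rewrite (inj_eq enum_val_inj) eq_sym (negPf ba) mulr0.
have evB (e : 'rV_P) : (e <= B0)%MS -> exists phi : A -> F, forall g, e 0 (cls g) = phi (eta (g + s0)).
  move=> /submxP[v ->]; exists (fun x => \sum_a v 0 a * (x == enum_val a)%:R) => g.
  rewrite !mxE; apply: eq_bigr => a _; rewrite mxE; congr (_ * (_ == _)%:R).
  by apply: clsS; rewrite ?rK.
have [||A1 [B1 [rk sub m st]]] := @e_transform F (size S) P d cls r rK (size S) 1%:M <<B0>>%MS.
- by rewrite mxrank1.
- move=> a e _; rewrite genmxE => /evB[phi ep] g g' gg.
  rewrite /row_op; apply: eq_bigr => k _; congr (_ * _).
  rewrite !ep /d !addrA !subrK; congr phi.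
  by apply: (clsS _ _ gg); apply: mem_tnth.
exists A1; split.
  move: rk; rewrite mxrank1 mxrank_gen (eqP B0free) => /leq_trans; apply.
  by rewrite leq_add2l rank_leq_row.
move=> a aA.
(* [M] applies a and samples at representatives. On [B1], which a maps into itself with measurable
   images, nothing is lost by sampling, so the polynomial annihilating [M] also annihilates a
   there. *)
pose M : 'M[F]_P := \matrix_(i, j) \sum_k a 0 k * (cls (r j + d k) == i)%:R.
have ME (e : 'rV_P) : e *m M = \row_j row_op a d (fun g => e 0 (cls g)) (r j).
  apply/rowP => j; rewrite !mxE /row_op.
  under eq_bigr do rewrite mxE big_distrr /=.
  rewrite exchange_big /=; apply: eq_bigr => k _.
  rewrite (bigD1 (cls (r j + d k)))//= eqxx mulr1 big1 ?addr0 1?mulrC// => i ne.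
  by rewrite eq_sym (negPf ne) !mulr0.
have [q q0 qM] := mx_annihilator M; exists q => // phi g.
pose e0 : 'rV[F]_P := \row_j phi (eta (r j + s0)).
have e0B : (e0 <= B1)%MS.
  apply: (submx_trans _ sub); rewrite genmxE; apply/submxP.
  exists (\row_a phi (enum_val a)); apply/rowP => j; rewrite !mxE.
  rewrite (bigD1 (enum_rank (eta (r j + s0))))//= !mxE enum_rankK eqxx mulr1 big1 ?addr0// => i ne.
  by rewrite !mxE -(can_eq enum_rankK) enum_valK eq_sym (negPf ne) mulr0.
have it i : (iter i (mulmxr M) e0 <= B1)%MS /\
    forall g, iter i (row_op a d) (phi \o eta) (g + s0) = iter i (mulmxr M) e0 0 (cls g).
  elim: i => [|i [IH1 IH2]] /=.
    split=> // g'; rewrite mxE; congr phi; apply: clsS => //; by rewrite rK.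
  split; first by rewrite ME; apply: st.
  move=> g'; rewrite ME mxE (m _ _ aA IH1 _ g') ?rK//.
  by rewrite /row_op; apply: eq_bigr => k _; rewrite addrAC IH2.
have := congr1 (fun v : 'rV_P => v 0 (cls (g - s0))) (qM e0).
rewrite summxE mxE => q0'; rewrite -[RHS]q0'; apply: eq_bigr => i _.
by rewrite mxE -(it i).2 subrK.
Qed.

End Annihilator.

(** * An integer annihilator *)

(* A list of pairs (coefficient, v) stands for the Laurent polynomial with terms
   coefficient * X^v. *)
Section TermLists.
Variable F : comNzRingType.
Implicit Types (l m : seq (F * Z2)) (e : Z2 -> F).

Definition lop l e g := \sum_(x <- l) x.1 * e (g + x.2).
Definition lmul l m : seq (F * Z2) := [seq (x.1 * y.1, x.2 + y.2) | x <- l, y <- m].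
Definition lcoef l v := \sum_(x <- l | x.2 == v) x.1.

Lemma lop_mul l m e g : lop (lmul l m) e g = lop l (lop m e) g.
Proof.
rewrite /lop /lmul big_allpairs_dep /=; apply: eq_bigr => x _.
by rewrite big_distrr /=; apply: eq_bigr => y _; rewrite mulrA addrA.
Qed.

Lemma sum_by_value (V : nmodType) l (G : F * Z2 -> V) :
  \sum_(x <- l) G x = \sum_(v <- undup (map snd l)) \sum_(x <- l | x.2 == v) G x.
Proof.
under [RHS]eq_bigr do rewrite big_mkcond.
rewrite exchange_big /= big_seq [RHS]big_seq; apply: eq_bigr => x xl.
rewrite (bigD1_seq x.2) ?undup_uniq ?mem_undup ?map_f//= eqxx.
by rewrite big1 ?addr0// => v; rewrite eq_sym => /negPf ->.
Qed.

Lemma lop_coef l e g : lop l e g = \sum_(v <- undup (map snd l)) lcoef l v * e (g + v).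
Proof.
rewrite /lop sum_by_value; apply: eq_bigr => v _.
by rewrite /lcoef big_distrl /=; apply: eq_bigr => x /eqP ->.
Qed.

Variable theta : Z2 -> nat.

Definition lpoly l : {poly F} := \sum_(x <- l) x.1 *: 'X^(theta x.2).

Lemma lpoly_coef l : lpoly l = \sum_(v <- undup (map snd l)) lcoef l v *: 'X^(theta v).
Proof.
rewrite /lpoly sum_by_value; apply: eq_bigr => v _.
by rewrite /lcoef scaler_suml; apply: eq_bigr => x /eqP ->.
Qed.

Lemma lpoly_neq0 l : lpoly l != 0 -> exists2 v, v \in undup (map snd l) & lcoef l v != 0.
Proof.
move=> nz; apply: contrapT => no; move/eqP: nz; apply.
rewrite lpoly_coef big_seq big1// => v vl.
case: (eqVneq (lcoef l v) 0) => [->|ne]; first by rewrite scale0r.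
by case: no; exists v.
Qed.

Lemma lpoly_mul (D : pred Z2) l m :
  (forall v w, D v -> D w -> theta (v + w) = (theta v + theta w)%N) ->
  all (D \o snd) l -> all (D \o snd) m -> lpoly (lmul l m) = lpoly l * lpoly m.
Proof.
move=> th /allP lD /allP mD.
rewrite /lpoly /lmul big_allpairs_dep /= big_distrl /= big_seq [RHS]big_seq.
apply: eq_bigr => x xl; rewrite big_distrr /= big_seq [RHS]big_seq.
apply: eq_bigr => y ym; rewrite th ?exprD; last exact: mD; last exact: lD.
by rewrite -scalerAl -scalerAr scalerA.
Qed.

Fixpoint lpow l i := if i is i'.+1 then lmul l (lpow l i') else [:: (1, 0)].

Lemma lop_pow l e i g : lop (lpow l i) e g = iter i (lop l) e g.
Proof.
elim: i g => [|i IH] g /=; first by rewrite /lop big_seq1 mul1r addr0.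
by rewrite lop_mul /lop; apply: eq_bigr => x _; rewrite -IH.
Qed.

Lemma lpoly_pow (D : pred Z2) l i :
  D 0 -> (forall v w, D v -> D w -> D (v + w)) -> 
  (forall v w, D v -> D w -> theta (v + w) = (theta v + theta w)%N) ->
  all (D \o snd) l -> lpoly (lpow l i) = lpoly l ^+ i /\ all (D \o snd) (lpow l i).
Proof.
move=> D0 DD th lD; elim: i => [|i [IH1 IH2]].
  rewrite /= D0 /lpoly big_seq1 /= expr0 scale1r; split=> //.
  have := th 0 0 D0 D0; rewrite addr0 => t0.
  by rewrite (_ : theta 0 = 0%N) ?expr0//; lia.
split; first by rewrite /= (lpoly_mul th)// IH1 exprS.
apply/allP => x /allpairsP[[y z] [yl zl ->]] /=.
by apply: DD; [apply: (allP lD)|apply: (allP IH2)].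
Qed.

Definition lscale (a : F) l : seq (F * Z2) := [seq (a * x.1, x.2) | x <- l].

Lemma lop_scale a l e g : lop (lscale a l) e g = a * lop l e g.
Proof.
by rewrite /lop big_map /= big_distrr; apply: eq_bigr => x _ /=; rewrite mulrA.
Qed.

Lemma lpoly_scale a l : lpoly (lscale a l) = a *: lpoly l.
Proof.
by rewrite /lpoly big_map /= scaler_sumr; apply: eq_bigr => x _; rewrite scalerA.
Qed.

Definition leval (q : {poly F}) l := flatten [seq lscale q`_i (lpow l i) | i <- iota 0 (size q)].

Lemma lop_eval q l e g : lop (leval q l) e g = \sum_(i < size q) q`_i * iter i (lop l) e g.
Proof.
rewrite /lop /leval big_flatten /= big_map -[size q in X in iota 0 X]subn0 -/(index_iota 0 _) big_mkord.
by apply: eq_bigr => i _; rewrite -lop_pow -lop_scale.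
Qed.

Lemma lpoly_eval (D : pred Z2) q l :
  D 0 -> (forall v w, D v -> D w -> D (v + w)) -> 
  (forall v w, D v -> D w -> theta (v + w) = (theta v + theta w)%N) ->
  all (D \o snd) l -> lpoly (leval q l) = q \Po lpoly l.
Proof.
move=> D0 DD th lD.
rewrite comp_polyE /lpoly /leval big_flatten /= big_map -[size q in X in iota 0 X]subn0 -/(index_iota 0 _) big_mkord.
by apply: eq_bigr => i _; rewrite -!/(lpoly _) lpoly_scale (lpoly_pow i D0 DD th lD).1.
Qed.

End TermLists.

Lemma int_multiple (D : seq Z2) (f : Z2 -> rat) : exists (N : int) (f' : Z2 -> int),
  N != 0 /\ forall v, v \in D -> (f' v)%:~R = N%:~R * f v.
Proof.
elim: D => [|v D [N [f' [N0 IH]]]]; first by exists 1, (fun _ => 0).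
exists (N * denq (f v)), (fun w => if w == v then N * numq (f v) else denq (f v) * f' w).
split; first by rewrite mulf_neq0 ?denq_neq0.
move=> w; rewrite inE; case: eqP => [-> _|_ /= wD].
  by rewrite !rmorphM/= -mulrA; congr (_ * _); rewrite -{3}(divq_num_den (f v)) mulrCA divff ?mulr1// intr_eq0 denq_neq0.
by rewrite rmorphM/= IH// rmorphM/=; ring.
Qed.

(* With s0 minimizing an injective linear functional on S, the operators map to
   ordinary polynomials in one variable, where composing a nonzero q with a
   nonconstant polynomial gives a nonzero one. *)
Lemma int_annihilator (A : finType) (eta : Z2 -> A) (S : seq Z2) :
  (forall a, exists g, eta g = a) -> uniq S -> S != [::] ->
  (complexity (fun i j => eta (i, j)) S + 2 <= size S + #|A|)%N ->
  exists (D : seq Z2) (f : Z2 -> int), [/\ uniq D, exists2 v, v \in D & f v != 0 &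
    forall (phi : A -> int) g, \sum_(v <- D) f v * phi (eta (g + v)) = 0].
Proof.
move=> surj uS neS le.
(* [th] reads a point as a number in base K; K exceeds all differences of second coordinates in S,
   so [th] is injective on S. *)
pose K : int := 1 + 2 * \sum_(s <- S) `|s.2|.
have K0 : 0 < K.
  have : 0 <= \sum_(s <- S) `|s.2| by apply: sumr_ge0.
  by rewrite /K; move: (\sum_(s <- S) _) => ?; lia.
have bnd (s : Z2) : s \in S -> 2 * `|s.2| < K.
  move=> sS; rewrite /K (big_rem s)//=.
  have : 0 <= \sum_(t <- rem s S) `|t.2| by apply: sumr_ge0.
  by move: (\sum_(t <- _) _) => ?; lia.
pose th (v : Z2) : int := v.1 * K + v.2.
have thD v w : th (v + w) = th v + th w by rewrite /th /=; ring.
have th_inj : {in S &, injective th}.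
  move=> [x y] [x' y'] /bnd /= b1 /bnd /= b2; rewrite /th /= => e.
  have e1 : x = x' by nia.
  by congr (_, _) => //; move: e; rewrite e1 => /addrI.
have [s0 s0S s0m] := seq_argmax (fun s => - th s) neS.
pose D (v : Z2) := 0 <= th v; pose theta (v : Z2) := absz (th v).
have D0 : D 0 by rewrite /D /th mul0r.
have DD v w : D v -> D w -> D (v + w) by rewrite /D thD; apply: addr_ge0.
have thetaD v w : D v -> D w -> theta (v + w) = (theta v + theta w)%N.
  by rewrite /D /theta thD; lia.
have [Af [rk AfP]] := pattern_operators rat surj s0S.
pose d (k : 'I_(size S)) : Z2 := tnth (in_tuple S) k - s0.
have dD k : D (d k).
  have := s0m _ (mem_tnth k (in_tuple S)); rewrite lerN2 /D.
  have := thD (d k) s0; rewrite /d subrK => ->.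
  by rewrite lerDr.
have theta_inj k k' : theta (d k) = theta (d k') -> k = k'.
  move=> e; have {}e : th (d k) = th (d k').
    move: e (dD k) (dD k'); rewrite /theta /D.
    by move: (th (d k)) (th (d k')) => x y; lia.
  apply/(tuple_uniqP (in_tuple S) uS)/th_inj; rewrite ?mem_tnth//.
  by have := thD (d k) s0; have := thD (d k') s0; rewrite /d !subrK e => -> ->.
have /tnthP[k0 k0E] : s0 \in in_tuple S by [].
have dk0 : theta (d k0) = 0%N by rewrite /theta /d -k0E subrr /th mul0r.
(* [Af] has rank at least 2, whereas the scalars, supported at s0 alone, form a line. *)
have [a aA [k1 k10 ak1]] : exists2 a : 'rV_(size S), (a <= Af)%MS & exists2 k, k != k0 & a 0 k != 0.
  have : ~~ (Af <= (delta_mx 0 k0 : 'rV[rat]_(size S)))%MS.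
    apply/negP => /mxrankS; have := rank_leq_row (delta_mx 0 k0 : 'rV[rat]_(size S)).
    by move: rk le; move: (\rank Af) (\rank (delta_mx _ _)) (complexity _ _) => x y z; lia.
  move=> /row_subPn[i ni]; exists (row i Af); first exact: row_sub.
  apply: contrapT => no; move/negP: ni; apply.
  apply/submxP; exists (const_mx (Af i k0)); apply/rowP => k.
  rewrite !mxE big_ord1 !mxE eqxx /=.
  have [->|ne] := eqVneq k k0; first by rewrite mulr1.
  rewrite mulr0; apply/eqP; apply: contrapT => /negP nz; apply: no; exists k => //.
  by rewrite mxE.
have [q q0 qP] := AfP a aA.
pose l := [seq (a 0 k, d k) | k <- enum 'I_(size S)].
have lopE e : lop l e = row_op a d e.
  by apply: funext => g; rewrite /lop /row_op big_map big_enum.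
have lD : all (D \o snd) l by apply/allP => x /mapP[k _ ->] /=.
have sz : (1 < size (lpoly theta l))%N.
  have c1 : (lpoly theta l)`_(theta (d k1)) = a 0 k1.
    rewrite /lpoly big_map big_enum /= coef_sum (bigD1 k1)//= coefZ coefXn eqxx mulr1.
    rewrite big1 ?addr0// => k ne; rewrite coefZ coefXn.
    by case: eqP => [/theta_inj e|_]; rewrite ?mulr0//; move: ne; rewrite e eqxx.
  have t0 : (0 < theta (d k1))%N.
    by rewrite lt0n -dk0; apply: contra_neq k10 => /theta_inj.
  rewrite ltnNge; apply/negP => sz; move: ak1; rewrite -c1 nth_default ?eqxx//.
  exact: leq_trans sz t0.
have nz : lpoly theta (leval q l) != 0.
  by rewrite (lpoly_eval _ D0 DD thetaD lD) comp_poly_eq0.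
have [v0 v0D fv0] := lpoly_neq0 nz.
set L := undup _ in v0D.
have [N [f [N0 fE]]] := int_multiple L (lcoef (leval q l)).
exists L, f; split; first exact: undup_uniq.
  exists v0 => //; apply/eqP => f0; have := fE _ v0D; rewrite f0 => /esym/eqP.
  by rewrite mulf_eq0 intr_eq0 (negPf N0) (negPf fv0).
move=> phi g; apply/eqP; rewrite -(intr_eq0 rat) rmorph_sum /=.
have := qP (fun x => (phi x)%:~R) g.
have -> : (fun x => (phi x)%:~R) \o eta = fun g => (phi (eta g))%:~R by [].
rewrite -(_ : lop l = row_op a d); last by apply: funext.
rewrite -lop_eval lop_coef -/L => E.
rewrite big_seq; under eq_bigr => v vL do rewrite rmorphM /= fE//.
rewrite -big_seq; under eq_bigr do rewrite -mulrA.
by rewrite -big_distrr /= E mulr0.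
Qed.

(** * From an annihilator to a product of differences *)

Section Frobenius.
Variable F : comNzRingType.
Implicit Types (l : seq (F * Z2)) (e : Z2 -> F).

Lemma lop_shift l e t g : lop l (fun x => e (x + t)) g = lop l e (g + t).
Proof. by rewrite /lop; apply: eq_bigr => x _; rewrite addrAC. Qed.

Lemma lop_sum l (I : Type) (r : seq I) (E : I -> Z2 -> F) (a : I -> F) g :
  lop l (fun y => \sum_(i <- r) a i * E i y) g = \sum_(i <- r) a i * lop l (E i) g.
Proof.
rewrite /lop; under eq_bigr do rewrite big_distrr /=.
rewrite exchange_big /=; apply: eq_bigr => i _; rewrite big_distrr /=.
by apply: eq_bigr => x _; rewrite mulrCA.
Qed.

Lemma lop_binomial a v l e n g :
  iter n (lop ((a, v) :: l)) e g =
  \sum_(0 <= i < n.+1) (a ^+ i *+ 'C(n, i)) * iter (n - i) (lop l) e (g + v *+ i).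
Proof.
elim: n g => [|n IH] g; first by rewrite big_nat1 /= mulr0n addr0 mul1r.
rewrite iterS /lop big_cons /= -/(lop l _ g) (IH (g + v)).
have -> : lop l (iter n (lop ((a, v) :: l)) e) g =
    \sum_(0 <= i < n.+1) (a ^+ i *+ 'C(n, i)) * iter (n.+1 - i) (lop l) e (g + v *+ i).
  rewrite (_ : iter n _ e = fun y => \sum_(0 <= i < n.+1)
      (a ^+ i *+ 'C(n, i)) * iter (n - i) (lop l) e (y + v *+ i)); last exact: funext.
  rewrite lop_sum big_nat [RHS]big_nat; apply: eq_bigr => i /andP[_ i_n].
  by rewrite lop_shift subSn.
rewrite big_distrr /= [X in _ + X = _]big_nat_recl// [RHS]big_nat_recl//.
rewrite !bin0 addrCA; congr (_ + _).
rewrite [in RHS](eq_bigr (fun i => (a ^+ i.+1 *+ 'C(n, i.+1)) * iter (n - i) (lop l) e (g + v *+ i.+1) +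
   a * ((a ^+ i *+ 'C(n, i)) * iter (n - i) (lop l) e (g + v + v *+ i)))); last first.
  move=> i _; rewrite binS mulrnDr mulrDl subSS; congr (_ + _).
  by rewrite mulrA mulrnAr -exprS -addrA -mulrS.
rewrite big_split /= addrC; congr (_ + _).
by rewrite [RHS]big_nat_recr//= bin_small// mulr0n mul0r addr0.
Qed.

(** Monomial operators commute, and in characteristic p the inner binomial coefficients vanish, so
    only p-th powers of single terms survive. *)
Lemma lop_frobenius p l e g : p \in [pchar F] ->
  iter p (lop l) e g = \sum_(x <- l) x.1 ^+ p * e (g + x.2 *+ p).
Proof.
move=> pF; have pp := pcharf_prime pF; have p0 := prime_gt0 pp.
elim: l g => [|[a v] l IH] g.
  by rewrite big_nil -(prednK p0) /= /lop big_nil.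
rewrite lop_binomial big_nat_recr//= big_ltn// subnn bin0 binn !mulr1n expr0 mul1r subn0 mulr0n addr0.
rewrite big_cons /= -IH big_nat big1 ?addr0 1?addrC// => i /andP[i0 ip].
have /dvdnP[k ->] : (p %| 'C(p, i))%N by apply: prime_dvd_bin; rewrite ?i0.
by rewrite mulrnA -mulr_natr (pcharf0 pF) mulr0 mul0r.
Qed.
End Frobenius.

(* Reduction modulo p: the p-th power of the operator l is the dilated operator,
   and a multiple of p smaller than p vanishes. *)
Lemma dilate_prime (l : seq (int * Z2)) (c : Z2 -> int) (C p : nat) :
  (forall g, (absz (c g) <= C)%N) -> (forall g, lop l c g = 0) ->
  prime p -> (\sum_(x <- l) absz x.1 * C < p)%N ->
  forall g, \sum_(x <- l) x.1 * c (g + x.2 *+ p) = 0.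
Proof.
move=> cC lc pp lt g.
pose l' : seq ('F_p * Z2) := [seq (x.1%:~R, x.2) | x <- l].
have H0 i y : (0 < i)%N -> iter i (lop l') (fun g => (c g)%:~R) y = 0.
  case: i => // i _; elim: i y => [|i IH] y /=.
    rewrite /lop big_map /=; have := congr1 (fun z : int => z%:~R : 'F_p) (lc y).
    by rewrite /lop rmorph_sum /= => E; rewrite -[RHS]E; apply: eq_bigr => x _; rewrite rmorphM.
  by rewrite -iterS {1}/lop big1_seq// => x _; rewrite IH mulr0.
have := lop_frobenius l' (fun g => (c g)%:~R) g (pchar_Fp pp).
rewrite H0 ?prime_gt0// big_map /=.
set z := (X in _ -> X = 0) => /esym E.
have {}E : z%:~R = 0 :> 'F_p.
  rewrite -[RHS]E /z rmorph_sum /=; apply: eq_bigr => x _.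
  rewrite rmorphM /=; congr (_ * _).
  by rewrite -(pFrobenius_autE (pchar_Fp pp)) rmorph_int.
have zp : (p %| absz z)%N.
  rewrite (dvdn_pcharf (pchar_Fp pp)).
  by case: (intP z) E => [|n|n] //=; rewrite ?mulrNz => /eqP; rewrite ?oppr_eq0.
have zb : (absz z < p)%N.
  apply: leq_ltn_trans lt; rewrite /z; elim: (l) => [|x m IH]; first by rewrite !big_nil.
  rewrite !big_cons.
  have h : (absz (x.1 * c (g + x.2 *+ p))%R <= absz x.1 * C)%N.
    by rewrite abszM leq_mul2l cC orbT.
  apply: leq_trans (leq_add h IH) => {h IH}.
  by move: (x.1 * _) (\sum_(_ <- _) _) => a b; lia.
apply/eqP; rewrite -absz_eq0; case: (absz z) zp zb => // n /dvdn_leq -/(_ isT); lia.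
Qed.

(** Dilating by one prime factor of k at a time keeps the coefficients, so the same bound serves for
    the next prime. *)
Lemma dilate (l : seq (int * Z2)) (c : Z2 -> int) (C k : nat) :
  (forall g, (absz (c g) <= C)%N) -> (forall g, lop l c g = 0) -> (0 < k)%N ->
  (forall p, prime p -> (p %| k)%N -> (\sum_(x <- l) absz x.1 * C < p)%N) ->
  forall g, \sum_(x <- l) x.1 * c (g + x.2 *+ k) = 0.
Proof.
move=> cC; elim/ltn_ind: k l => k IH l lc k0 kp.
have [k1|k1] := leqP k 1.
  by rewrite (_ : k = 1%N); last lia.
have pp := pdiv_prime k1; have pk := pdiv_dvd k; set p := pdiv k in pp pk.
pose l' : seq (int * Z2) := [seq (x.1, x.2 *+ p) | x <- l].
move/dvdnP: pk => [m kE].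
have p1 := prime_gt1 pp.
have m0 : (0 < m)%N by move: k0; rewrite kE; case: (m).
have mk : (m < k)%N by rewrite kE ltn_Pmulr.
have xk (x : Z2) : x *+ k = x *+ p *+ m by rewrite -mulrnA mulnC -kE.
move=> g; under eq_bigr do rewrite xk.
have := IH m mk l' _ m0 _ g; rewrite !big_map; apply.
  move=> g'; rewrite /lop big_map; apply: (dilate_prime cC lc pp).
  by apply: kp => //; rewrite kE dvdn_mull.
by move=> p' pp' dv; apply: kp => //; rewrite kE; exact: dvdn_mulr.
Qed.

Fixpoint difference_ops (V : zmodType) (L : seq Z2) (e : Z2 -> V) : Z2 -> V :=
  if L is w :: L' then difference_ops L' (fun g => e (g + w) - e g) else e.

Lemma difference_ops_shift (V : zmodType) L (e : Z2 -> V) t g :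
  difference_ops L (fun x => e (x + t)) g = difference_ops L e (g + t).
Proof.
elim: L e => //= w L IH e; rewrite -IH; congr (difference_ops L _ g).
by apply: funext => x; rewrite addrAC.
Qed.

(* The equation for j + 1 minus the equation for j shifted by r v1 eliminates
   the term v1 and applies X^(r v) - X^(r v1) to every other term v. *)
Lemma dilation_elimination (V : zmodType) (rest : seq Z2) (v0 : Z2) (r : nat) (E : Z2 -> Z2 -> V) :
  (forall (j : nat) g, \sum_(v <- v0 :: rest) E v (g + v *+ (1 + j * r)) = 0) ->
  forall g, difference_ops [seq (v0 - v) *+ r | v <- rest] (E v0) g = 0.
Proof.
elim: rest E => [|v1 rest IH] E H g /=.
  by have := H 0%N (g - v0); rewrite big_seq1 mul0n addn0 mulr1n subrK.
pose E' v g := E v (g + v *+ r) - E v (g + v1 *+ r).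
have := IH E' _ (g - v1 *+ r); rewrite -difference_ops_shift.
rewrite (_ : (fun x => E' v0 (x + - (v1 *+ r))) = (fun g0 => E v0 (g0 + (v0 - v1) *+ r) - E v0 g0)).
  apply=> j g'.
  pose T v := E v (g' + v *+ (1 + j.+1 * r)).
  pose U v := E v (g' + v1 *+ r + v *+ (1 + j * r)).
  have E'E v : E' v (g' + v *+ (1 + j * r)) = T v - U v.
    rewrite /E' /T /U (addrAC g' (v1 *+ r)); congr (E v _ - _).
    by rewrite mulSn (addnC r) addnA (mulrnDr _ _ r) addrA.
  have TU : T v1 = U v1.
    rewrite /T /U; congr (E v1 _).
    by rewrite mulSn (addnC r) addnA (mulrnDr _ _ r) addrA (addrAC g' (v1 *+ r)).
  have := H j (g' + v1 *+ r); have := H j.+1 g'.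
  rewrite !big_cons -!/(T _) -!/(U _) TU addrCA => /eqP; rewrite addrC addr_eq0 => /eqP HT.
  rewrite addrCA => /eqP; rewrite addrC addr_eq0 => /eqP HU.
  under eq_bigr do rewrite E'E.
  by rewrite E'E sumrB addrACA -opprD HT HU subrr.
apply: funext => x; rewrite /E'; congr (_ - _); last by rewrite subrK.
by rewrite mulrnBl addrAC addrA.
Qed.

Lemma difference_ops_scale (V : pzRingType) L (a : V) e g :
  difference_ops L (fun x => a * e x) g = a * difference_ops L e g.
Proof.
elim: L e => //= w L IH e; rewrite -IH; congr (difference_ops L _ g).
by apply: funext => x; rewrite mulrBr.
Qed.

(** No prime up to B divides 1 + j B!, so [dilate] applies along this whole arithmetic progression,
    the form that [dilation_elimination] takes. *)
Lemma difference_product (D : seq Z2) (f : Z2 -> int) (c : Z2 -> int) (C : nat) (v0 : Z2) :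
  (forall g, (absz (c g) <= C)%N) -> uniq D -> v0 \in D -> f v0 != 0 ->
  (forall g, \sum_(v <- D) f v * c (g + v) = 0) ->
  exists2 L : seq Z2, 0 \notin L & forall g, difference_ops L c g = 0.
Proof.
move=> cC uD vD fv0 ann.
pose l := [seq (f v, v) | v <- D].
pose B := (\sum_(x <- l) absz x.1 * C)%N.
exists [seq (v0 - v) *+ B`! | v <- rem v0 D].
  apply/negP => /mapP[v]; rewrite mem_rem_uniq// inE => /andP[ne _].
  have := fact_gt0 B; case: (B`!) => // n _.
  case: v v0 ne {vD fv0} => [x y] [x0 y0] ne e; move/negP: ne; apply.
  have e1 i : ((x0, y0) - (x, y) : Z2) *+ i = ((x0 - x) *+ i, (y0 - y) *+ i).
    by elim: i => [|i IH]; rewrite ?mulr0n// !mulrS IH.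
  rewrite e1 in e; have /esym/eqP := congr1 fst e; have /esym/eqP := congr1 snd e.
  rewrite /= !mulrn_eq0 !subr_eq0 /=.
  by move=> /eqP -> /eqP ->; rewrite eqxx.
move=> g.
have := @dilation_elimination _ (rem v0 D) v0 B`! (fun v g => f v * c g) _ g.
rewrite difference_ops_scale => H.
suff : f v0 * difference_ops [seq (v0 - v) *+ B`! | v <- rem v0 D] c g = 0.
  by move/eqP; rewrite mulf_eq0 (negPf fv0) /= => /eqP.
apply: H.
move=> j g'; rewrite -(perm_big _ (perm_to_rem vD)) /=.
have H2 : forall g, \sum_(x <- l) x.1 * c (g + x.2 *+ (1 + j * B`!)) = 0.
  apply: (dilate cC) => // [x|p pp pk]; first by rewrite /lop big_map.
  rewrite -/B ltnNge; apply/negP => pB.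
  have pf : (p %| j * B`!)%N by rewrite dvdn_mull// dvdn_fact// prime_gt0.
  by move: pk; rewrite dvdn_addl// dvdn1 => /eqP p1; rewrite p1 in pp.
by have := H2 g'; rewrite big_map.
Qed.

(** * Doubly periodic functions *)

Lemma pairMz (s : Z2) (n : int) : s *~ n = (s.1 * n, s.2 * n).
Proof.
case: (intP n) => [|k|k]; first by rewrite mulr0z !mulr0.
  by rewrite -pmulrn pairMn.
by rewrite mulrNz -pmulrn pairMn !mulrN.
Qed.

Section DoublyPeriodic.
Variable V : numClosedFieldType.
Implicit Types (e f b : Z2 -> V) (x : Z2 * V) (L K : seq (Z2 * V)) (u v w g : Z2).

Definition per v e := forall g, e (g + v) = e g.

Definition doubly_periodic e := exists2 N, (0 < N)%N & forall v, per (v *+ N) e.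

Definition finite_valued e := exists vals : seq V, forall g, e g \in vals.

Lemma perM v e n : per v e -> per (v *+ n) e.
Proof.
by move=> p; elim: n => [|n IH] g; rewrite ?mulr0n ?addr0// mulrSr addrA p IH.
Qed.

Lemma perN v e : per v e -> per (- v) e.
Proof. by move=> p g; rewrite -p subrK. Qed.

Lemma perMz v e (n : int) : per v e -> per (v *~ n) e.
Proof.
by move=> p; case: (intP n) => [|m|m] g; rewrite ?mulr0z ?addr0// ?mulrNz ?(perN (perM _ p))// perM.
Qed.

Lemma per_add v w e : per v e -> per w e -> per (v + w) e.
Proof. by move=> pv pw g; rewrite addrA pw pv. Qed.

Lemma doubly_periodic_common e f : doubly_periodic e -> doubly_periodic f ->
  exists2 N, (0 < N)%N & forall v, per (v *+ N) e /\ per (v *+ N) f.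
Proof.
move=> [N N0 eN] [M M0 fM]; exists (N * M)%N; first by rewrite muln_gt0 N0.
by move=> v; split; [rewrite mulnC|]; rewrite mulrnA; [apply: eN|apply: fM].
Qed.

Lemma doubly_periodic_ext e f : (forall g, e g = f g) -> doubly_periodic e -> doubly_periodic f.
Proof. by move=> /funext ->. Qed.

Lemma doubly_periodic_lin (p q : V) e f : doubly_periodic e -> doubly_periodic f ->
  doubly_periodic (fun g => p * e g + q * f g).
Proof.
move=> de df; have [N N0 H] := doubly_periodic_common de df; exists N => // v g.
by rewrite (H v).1 (H v).2.
Qed.

Lemma DP0 : doubly_periodic (fun _ => 0).
Proof. by exists 1%N. Qed.

Lemma doubly_periodic_shift w e : doubly_periodic e -> doubly_periodic (fun g => e (g + w)).
Proof. by move=> [N N0 H]; exists N => // v g; rewrite addrAC H. Qed.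

Lemma doubly_periodic_scale (p : V) e : doubly_periodic e -> doubly_periodic (fun g => p * e g).
Proof.
by move=> de; apply: doubly_periodic_ext (doubly_periodic_lin p 0 de DP0) => g; rewrite mulr0 addr0.
Qed.

Lemma doubly_periodic_unscale (p : V) e : p != 0 -> doubly_periodic (fun g => p * e g) -> doubly_periodic e.
Proof. by move=> p0 /(doubly_periodic_scale p^-1); apply: doubly_periodic_ext => g; rewrite mulKf. Qed.

Lemma doubly_periodic_indep u v e M N : (0 < M)%N -> (0 < N)%N -> u.1 * v.2 - u.2 * v.1 != 0 ->
  per (u *+ M) e -> per (v *+ N) e -> doubly_periodic e.
Proof.
move=> M0 N0; set D := _ - _ => D0 pu pv.
exists (M * N * absz D)%N; first by rewrite !muln_gt0 M0 N0 absz_gt0.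
(* Cramer's rule for D s in terms of u and v, cleared of denominators. *)
move=> [s1 s2]; have E : (s1, s2) *+ (M * N * absz D) =
    (u *+ M) *~ (sgz D * N%:Z * (s1 * v.2 - s2 * v.1)) +
    (v *+ N) *~ (sgz D * M%:Z * (u.1 * s2 - u.2 * s1)).
  rewrite !pmulrn !pairMz /= !PoszM abszEsg.
  by congr (_, _) => /=; rewrite /D; ring.
by rewrite E; apply: per_add; apply: perMz.
Qed.

Definition op x e := fun g => e (g + x.1) - x.2 * e g.

Lemma finite_valued_op x e : finite_valued e -> finite_valued (op x e).
Proof.
move=> [vals H]; exists [seq p - x.2 * q | p <- vals, q <- vals] => g.
by apply/allpairsP; exists (e (g + x.1), e g); split; rewrite /= ?H.
Qed.

Lemma doubly_periodic_op x e : doubly_periodic e -> doubly_periodic (op x e).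
Proof.
move=> de; apply: doubly_periodic_ext (doubly_periodic_lin 1 (- x.2) (doubly_periodic_shift x.1 de) de) => g.
by rewrite /op mul1r mulNr.
Qed.

Lemma opC x y e : op x (op y e) = op y (op x e).
Proof. by apply: funext => g; rewrite /op (addrAC g); ring. Qed.

Fixpoint ops L e := if L is x :: L' then op x (ops L' e) else e.

Lemma ops_op L x e : ops L (op x e) = op x (ops L e).
Proof. by elim: L => //= y L ->; exact: opC. Qed.

Lemma ops_cat L K e : ops (L ++ K) e = ops L (ops K e).
Proof. by elim: L => //= x L ->. Qed.

Lemma ops_catC L K e : ops L (ops K e) = ops K (ops L e).
Proof. by elim: L => //= x L ->; rewrite ops_op. Qed.

Lemma ops_perm L K e : perm_eq L K -> ops L e = ops K e.
Proof.
elim: L K => [|x L IH] K; first by rewrite perm_sym => /perm_nilP ->.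
move=> p; have xK : x \in K by rewrite -(perm_mem p) inE eqxx.
case/splitPr: xK p => K1 K2; rewrite -[x :: K2]cat1s perm_sym perm_catCA perm_sym /= perm_cons.
by move=> /IH ->; rewrite !ops_cat /= ops_op.
Qed.

Lemma finite_valued_ops L e : finite_valued e -> finite_valued (ops L e).
Proof. by elim: L => //= x L IH /IH; apply: finite_valued_op. Qed.

Lemma doubly_periodic_ops L e : doubly_periodic e -> doubly_periodic (ops L e).
Proof. by elim: L => //= x L IH /IH; apply: doubly_periodic_op. Qed.

(* Along the line g + Z w, the pair (e g, position mod N) evolves
   deterministically in a finite set. *)
Lemma affine_recurrence w z e N : finite_valued e -> (0 < N)%N -> per (w *+ N) (op (w, z) e) ->
  exists2 M, (0 < M)%N & per (w *+ M) e.
Proof.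
move=> [vals ev] N0 pd; set d := op _ _ in pd.
pose m := (size vals).+1.
have [K K0 KE] : exists2 K, (0 < K)%N & K = (#|{: 'I_m * 'I_N}|)`!.
  by eexists; [|reflexivity]; exact: fact_gt0.
exists K => // g.
have modN (i : int) : (absz (i %% N%:Z)%Z < N)%N.
  have := ltz_pmod i (d := N%:Z) N0; have := modz_ge0 i (d := N%:Z).
  by move: (i %% N%:Z)%Z => r; lia.
pose st (i : int) : 'I_m * 'I_N :=
  (inord (index (e (g + w *~ i)) vals), Ordinal (modN i)).
have det i j : st i = st j -> st (i + 1) = st (j + 1).
  move=> [/(congr1 val) /=]; rewrite !inordK ?ltnS ?index_size// => eij.
  have {}eij : e (g + w *~ i) = e (g + w *~ j).
    by rewrite -(nth_index 0 (ev (g + w *~ i))) eij nth_index.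
  move=> mij.
  have {}mij : (i %% N%:Z)%Z = (j %% N%:Z)%Z.
    have := modz_ge0 i (d := N%:Z); have := modz_ge0 j (d := N%:Z).
    by move: (i %% N%:Z)%Z (j %% N%:Z)%Z mij => r s; lia.
  have dij : d (g + w *~ i) = d (g + w *~ j).
    rewrite (divz_eq i N%:Z) (divz_eq j N%:Z) mij !mulrzDr ![_ * N%:Z]mulrC !mulrzA -!pmulrn.
    rewrite (addrC (_ *~ _)) (addrC (_ *~ (j %/ _)%Z)) !addrA.
    by rewrite !(perMz _ pd).
  have step k : e (g + w *~ (k + 1)) = z * e (g + w *~ k) + d (g + w *~ k).
    by rewrite /d /op /= mulrzDr mulr1z addrA; ring.
  rewrite /st !step eij dij; congr (_, _); apply: val_inj => /=.
  by rewrite -modzDml mij modzDml.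
have := deterministic_periodic det 0; rewrite -KE add0r => -[/(congr1 val) /=].
rewrite !inordK ?ltnS ?index_size// mulr0z addr0 -pmulrn => eK _.
by rewrite -(nth_index 0 (ev (g + w *+ K))) eK nth_index.
Qed.

Lemma recurrence_list w K e N : finite_valued e -> all (fun x => x.1 == w) K -> (0 < N)%N ->
  per (w *+ N) (ops K e) -> exists2 M, (0 < M)%N & per (w *+ M) e.
Proof.
elim: K N => [|[w' z] K IH] N fe /=; first by move=> _; exists N.
move=> /andP[/eqP -> aK] N0 /(affine_recurrence (finite_valued_ops K fe) N0)[M M0].
exact: IH.
Qed.

Lemma doubly_periodic_power u z e (k : nat) : doubly_periodic (op (u, z) e) ->
  doubly_periodic (fun g => e (g + u *+ k) - z ^+ k * e g).
Proof.
move=> db; elim: k => [|k IH].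
  by apply: doubly_periodic_ext DP0 => g; rewrite mulr0n addr0 expr0 mul1r subrr.
apply: doubly_periodic_ext (doubly_periodic_lin 1 (z ^+ k) (doubly_periodic_shift u IH) db) => g.
by rewrite /op /= mulrS exprSr addrA; ring.
Qed.

(* If f = (X^u - z) e and (X^u - z) f is doubly periodic, then X^(k u) e = z^k e
   + k z^(k-1) f up to a doubly periodic function. For k with X^(k u) e = e and
   X^(k u) f = f, if z^k = 1 then k z^(k-1) f is doubly periodic, otherwise (z^k
   - 1) f is. *)
Lemma op_square u z e : finite_valued e -> z != 0 ->
  doubly_periodic (op (u, z) (op (u, z) e)) -> doubly_periodic (op (u, z) e).
Proof.
move=> fe z0; set f := op (u, z) e => db; have ff : finite_valued f := finite_valued_op (u, z) fe.
have [N N0 dN] := db.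
have [M1 M10 fM] := affine_recurrence ff N0 (dN u).
have [M2 M20 eM] := affine_recurrence fe M10 fM.
pose M := (M1 * M2)%N; have M0 : (0 < M)%N by rewrite muln_gt0 M10.
have {}fM : per (u *+ M) f by rewrite mulrnA; apply: perM.
have {}eM : per (u *+ M) e by rewrite /M mulnC mulrnA; apply: perM.
have [zM|zM] := eqVneq (z ^+ M) 1; last first.
  have := doubly_periodic_power M db => H; apply: (@doubly_periodic_unscale (1 - z ^+ M)).
    by rewrite subr_eq0 eq_sym.
  by apply: doubly_periodic_ext H => g; rewrite fM mulrBl mul1r.
have H (k : nat) : doubly_periodic (fun g => z * e (g + u *+ k) - z ^+ k.+1 * e g - k%:R * z ^+ k * f g).
  elim: k => [|k IH].
    by apply: doubly_periodic_ext DP0 => g; rewrite mulr0n addr0 !mul0r expr1 subr0 subrr.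
  apply: doubly_periodic_ext (doubly_periodic_lin 1 (k%:R * z ^+ k) (doubly_periodic_shift u IH) db) => g.
  by rewrite /op -/f mulrS addrA -(natr1 k) !exprS /f /op /=; ring.
have := H M => {}H; apply: (@doubly_periodic_unscale (- (M%:R * z ^+ M))).
  by rewrite oppr_eq0 zM mulr1 pnatr_eq0 -lt0n.
by apply: doubly_periodic_ext H => g; rewrite eM exprS zM mulr1 subrr sub0r mulNr.
Qed.

End DoublyPeriodic.

(** * A minimal product of linear factors *)

Definition det (u v : Z2) : int := u.1 * v.2 - u.2 * v.1.

(* Of u and -u exactly one is normalized, so that parallel directions are equal.
   *)
Definition normalized (u : Z2) := (0 < u.1) || ((u.1 == 0) && (0 < u.2)).

Definition direction (u : Z2) := normalized u /\ exists w, det u w = 1.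

Lemma direction_decomp (v : Z2) : v != 0 ->
  exists (u : Z2) (d : nat), [/\ direction u, (0 < d)%N & v = u *+ d \/ v = - (u *+ d)].
Proof.
case: v => x y v0; have [p [q E]] := Bezoutz x y.
have d0 : gcdz x y != 0.
  by rewrite gcdz_eq0; apply: contra v0 => /andP[/eqP -> /eqP ->].
have [a xE] : exists a, x = a * gcdz x y by apply/dvdzP; exact: dvdz_gcdl.
have [b yE] : exists b, y = b * gcdz x y by apply/dvdzP; exact: dvdz_gcdr.
have dE : gcdz x y = (absz (gcdz x y))%:Z by rewrite /gcdz.
move: (gcdz x y) d0 xE yE E dE => d d0 xE yE E dE.
have ab : a * p + b * q = 1.
  by apply: (mulIf d0); rewrite mul1r -[RHS]E xE yE; ring.
case: (boolP (normalized (a, b))) => nab.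
  exists (a, b), (absz d); split; [|by lia|].
    by split=> //; exists (- q, p); rewrite /det /=; lia.
  by left; rewrite pairMn /= -dE -xE -yE.
exists (- a, - b), (absz d); split; [|by lia|].
  split; last by exists (q, - p); rewrite /det /=; lia.
  have ab0 : ~ (a = 0 /\ b = 0) by move=> [a0 b0]; move: ab; rewrite a0 b0 !mul0r.
  by move: nab; rewrite /normalized /=; lia.
by right; rewrite pairMn /= -dE !mulNr -xE -yE; congr (_, _); rewrite opprK.
Qed.

Lemma direction_det (u v : Z2) : direction u -> direction v -> det u v = 0 -> u = v.
Proof.
case: u v => [a b] [a' b'] [n1 [[w1 w2] d1]] [n2 [[w1' w2'] d2]].
rewrite /det /= in d1 d2 *; rewrite /normalized /= in n1 n2 => d0.
(* The ratio of the two vectors, an integer thanks to the Bezout vector w. It divides 1, and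
   normalization excludes -1. *)
set al := a' * w2 - b' * w1.
have e1 : a' = al * a.
  rewrite /al -[LHS]mulr1 -d1.
  by apply: (eq_by_sub (congr1 ( *%R w1) d0)); ring.
have e2 : b' = al * b.
  rewrite /al -[LHS]mulr1 -d1.
  by apply: (eq_by_sub (congr1 ( *%R w2) d0)); ring.
have u1 : al * (a * w2' - b * w1') = 1 by rewrite -d2 e1 e2; ring.
have : al = 1 \/ al = -1.
  have := congr1 absz u1; rewrite abszM => /eqP; rewrite muln_eq1 => /andP[/eqP a1 _].
  by move: al a1 {e1 e2 u1} => al; lia.
case=> alE; rewrite alE in e1 e2; last by exfalso; lia.
by congr (_, _); lia.
Qed.

Section Products.
Variable V : numClosedFieldType.
Implicit Types (e f b : Z2 -> V) (x : Z2 * V) (L K : seq (Z2 * V)) (u v w g : Z2).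

Definition good L := forall x, x \in L -> direction x.1 /\ x.2 != 0.

Lemma ops_lin L (p : V) e f g : ops L (fun g => p * e g + f g) g = p * ops L e g + ops L f g.
Proof. by elim: L g => //= x L IH g; rewrite /op !IH; ring. Qed.

Lemma ops_shift L e t g : ops L (fun y => e (y + t)) g = ops L e (g + t).
Proof. by elim: L g => //= x L IH g; rewrite /op !IH addrAC. Qed.

(** Stated for any linear T, since it is needed both for shifts and for the operators a in Af. *)
Lemma factor_operator (T : (Z2 -> V) -> Z2 -> V) (zs : seq V) e g :
  (forall p e f g, T (fun g => p * e g + f g) g = p * T e g + T f g) ->
  foldr (fun z e g => T e g - z * e g) e zs g =
  \sum_(i < (size zs).+1) (\prod_(z <- zs) ('X - z%:P))`_i * iter i T e g.
Proof.
move=> lin; elim: zs g => [|z zs IH] g /=.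
  by rewrite big_nil big_ord1 coef1 mul1r.
have T0 h : T (fun _ => 0) h = 0.
  have := lin (-1) (fun _ => 0) (fun _ => 0) h.
  rewrite (_ : (fun g => -1 * 0 + 0) = fun _ : Z2 => 0 : V); last by apply: funext => y; rewrite mulr0 addr0.
  by rewrite mulN1r addNr.
have Tsum n (a : nat -> V) h : T (fun y => \sum_(i < n) a i * iter i T e y) h = \sum_(i < n) a i * iter i.+1 T e h.
  elim: n => [|n IHn].
    rewrite big_ord0 (_ : (fun y => _) = fun _ : Z2 => 0) ?T0//.
    by apply: funext => y; rewrite big_ord0.
  rewrite big_ord_recr /= -IHn addrC -lin; congr (T _ h).
  by apply: funext => y; rewrite big_ord_recr /= addrC.
rewrite (_ : foldr _ e zs = fun y => \sum_(i < (size zs).+1) (\prod_(z <- zs) ('X - z%:P))`_i * iter i T e y); last exact: funext.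
rewrite Tsum big_cons; set q := \prod_(_ <- _) _.
have sq : size q = (size zs).+1 by rewrite size_prod_XsubC.
rewrite [RHS](eq_bigr (fun i : 'I_(size zs).+2 => ('X * q)`_i * iter i T e g - z * (q`_i * iter i T e g))); last first.
  by move=> i _; rewrite mulrBl coefB coefCM mulrBl -mulrA.
rewrite sumrB; congr (_ - _).
  rewrite [RHS]big_ord_recl coefXM mul0r add0r; apply: eq_bigr => i _.
  by rewrite coefXM.
by rewrite -mulr_sumr [in RHS]big_ord_recr /= [q`_(size zs).+1]nth_default ?sq// mul0r addr0.
Qed.

Lemma shift_factor u (zs : seq V) e g :
  ops [seq (u, z) | z <- zs] e g =
  \sum_(i < (size zs).+1) (\prod_(z <- zs) ('X - z%:P))`_i * e (g + u *+ i).
Proof.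
pose T e g : V := e (g + u) : V.
have it i h : iter i T e h = e (h + u *+ i).
  elim: i h => [|i IH] h /=; first by rewrite mulr0n addr0.
  by rewrite /T IH mulrS addrA.
have := @factor_operator T zs e g (fun _ _ _ _ => erefl).
have -> : foldr (fun z e g => T e g - z * e g) e zs = ops [seq (u, z) | z <- zs] e.
  by elim: zs => //= z zs ->.
by move=> ->; apply: eq_bigr => i _; rewrite it.
Qed.

(** X^(d u) - 1 splits into factors X^u - z over the d-th roots of unity; a reversed direction
    changes it only by a unit. *)
Lemma good_product (L : seq Z2) e : 0 \notin L -> (forall g, difference_ops L e g = 0) ->
  exists2 K, good K & forall g, ops K e g = 0.
Proof.
elim: L e => [|v L IH] e /=; first by move=> _ H; exists [::].
rewrite inE negb_or eq_sym => /andP[v0 L0] H.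
have [K gK KE] := IH _ L0 H.
have [u [d [du d0 vE]]] := direction_decomp v0.
have {}KE g : ops K (fun g => e (g + u *+ d) - e g) g = 0.
  have E t h : ops K (fun g => e (g + t) - e g) h = ops K e (h + t) - ops K e h.
    rewrite (_ : (fun g => _) = fun g => -1 * e g + e (g + t)); last by apply: funext => y; rewrite mulN1r addrC.
    by rewrite ops_lin ops_shift mulN1r addrC.
  move: KE; case: vE => -> KE; first exact: KE.
  have := KE (g + u *+ d); rewrite !E addrK => /eqP; rewrite subr_eq0 => /eqP ->.
  by rewrite subrr.
have [zs zsE] := closed_field_poly_normal ('X^d - 1 : {poly V}).
have lc : lead_coef ('X^d - 1 : {poly V}) = 1 by rewrite (monicP (monicXnsubC 1 d0)).
rewrite lc scale1r in zsE.
have szs : (size zs).+1 = d.+1.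
  by rewrite -(size_prod_XsubC zs id) -zsE size_XnsubC.
exists (K ++ [seq (u, z) | z <- zs]).
  move=> x; rewrite mem_cat => /orP[/gK//|/mapP[z zz ->]] /=; split=> //.
  apply/eqP => z0; rewrite z0 in zz.
  have : root ('X^d - 1 : {poly V}) 0 by rewrite zsE root_prod_XsubC.
  by rewrite /root !hornerE expr0n -[d == 0%N]negbK -lt0n d0 /= sub0r oppr_eq0 oner_eq0.
move=> g; rewrite ops_cat -[RHS](KE g); congr (ops K _ g).
apply: funext => h; rewrite shift_factor -zsE szs.
case: d d0 {zsE lc szs vE KE} => // d _; rewrite big_ord_recr big_ord_recl /=.
rewrite !coefB !coefXn !coef1 eqxx big1 => [|i _].
  by rewrite /= !mulr0n mulr1n !addr0; ring.
rewrite coefB coefXn coef1 /= /bump /= add1n eqSS.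
by rewrite (ltn_eqF (ltn_ord i)) subr0 mul0r.
Qed.

(** A product of least length making c doubly periodic. A repeated factor could be dropped by
    [op_square]; if all directions agreed, undoing the factors by [recurrence_list] would give c a
    period. *)
Lemma minimal_product c : finite_valued c -> (forall h, h != 0 -> ~ per h c) ->
  (exists2 K, good K & forall g, ops K c g = 0) ->
  exists L, [/\ good L, uniq L,
    forall x, x \in L -> ~ doubly_periodic (ops (rem x L) c) /\ doubly_periodic (op x (ops (rem x L) c)) &
    exists x y, [/\ x \in L, y \in L & det x.1 y.1 != 0]].
Proof.
move=> fc np [K gK KE].
pose P n := `[< exists L, [/\ good L, doubly_periodic (ops L c) & size L = n] >].
have exP : exists n, P n.
  exists (size K); apply/asboolP; exists K; split=> //.
  by apply: doubly_periodic_ext (DP0 _) => g; rewrite KE.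
case: (ex_minnP exP) => n /asboolP[L [gL dL sL]] min.
have min' L' : good L' -> (size L' < n)%N -> ~ doubly_periodic (ops L' c).
  move=> g' lt d'; have : P (size L') by apply/asboolP; exists L'.
  by move=> /min; rewrite leqNgt lt.
have gsub (L' : seq (Z2 * V)) : {subset L' <= L} -> good L' by move=> sub x /sub; exact: gL.
have H x : x \in L -> ~ doubly_periodic (ops (rem x L) c) /\ doubly_periodic (op x (ops (rem x L) c)).
  move=> xL; split.
    apply: min'; first by apply: gsub => y; exact: mem_rem.
    by rewrite size_rem// sL; case: (n) sL => // /size0nil E; rewrite E in xL.
  by rewrite -[op x _]/(ops (x :: rem x L) c) -(ops_perm _ (perm_to_rem xL)).
exists L; split=> //.
  apply: contrapT => /negP nu.
  have [x xL xL'] : exists2 x, x \in L & x \in rem x L.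
    elim: (L) nu => //= a l IH; rewrite negb_and negbK => /orP[al|/IH[x xl xr]].
      by exists a; rewrite ?inE ?eqxx.
    exists x; first by rewrite inE xl orbT.
    by case: eqP => // _; rewrite inE xr orbT.
  have [nd] := H x xL.
  have E : ops (rem x L) c = op x (ops (rem x (rem x L)) c).
    by rewrite (ops_perm _ (perm_to_rem xL')).
  rewrite E in nd *; case: x {xL'} xL nd {E} => u z xL nd /op_square H2; apply: nd; apply: H2.
    exact: finite_valued_ops.
  by have [] := gL _ xL.
apply: contrapT => no.
have same x y : x \in L -> y \in L -> x.1 = y.1.
  move=> xL yL; apply: direction_det; [by have [] := gL _ xL|by have [] := gL _ yL|].
  by apply/eqP; apply: contrapT => /negP ne; apply: no; exists x, y.
have [N N0 dN] := dL.
have npM v M : v != 0 -> (0 < M)%N -> ~ per (v *+ M) c.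
  move=> v0 M0; apply: np.
  case: v v0 => a b v0; apply/eqP => E.
  move: E; rewrite pairMn => E.
  have /eqP := congr1 fst E; have /eqP := congr1 snd E.
  have M1 : (M%:Z == 0) = false by lia.
  rewrite /= !mulf_eq0 M1 !orbF.
  by move=> /eqP b0 /eqP a0; move: v0; rewrite a0 b0 eqxx.
case: {2}L (erefl L) => [|x L0] LE.
  by move: dN; rewrite LE /= => dN; apply: (npM (1, 0) _ _ N0).
have xL : x \in L by rewrite LE inE eqxx.
have [|M M0 cM] := @recurrence_list _ x.1 L c N fc _ N0 (dN _).
  by apply/allP => y yL; apply/eqP; apply: same.
apply: (npM x.1 M) => //.
have [[+ [w d1]] _] := gL _ xL.
by move=> _; apply/eqP => x0; move: d1; rewrite /det x0 /= !mul0r subrr.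
Qed.

End Products.

Section Characters.
Variable V : numClosedFieldType.

(** * Characters and curves X^u = z *)

(* J shifts the exponents, which are assumed to satisfy 0 <= J + j x. *)
Definition laurent_poly (I : Type) (r : seq I) (c : I -> V) (j : I -> int) (J : nat) : {poly V} :=
  \sum_(x <- r) c x *: 'X^(absz (J%:Z + j x)).

Lemma laurent_poly_eval (I : eqType) (r : seq I) (c : I -> V) (j : I -> int) (J : nat) t :
  {in r, forall x, 0 <= J%:Z + j x} -> t != 0 ->
  (laurent_poly r c j J).[t] = t ^+ J * \sum_(x <- r) c x * t ^ (j x).
Proof.
move=> Jr t0; rewrite /laurent_poly horner_sum big_distrr /= big_seq [RHS]big_seq.
apply: eq_bigr => x xr; rewrite hornerZ hornerXn mulrCA; congr (_ * _).
rewrite !exprnP -expfzDr//; congr (t ^ _).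
by have := Jr x xr; move: (j x) => k; lia.
Qed.

Lemma laurent_poly_coef (I : eqType) (r : seq I) (c : I -> V) (j : I -> int) (J : nat) (k : int) :
  {in r, forall x, 0 <= J%:Z + j x} -> 0 <= J%:Z + k ->
  (laurent_poly r c j J)`_(absz (J%:Z + k)) = \sum_(x <- r | j x == k) c x.
Proof.
move=> Jr Jk; rewrite /laurent_poly coef_sum [RHS]big_mkcond [LHS]big_seq [RHS]big_seq.
apply: eq_bigr => x xr; rewrite coefZ coefXn.
have -> : (absz (J%:Z + k) == absz (J%:Z + j x)) = (j x == k).
  by have := Jr x xr; move: (j x) => i; lia.
by case: eqP; rewrite ?mulr1 ?mulr0.
Qed.

Lemma poly_all_roots (P : {poly V}) : (forall t, t != 0 -> P.[t] = 0) -> P = 0.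
Proof.
move=> H; apply: contrapT => /eqP P0.
have := @max_poly_roots _ P [seq i%:R | i <- iota 1 (size P)] P0.
rewrite size_map size_iota ltnn => /(_ _ _)/negP; apply => //.
  apply/allP => x /mapP[i]; rewrite mem_iota => /andP[i0 _] ->.
  by apply/eqP/H; rewrite pnatr_eq0 -lt0n.
rewrite map_inj_uniq ?iota_uniq// => i k /eqP; rewrite eqr_nat => /eqP//.
Qed.

(** Evaluates the linear map 'X^k |-> F k; with F k the shift by k w a polynomial becomes an
    operator. *)
Lemma laurent_poly_sum (I : eqType) (r : seq I) (c : I -> V) (j : I -> int) (J : nat) (F : nat -> V) :
  \sum_(k < size (laurent_poly r c j J)) (laurent_poly r c j J)`_k * F k =
  \sum_(x <- r) c x * F (absz (J%:Z + j x)).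
Proof.
pose n x := absz (J%:Z + j x); set P := laurent_poly r c j J.
pose N := (size P + \sum_(x <- r) (n x).+1)%N.
have -> : \sum_(k < size P) P`_k * F k = \sum_(k < N) P`_k * F k.
  rewrite -(big_mkord xpredT (fun k => P`_k * F k)) -[RHS](big_mkord xpredT (fun k => P`_k * F k)).
  rewrite (@big_cat_nat _ _ _ (size P) 0 N) ?leq_addr//= [X in _ = _ + X]big_nat.
  by rewrite [X in _ = _ + X]big1 ?addr0// => k /andP[h _]; rewrite nth_default ?mul0r.
under eq_bigr do rewrite /P /laurent_poly coef_sum big_distrl /=.
rewrite exchange_big /= big_seq [RHS]big_seq; apply: eq_bigr => x xr.
have nN : (n x < N)%N.
  by rewrite /N (big_rem x xr)/=; move: (n x) (\sum_(_ <- _) _)%N => a b; lia.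
rewrite (bigD1 (Ordinal nN))//= coefZ coefXn eqxx mulr1 big1 ?addr0// => k ne.
rewrite coefZ coefXn; case: eqP => [e|_]; last by rewrite mulr0 mul0r.
by case/eqP: ne; apply: val_inj.
Qed.

Definition character (rho : Z2 -> V) := rho 0 = 1 /\ forall s t, rho (s + t) = rho s * rho t.

Lemma character_neq0 rho s : character rho -> rho s != 0.
Proof.
move=> [r1 rD]; apply/eqP => s0; have := r1.
by rewrite -(subrr s) rD s0 mul0r => /esym/eqP; rewrite oner_eq0.
Qed.

Lemma characterMz rho s (n : int) : character rho -> rho (s *~ n) = rho s ^ n.
Proof.
move=> cr; have [r1 rD] := cr.
have N (m : nat) : rho (s *+ m) = rho s ^+ m.
  by elim: m => [|m IH]; rewrite ?mulr0n ?expr0// mulrS rD IH exprS.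
case: (intP n) => [|m|m]; first by rewrite mulr0z expr0z.
  by rewrite -pmulrn N exprnP.
rewrite mulrNz -pmulrn -exprnN -N; apply: (mulfI (character_neq0 (s *+ m.+1) cr)).
by rewrite -rD subrr r1 divff// character_neq0.
Qed.

Section Basis.
Variables u w : Z2.
Hypothesis uw : det u w = 1.

Lemma basisE s : s = u *~ (coord u w s).1 + w *~ (coord u w s).2.
Proof.
by rewrite !pairMz -{1}(coordK uw s) /lattice; congr (_, _) => /=; ring.
Qed.

Lemma coordD s t : coord u w (s + t) = coord u w s + coord u w t.
Proof. by rewrite /coord; congr (_, _) => /=; ring. Qed.

(** Parametrizes the curve X^u = z by the value t of X^w. *)
Definition chr (z t : V) (s : Z2) := z ^ (coord u w s).1 * t ^ (coord u w s).2.

Lemma coord_u : coord u w u = (1, 0).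
Proof. by rewrite /coord -/(det u w) uw; congr (_, _); ring. Qed.

Lemma chr_u z t : chr z t u = z.
Proof. by rewrite /chr coord_u /= expr1z expr0z mulr1. Qed.

Lemma character_chr z t : z != 0 -> t != 0 -> character (chr z t).
Proof.
move=> z0 t0; split.
  by rewrite /chr /coord /= !mul0r !mulr0 subrr !expr0z mulr1.
by move=> s s'; rewrite /chr coordD /= !expfzDr//; ring.
Qed.

Lemma character_eq_chr rho s : character rho -> rho s = chr (rho u) (rho w) s.
Proof.
move=> cr; rewrite {1}(basisE s) (proj2 cr) !characterMz//.
Qed.

Lemma coord_bound (r : seq Z2) : exists J : nat,
  {in r, forall s, 0 <= J%:Z + (coord u w s).2}.
Proof.
exists (\sum_(s <- r) absz (coord u w s).2)%N => s sr.
by rewrite (big_rem s sr) /=; move: (coord u w s).2 (\sum_(_ <- _) _)%N => a b; lia.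
Qed.

End Basis.

Implicit Types (e : Z2 -> V) (l : seq (V * Z2)).

Lemma doubly_periodic_sum (I : Type) (r : seq I) (E : I -> Z2 -> V) :
  (forall x, doubly_periodic (E x)) -> doubly_periodic (fun g => \sum_(x <- r) E x g).
Proof.
move=> H; elim: r => [|x r IH].
  by apply: doubly_periodic_ext (DP0 V) => g; rewrite big_nil.
by apply: doubly_periodic_ext (doubly_periodic_lin 1 1 (H x) IH) => g; rewrite big_cons !mul1r.
Qed.

Lemma doubly_periodic_powerz u z e (i : int) : z != 0 -> doubly_periodic (op (u, z) e) ->
  doubly_periodic (fun g => e (g + u *~ i) - z ^ i * e g).
Proof.
move=> z0 db; case: (intP i) => [|k|k]; [|exact: (doubly_periodic_power k.+1 db)|].
  by apply: doubly_periodic_ext (DP0 V) => g; rewrite mulr0z addr0 expr0z mul1r subrr.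
apply: doubly_periodic_ext (doubly_periodic_scale (- z ^- k.+1) (doubly_periodic_shift (- (u *+ k.+1)) (doubly_periodic_power k.+1 db))) => g.
rewrite subrK mulrNz -pmulrn -exprnN mulrBr !mulNr opprK mulrA mulVf ?mul1r 1?addrC//.
by rewrite expf_neq0.
Qed.

(* Modulo doubly periodic functions X^u acts on e as z, so l acts as a
   polynomial in X^w, which splits into linear factors; each of them can be
   undone by the affine recurrence. *)
Lemma doubly_periodic_lop_inv u w z e l (rho : Z2 -> V) : det u w = 1 -> z != 0 -> finite_valued e ->
  doubly_periodic (op (u, z) e) -> character rho -> rho u = z -> lop l rho 0 != 0 ->
  doubly_periodic (lop l e) -> doubly_periodic e.
Proof.
move=> uw z0 fe db cr rz lr dl.
pose i (x : V * Z2) := (coord u w x.2).1; pose j (x : V * Z2) := (coord u w x.2).2.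
have [J JP] : exists J : nat, {in l, forall x, 0 <= J%:Z + j x}.
  have [J JP] := coord_bound uw (map snd l).
  by exists J => x xl; apply: JP; apply: map_f.
pose E g := \sum_(x <- l) (x.1 * z ^ i x) * e (g + w *~ j x).
have dE : doubly_periodic E.
  apply: (@doubly_periodic_unscale _ (-1)); first by rewrite oppr_eq0 oner_eq0.
  have H (x : V * Z2) : doubly_periodic (fun g => x.1 * (e (g + x.2) - z ^ i x * e (g + w *~ j x))).
    apply: doubly_periodic_scale; apply: doubly_periodic_ext (doubly_periodic_shift (w *~ j x) (doubly_periodic_powerz (i x) z0 db)) => g.
    by rewrite {1}(basisE uw x.2) -addrA (addrC (w *~ _)).
  apply: doubly_periodic_ext (doubly_periodic_lin 1 (-1) (doubly_periodic_sum l H) dl) => g.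
  rewrite /E /lop mul1r mulN1r -sumrB mulr_sumr; apply: eq_bigr => x _.
  by rewrite mulN1r; ring.
(* l with X^u replaced by z, as a polynomial in X^w. Its value at rho w is that of l at rho up to a
   unit, so it is nonzero. *)
pose P := laurent_poly l (fun x => x.1 * z ^ i x) j J.
have P0 : P != 0.
  have r0 := character_neq0 w cr.
  suff : P.[rho w] != 0 by apply: contra_neq => ->; rewrite horner0.
  rewrite laurent_poly_eval// mulf_neq0 ?expf_neq0//.
  move: lr; rewrite /lop; congr (_ != 0); apply: eq_bigr => x _.
  by rewrite add0r -mulrA; congr (_ * _); rewrite (character_eq_chr uw x.2 cr) rz.
have [ys PE] := closed_field_poly_normal P.
have lc0 : lead_coef P != 0 by rewrite lead_coef_eq0.
have dP : doubly_periodic (ops [seq (w, y) | y <- ys] e).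
  apply: (doubly_periodic_unscale lc0); apply: doubly_periodic_ext (doubly_periodic_shift (w *~ J%:Z) dE) => g.
  have -> : E (g + w *~ J%:Z) = \sum_(k < size P) P`_k * e (g + w *+ k).
    rewrite (laurent_poly_sum l _ j J (fun k => e (g + w *+ k))) /E big_seq [RHS]big_seq.
    apply: eq_bigr => x xl; rewrite -addrA -mulrzDr; congr (_ * e (g + _)).
    by rewrite pmulrn; congr (w *~ _); have := JP x xl; lia.
  have sP : size P = (size ys).+1.
    by rewrite PE size_scale// size_prod_XsubC.
  rewrite shift_factor sP mulr_sumr; apply: eq_bigr => k _.
  by rewrite [in LHS]PE coefZ mulrA.
have [N N0 dN] := dP; have [M M0 dM] := db.
have [|K K0 eK] := recurrence_list fe _ N0 (dN w).
  by apply/allP => x /mapP[y _ ->].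
have [K' K'0 eK'] := affine_recurrence fe M0 (dM u).
apply: (doubly_periodic_indep K'0 K0 _ eK' eK).
by rewrite -/(det u w) uw oner_eq0.
Qed.

End Characters.

(** * Dividing by X^u - z *)

Definition shrink (u : Z2) (S : seq Z2) := [seq s <- S | s + u \in S].

Lemma lconv_segment (S : seq Z2) (s u : Z2) (k m : nat) : lconv S -> s \in S ->
  s + u *+ k \in S -> (m <= k)%N -> s + u *+ m \in S.
Proof.
move=> cS sS kS mk; case: k mk kS => [|k] mk kS.
  by move: mk; rewrite leqn0 => /eqP ->; rewrite mulr0n addr0.
apply: (cS s (s + u *+ k.+1) s s _ (k.+1%:Z - m%:Z) m%:Z 0 0) => //; try lia.
  by rewrite !pairMn /=; ring.
by rewrite !pairMn /=; ring.
Qed.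

Lemma lconv_shrink u S : lconv S -> lconv (shrink u S).
Proof.
move=> cS q1 q2 q3 q4 g w1 w2 w3 w4; rewrite !mem_filter.
move=> /andP[h1 s1] /andP[h2 s2] /andP[h3 s3] /andP[h4 s4] p1 p2 p3 p4 W e1 e2.
rewrite (cS _ _ _ _ _ _ _ _ _ s1 s2 s3 s4 p1 p2 p3 p4 W e1 e2) andbT.
apply: (cS _ _ _ _ _ _ _ _ _ h1 h2 h3 h4 p1 p2 p3 p4 W) => /=.
  by rewrite mulrDr e1; ring.
by rewrite mulrDr e2; ring.
Qed.

Section Peel.
Variable V : numClosedFieldType.
Implicit Types (S : seq Z2) (a : Z2 -> V) (x : Z2 * V).

Definition vanishes S a x := forall rho, character rho -> rho x.1 = x.2 ->
  \sum_(s <- S) a s * rho s = 0.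

(** Along the curve t is free, so the coefficient of every power of t vanishes. *)
Lemma vanishes_line u w z S a : det u w = 1 -> z != 0 -> vanishes S a (u, z) ->
  forall k, \sum_(s <- S | (coord u w s).2 == k) a s * z ^ (coord u w s).1 = 0.
Proof.
move=> uw z0 van k; have [J JP] := coord_bound uw S.
pose c s := a s * z ^ (coord u w s).1; pose j s := (coord u w s).2.
have JP' : {in S, forall s, 0 <= (J + absz k)%N%:Z + j s}.
  by move=> s /JP; rewrite /j; move: (_.2) => i; lia.
have P0 : laurent_poly S c j (J + absz k) = 0.
  apply: poly_all_roots => t t0; rewrite laurent_poly_eval//.
  have := van _ (character_chr u w z0 t0) (chr_u uw z t) => E.
  apply/eqP; rewrite mulf_eq0; apply/orP; right; rewrite -[X in _ == X]E; apply/eqP.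
  by apply: eq_bigr => s _; rewrite /chr mulrA.
have := @laurent_poly_coef V _ S c j (J + absz k) k JP'; rewrite P0 coef0 => <- //.
by lia.
Qed.

Lemma peel_op u z S a a' : uniq S ->
  (forall s, s \notin shrink u S -> a' s = 0) ->
  (forall s, a s = a' (s - u) - z * a' s) ->
  forall (e : Z2 -> V) g,
  \sum_(s <- S) a s * e (g + s) = \sum_(s <- shrink u S) a' s * op (u, z) e (g + s).
Proof.
move=> uS a'0 aE e g.
have E1 : \sum_(s <- S) a' (s - u) * e (g + s) = \sum_(s <- shrink u S) a' s * e (g + s + u).
  rewrite (bigID (fun s => s - u \in shrink u S)) /= [X in _ + X]big1 ?addr0; last first.
    by move=> s /a'0 ->; rewrite mul0r.
  rewrite -big_filter.
  have P : perm_eq [seq s <- S | s - u \in shrink u S] [seq s + u | s <- shrink u S].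
    apply: uniq_perm; rewrite ?filter_uniq//.
      by rewrite map_inj_uniq ?filter_uniq//; apply: addIr.
    move=> s; rewrite mem_filter; apply/andP/mapP.
      by move=> [h _]; exists (s - u); rewrite ?subrK.
    by move=> [t tS ->]; rewrite addrK; split=> //; move: tS; rewrite mem_filter => /andP[].
  rewrite (perm_big _ P) big_map; apply: eq_bigr => s _.
  by rewrite addrK addrA.
have E2 : \sum_(s <- S) a' s * e (g + s) = \sum_(s <- shrink u S) a' s * e (g + s).
  rewrite /shrink big_filter [RHS]big_mkcond big_seq [RHS]big_seq; apply: eq_bigr => s sS.
  by case: ifP => // h; rewrite a'0 ?mul0r// mem_filter h.
under eq_bigr do rewrite aE mulrBl -mulrA.
rewrite sumrB -mulr_sumr E1 E2 mulr_sumr -sumrB; apply: eq_bigr => s _.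
by rewrite /op /=; ring.
Qed.

(* The quotient is a' s = sum_{k >= 1} z^(k-1) a (s + k u); the sums of z^k a (s
   + k u) over a whole line vanish, so by convexity a' lives where s and s + u
   are both in S. *)
Lemma peel u w z S a : det u w = 1 -> z != 0 -> uniq S -> lconv S ->
  (forall s, s \notin S -> a s = 0) -> vanishes S a (u, z) ->
  exists2 a', (forall s, s \notin shrink u S -> a' s = 0) &
    forall s, a s = a' (s - u) - z * a' s.
Proof.
move=> uw z0 uS cS a0 van.
pose i s := (coord u w s).1.
pose K := (1 + 2 * \sum_(s <- S) absz (i s))%N.
have iD s k : i (s + u *+ k) = i s + k%:Z.
  by rewrite /i coordD pmulrn [coord u w (u *~ _)](_ : _ = (k%:Z, 0)) //
    pairMz /coord /=; congr (_, _); [rewrite -[RHS]mul1r -uw /det|]; ring.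
have jD s k : (coord u w (s + u *+ k)).2 = (coord u w s).2.
  by rewrite pairMn /coord /=; ring.
have KP s k : s \in S -> s + u *+ k \in S -> (k < K)%N.
  have bd t : t \in S -> (absz (i t) <= \sum_(s <- S) absz (i s))%N.
    by move=> tS; rewrite (big_rem t tS) /= leq_addr.
  move=> /bd h1 /bd; rewrite iD /K; move: (i s) (\sum_(_ <- _) _)%N h1 => p q; lia.
pose A s := \sum_(k < K) z ^+ k * a (s + u *+ k.+1).
have AE s : s \in S -> A (s - u) - z * A s = a s.
  move=> sS; rewrite /A.
  have -> : \sum_(k < K) z ^+ k * a (s - u + u *+ k.+1) = \sum_(k < K) z ^+ k * a (s + u *+ k).
    by apply: eq_bigr => k _; rewrite mulrS addrA subrK.
  have -> : z * (\sum_(k < K) z ^+ k * a (s + u *+ k.+1)) = \sum_(k < K) z ^+ k.+1 * a (s + u *+ k.+1).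
    by rewrite mulr_sumr; apply: eq_bigr => k _; rewrite exprS mulrA.
  have E1 : \sum_(k < K.+1) z ^+ k * a (s + u *+ k) = a s + \sum_(k < K) z ^+ k.+1 * a (s + u *+ k.+1).
    by rewrite big_ord_recl /= mulr0n addr0 expr0 mul1r.
  have E2 : \sum_(k < K.+1) z ^+ k * a (s + u *+ k) = \sum_(k < K) z ^+ k * a (s + u *+ k).
    rewrite big_ord_recr /= (a0 (s + u *+ K)) ?mulr0 ?addr0//.
    by apply/negP => /(KP _ _ sS); rewrite ltnn.
  by rewrite -E2 E1 addrK.
have A0 s : s \in S -> s \notin shrink u S -> A s = 0.
  move=> sS; rewrite mem_filter sS andbT => su; rewrite /A big1// => k _.
  rewrite a0 ?mulr0//; apply: contra su => kS.
  by have := @lconv_segment S s u k.+1 1 cS sS kS isT; rewrite mulr1n.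
(* By convexity s is the first point of S on its line, so A (s - u) runs over the whole line and is,
   up to a power of z, its vanishing sum. *)
have A1 s : s \in S -> s - u \notin S -> A (s - u) = 0.
  move=> sS su.
  have -> : A (s - u) = \sum_(k <- iota 0 K) z ^+ k * a (s + u *+ k).
    rewrite -[K in X in iota 0 X]subn0 -/(index_iota 0 K) big_mkord.
    by apply: eq_bigr => k _; rewrite mulrS addrA subrK.
  have := vanishes_line uw z0 van (coord u w s).2.
  rewrite -big_filter.
  have P : perm_eq [seq t <- S | (coord u w t).2 == (coord u w s).2]
             [seq t <- [seq s + u *+ k | k <- iota 0 K] | t \in S].
    apply: uniq_perm; rewrite ?filter_uniq//.
      rewrite map_inj_uniq ?iota_uniq// => k k' /(congr1 i); rewrite !iD; lia.
    move=> t; rewrite !mem_filter; apply/andP/andP => -[h1 h2]; split=> //; last first.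
      by case/mapP: h2 => k _ ->; rewrite jD.
    have tE : t = s + u *~ (i t - i s).
      rewrite {1}(basisE uw t) {1}(basisE uw s) (eqP h1) addrAC -mulrzDr.
      by congr (u *~ _ + _); rewrite /i; ring.
    have [m mE] : exists m : nat, i t - i s = m%:Z.
      case: (intP (i t - i s)) tE => [_|m _|m tE]; [by exists 0%N|by exists m.+1|].
      exfalso; case/negP: su.
      have := @lconv_segment S t u m.+1 m cS h2; rewrite tE mulrNz -pmulrn subrK.
      by move=> /(_ sS (leqnSn m)); rewrite mulrSr opprD addrA addrAC subrK.
    apply/mapP; exists m; last by rewrite tE mE -pmulrn.
    rewrite mem_iota /=; apply: (KP s) => //.
    by rewrite pmulrn -mE -tE.
  rewrite (perm_big _ P) big_filter big_mkcond big_map => E.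
  apply: (mulfI (_ : z ^ i s != 0)); first by rewrite expfz_neq0.
  rewrite mulr0 -[RHS]E mulr_sumr; apply: eq_bigr => k _; case: ifP => h.
    by rewrite -/(i _) iD (@expfzDr _ _ (i s) k) // exprnP; ring.
  by rewrite a0 ?h// !mulr0.
exists (fun s => if s \in shrink u S then A s else 0) => [s /negPf ->//|s].
have sub t : t \in shrink u S -> t \in S /\ t + u \in S.
  by rewrite mem_filter => /andP[].
case: (boolP (s \in S)) => sS; last first.
  rewrite (a0 s sS); case: ifP => [/sub[_]|_]; first by rewrite subrK (negPf sS).
  by case: ifP => [/sub[]|]; rewrite ?(negPf sS)// mulr0 subr0.
rewrite -AE//; congr (_ - _ * _).
  case: ifP => // /negbT; rewrite mem_filter subrK sS /= => su.
  exact: A1.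
by case: ifP => // /negbT; apply: A0.
Qed.

End Peel.

(** * Operators constant on the curves *)

Section Rank.
Variable V : numClosedFieldType.
Implicit Types (S : seq Z2) (a : Z2 -> V) (x y : Z2 * V) (L : seq (Z2 * V)).

Lemma expfz2_neq1 (n : int) : n != 0 -> (2 : V) ^ n != 1.
Proof.
have H (m : nat) : (2 : V) ^+ m.+1 != 1.
  by rewrite pexpr_eq1// ?ler0n// (eqr_nat V 2 1).
case: (intP n) => // m _; first by rewrite -exprnP H.
by rewrite -exprnN invr_eq1 H.
Qed.

(* On any other curve X^u - z is a nonzero Laurent polynomial. *)
Lemma good_escape L x y : good L -> x \in L -> y \in L -> x != y ->
  forall w, det y.1 w = 1 -> exists2 t : V, t != 0 & chr y.1 w y.2 t x.1 != x.2.
Proof.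
move=> gL xL yL xy w yw.
have [dy y0] := gL _ yL; have [dx x0] := gL _ xL.
case: (eqVneq (chr y.1 w y.2 1 x.1) x.2) => [e1|]; last by exists 1; rewrite ?oner_eq0.
exists 2; first by rewrite pnatr_eq0.
rewrite -e1 /chr exp1rz; have [b0|b0] := eqVneq (coord y.1 w x.1).2 0; last first.
  by rewrite (inj_eq (mulfI _)) ?expfz_neq0// expfz2_neq1.
exfalso; case/negP: xy.
have E : y.1 = x.1 by apply: direction_det.
move: e1; rewrite -E chr_u// => E'.
by rewrite (surjective_pairing x) (surjective_pairing y) E E'.
Qed.

(** Restricted to the curve of y, the product of a' and the factor x is zero. Polynomials in t form
    a domain and the factor is nonzero by [good_escape], so a' vanishes there. *)
Lemma vanishes_peel L S a a' x y : good L -> x \in L -> y \in L -> x != y -> uniq S ->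
  (forall s, s \notin shrink x.1 S -> a' s = 0) ->
  (forall s, a s = a' (s - x.1) - x.2 * a' s) ->
  vanishes S a y -> vanishes (shrink x.1 S) a' y.
Proof.
move=> gL xL yL xy uS a'0 aE van rho cr ry.
have [[_ [w yw]] y0] := gL _ yL.
have [t1 t10 F1] := good_escape gL xL yL xy yw.
have [J JP] := coord_bound yw (x.1 :: shrink x.1 S).
pose j s := (coord y.1 w s).2; pose c s := a' s * y.2 ^ (coord y.1 w s).1.
pose Q := laurent_poly (shrink x.1 S) c j J.
pose rF : seq (V * int) := [:: (y.2 ^ (coord y.1 w x.1).1, j x.1); (- x.2, 0)].
pose F := laurent_poly rF fst snd J.
have Qt t : t != 0 -> Q.[t] = t ^+ J * \sum_(s <- shrink x.1 S) a' s * chr y.1 w y.2 t s.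
  move=> t0; rewrite laurent_poly_eval// => [|s sS]; last by apply: JP; rewrite inE sS orbT.
  by congr (_ * _); apply: eq_bigr => s _; rewrite /chr mulrA.
have Ft t : t != 0 -> F.[t] = t ^+ J * (chr y.1 w y.2 t x.1 - x.2).
  move=> t0; rewrite laurent_poly_eval//.
    by rewrite !big_cons big_nil /= expr0z mulr1 addr0.
  move=> p; rewrite !inE => /orP[/eqP -> /=|/eqP -> /=]; last by lia.
  by apply: JP; rewrite inE eqxx.
have QF : Q * F = 0.
  apply: poly_all_roots => t t0; rewrite hornerM Qt// Ft//.
  have cc := character_chr y.1 w y0 t0.
  have := van _ cc (chr_u yw y.2 t).
  have := @peel_op V x.1 x.2 S a a' uS a'0 aE (chr y.1 w y.2 t) 0.
  under eq_bigr do rewrite add0r; move=> -> E.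
  rewrite mulrACA [X in _ * X](_ : _ = 0) ?mulr0// -[RHS]E mulr_suml.
  apply: eq_bigr => s _; rewrite /op /= add0r (proj2 cc); ring.
have F0 : F != 0.
  apply/eqP => F0; have := Ft _ t10; rewrite F0 horner0 => /esym/eqP.
  by rewrite mulf_eq0 expf_eq0 (negPf t10) andbF /= subr_eq0 (negPf F1).
have Q0 : Q = 0 by apply/eqP; move/eqP: QF; rewrite mulf_eq0 (negPf F0) orbF.
have r0 := character_neq0 w cr.
have := Qt _ r0; rewrite Q0 horner0 => /esym/eqP.
rewrite mulf_eq0 expf_eq0 (negPf r0) andbF /= => /eqP E; rewrite -[RHS]E.
by apply: eq_bigr => s _; rewrite (character_eq_chr yw s cr) ry.
Qed.

Fixpoint erode S L := if L is x :: L' then erode (shrink x.1 S) L' else S.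

(** The coefficients of X^s' times the product of the factors X^u - z in L. *)
Fixpoint peel_kernel L (s' s : Z2) : V :=
  if L is x :: L' then peel_kernel L' s' (s - x.1) - x.2 * peel_kernel L' s' s else (s == s')%:R.

Lemma peel_all L S a : good L -> uniq L -> uniq S -> lconv S ->
  (forall s, s \notin S -> a s = 0) -> (forall x, x \in L -> vanishes S a x) ->
  exists b : Z2 -> V, forall s, a s = \sum_(s' <- erode S L) b s' * peel_kernel L s' s.
Proof.
elim: L S a => [|x L IH] S a gL uL uS cS a0 van /=.
  exists a => s; case: (boolP (s \in S)) => sS.
    rewrite (bigD1_seq s)//= eqxx mulr1 big1 ?addr0// => t ts.
    by rewrite eq_sym (negPf ts) mulr0.
  rewrite a0// big_seq big1// => t tS; case: eqP => [e|_]; last by rewrite mulr0.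
  by move: sS; rewrite e tS.
have xL : x \in x :: L by rewrite inE eqxx.
have [[_ [w xw]] x0] := gL _ xL.
have [|a' a'0 aE] := peel xw x0 uS cS a0.
  by rewrite -surjective_pairing; apply: van.
have {}uL : x \notin L /\ uniq L by move: uL => /= /andP[].
have [||||||b bE] := IH (shrink x.1 S) a'.
- by move=> y yL; apply: gL; rewrite inE yL orbT.
- exact: uL.2.
- exact: filter_uniq.
- exact: lconv_shrink.
- exact: a'0.
- move=> y yL; have yL' : y \in x :: L by rewrite inE yL orbT.
  apply: (vanishes_peel gL xL yL' _ uS a'0 aE (van _ yL')).
  by apply: contraNneq uL.1 => ->.
exists b => s; rewrite aE !bE mulr_sumr -sumrB; apply: eq_bigr => t _; ring.
Qed.

Definition coef_fun S (a : 'rV[V]_(size S)) (s : Z2) : V :=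
  \sum_k a 0 k * (tnth (in_tuple S) k == s)%:R.

Lemma coef_funE S (a : 'rV[V]_(size S)) k : uniq S -> coef_fun a (tnth (in_tuple S) k) = a 0 k.
Proof.
move=> uS; rewrite /coef_fun (bigD1 k)//= eqxx mulr1 big1 ?addr0// => i ik.
rewrite (inj_eq (tuple_uniqP (in_tuple S) uS)) (negPf ik) mulr0//.
Qed.

Lemma coef_fun_out S (a : 'rV[V]_(size S)) s : s \notin S -> coef_fun a s = 0.
Proof.
move=> sS; apply: big1 => k _; case: eqP => [e|_]; last by rewrite mulr0.
by move: sS; rewrite -e mem_tnth.
Qed.

Lemma coef_fun_sum S (a : 'rV[V]_(size S)) (f : Z2 -> V) : uniq S ->
  \sum_(s <- S) coef_fun a s * f s = \sum_k a 0 k * f (tnth (in_tuple S) k).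
Proof.
by move=> uS; rewrite big_tnth; apply: eq_bigr => k _; rewrite coef_funE.
Qed.

(** Up to a scalar each operator is divisible by all factors, hence a combination of their product
    shifted by the points of the eroded set. *)
Lemma rank_bound L S s0 (Af : 'M[V]_(size S)) : good L -> uniq L -> uniq S -> lconv S -> s0 \in S ->
  (forall a : 'rV_(size S), (a <= Af)%MS -> exists lam, forall x, x \in L ->
     vanishes S (fun s => coef_fun a s - lam * (s == s0)%:R) x) ->
  (\rank Af <= 1 + size (erode S L))%N.
Proof.
move=> gL uL uS cS s0S H.
pose E := in_tuple (erode S L); pose T := in_tuple S.
pose M : 'M[V]_(1 + size (erode S L), size S) :=
  col_mx (\row_k (tnth T k == s0)%:R) (\matrix_(i, k) peel_kernel L (tnth E i) (tnth T k)).
suff : (Af <= M)%MS by move=> /mxrankS/leq_trans; apply; exact: rank_leq_row.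
apply/row_subP => i; have [lam lamP] := H _ (row_sub i Af).
have [|b bE] := peel_all gL uL uS cS _ lamP.
  move=> s sS; rewrite coef_fun_out//; case: eqP => [e|_]; last by rewrite mulr0 subr0.
  by move: sS; rewrite e s0S.
apply/submxP; exists (row_mx (const_mx lam) (\row_i b (tnth E i))).
rewrite mul_row_col; apply/rowP => k; rewrite !mxE big_ord1 !mxE.
have := bE (tnth T k); rewrite coef_funE// mxE => /eqP; rewrite subr_eq => /eqP ->.
rewrite addrC; congr (_ + _); rewrite big_tnth; apply: eq_bigr => l _.
by rewrite !mxE.
Qed.

End Rank.

Section Constants.
Variable V : numClosedFieldType.
Variables (S : seq Z2) (s0 : Z2).
Hypothesis uS : uniq S.
Hypothesis s0S : s0 \in S.
Implicit Types (x y : Z2 * V) (L : seq (Z2 * V)) (e c : Z2 -> V) (q : {poly V}).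

Let d (k : 'I_(size S)) : Z2 := tnth (in_tuple S) k - s0.
Variable a : 'rV[V]_(size S).
Let T := row_op a d.

Lemma row_op_lin p e1 e2 g : T (fun g => p * e1 g + e2 g) g = p * T e1 g + T e2 g.
Proof.
rewrite /T /row_op mulr_sumr -big_split; apply: eq_bigr => k _ /=; ring.
Qed.

Lemma row_op_op x e : T (op x e) = op x (T e).
Proof.
apply: funext => g; rewrite /T /row_op /op mulr_sumr -sumrB; apply: eq_bigr => k _.
by rewrite (addrAC g); ring.
Qed.

Lemma annihilator_op q x e :
  (forall g, \sum_(i < size q) q`_i * iter i T e g = 0) ->
  forall g, \sum_(i < size q) q`_i * iter i T (op x e) g = 0.
Proof.
move=> H g.
have it i : iter i T (op x e) = op x (iter i T e).
  by elim: i => //= i ->; rewrite row_op_op.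
under eq_bigr do rewrite it /op mulrBr mulrCA.
by rewrite sumrB -mulr_sumr !H mulr0 subrr.
Qed.

Lemma annihilator_ops q L e :
  (forall g, \sum_(i < size q) q`_i * iter i T e g = 0) ->
  forall g, \sum_(i < size q) q`_i * iter i T (ops L e) g = 0.
Proof. by move=> H; elim: L => //= x L; apply: annihilator_op. Qed.

(* Splitting q into factors, some a - lam maps a function that is not doubly
   periodic to one that is. *)
Lemma curve_constant q u w z e : det u w = 1 -> z != 0 -> finite_valued e -> ~ doubly_periodic e ->
  doubly_periodic (op (u, z) e) -> q != 0 ->
  (forall g, \sum_(i < size q) q`_i * iter i T e g = 0) ->
  exists lam, vanishes S (fun s => coef_fun a s - lam * (s == s0)%:R) (u, z).
Proof.
move=> uw z0 fe nd db q0 qT; apply: contrapT => no.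
have [zs qE] := closed_field_poly_normal q.
have lc0 : lead_coef q != 0 by rewrite lead_coef_eq0.
have sq : size q = (size zs).+1 by rewrite qE size_scale// size_prod_XsubC.
pose f zs := foldr (fun z e g => T e g - z * e g) e zs.
have f0 g : f zs g = 0.
  rewrite /f factor_operator; last exact: row_op_lin.
  apply: (mulfI lc0); rewrite mulr0 -[RHS](qT g) sq mulr_sumr.
  by apply: eq_bigr => i _; rewrite [in RHS]qE coefZ mulrA.
(* If no constant works, each a - lam is nonzero somewhere on the curve and so preserves the failure
   of double periodicity; yet the full product gives 0. *)
suff [] : [/\ finite_valued (f zs), ~ doubly_periodic (f zs) & doubly_periodic (op (u, z) (f zs))].
  by move=> _ + _; apply; apply: doubly_periodic_ext (DP0 V) => g; rewrite f0.
elim: (zs) => //= lam l [fl nl dl].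
pose m : seq (V * Z2) := (- lam, 0) :: [seq (a 0 k, d k) | k <- enum 'I_(size S)].
have mE e' : lop m e' = fun g => T e' g - lam * e' g.
  apply: funext => g; rewrite /lop big_cons /= addr0 addrC mulNr; congr (_ - _).
  by rewrite big_map big_enum.
rewrite -/(f l) -mE; split.
- have Tfin (I : Type) (r : seq I) (F : I -> Z2 -> V) : (forall k, finite_valued (F k)) -> finite_valued (fun g => \sum_(k <- r) F k g).
    move=> H; elim: r => [|k r [vals IH]].
      by exists [:: 0] => g; rewrite big_nil inE.
    have [vals' H'] := H k; exists [seq p + p' | p <- vals', p' <- vals] => g.
    by rewrite big_cons; apply/allpairsP; exists (F k g, \sum_(k <- r) F k g); split; rewrite /= ?H' ?IH.
  apply: Tfin => p; have [vals H] := fl.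
  by exists [seq p.1 * v | v <- vals] => g; apply: map_f.
- apply: contra_not nl; move: no => /forallNP/(_ lam) /existsNP[rho /not_implyP[cr /not_implyP[ru nz]]].
  apply: (doubly_periodic_lop_inv uw z0 fl dl cr ru); apply/eqP => E; apply: nz.
  have r0 := character_neq0 s0 cr.
  rewrite mE in E.
  under eq_bigr do rewrite mulrBl; rewrite sumrB coef_fun_sum//.
  rewrite (bigD1_seq s0)//= eqxx mulr1 [X in _ - (_ + X)]big1 ?addr0; last first.
    by move=> s /negPf ->; rewrite mulr0 mul0r.
  move: E => /(congr1 (fun v => v * rho s0)); rewrite mul0r mulrBl -mulrA (proj1 cr) mul1r.
  move=> E; rewrite -[RHS]E; congr (_ - _); rewrite /T /row_op mulr_suml; apply: eq_bigr => k _.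
  by rewrite -mulrA -(proj2 cr) add0r /d subrK.
- have -> : op (u, z) (lop m (f l)) = lop m (op (u, z) (f l)).
    by rewrite !mE; apply: funext => g; rewrite row_op_op /op; ring.
  apply: doubly_periodic_sum => p; apply: doubly_periodic_scale; exact: doubly_periodic_shift.
Qed.

(** Curves with independent directions meet: on the first one the second equation reads t^det = r,
    which has a root. Both constants are read off at a common point. *)
Lemma common_constant x y lam lam' w : det x.1 w = 1 -> x.2 != 0 -> y.2 != 0 -> det x.1 y.1 != 0 ->
  vanishes S (fun s => coef_fun a s - lam * (s == s0)%:R) x ->
  vanishes S (fun s => coef_fun a s - lam' * (s == s0)%:R) y -> lam = lam'.
Proof.
move=> xw x0 y0 xy vx vy.
have [t t0 tE] : exists2 t : V, t != 0 & chr x.1 w x.2 t y.1 = y.2.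
  pose al := (coord x.1 w y.1).1; pose r := y.2 / x.2 ^ al.
  have z0 : x.2 ^ al != 0 by rewrite expfz_neq0.
  have r0 : r != 0 by rewrite mulf_neq0// invr_eq0.
  have [t t0 tE] : exists2 t : V, t != 0 & t ^ (det x.1 y.1) = r.
    case: (intP (det x.1 y.1)) xy => // m _.
      by exists (m.+1.-root r); rewrite ?rootC_eq0// -exprnP rootCK.
    by exists (m.+1.-root r)^-1; rewrite ?invr_eq0 ?rootC_eq0// -exprnN exprVn invrK rootCK.
  by exists t => //; rewrite /chr -/(det x.1 y.1) tE /r mulrCA divff// mulr1.
have cr := character_chr x.1 w x0 t0.
have K l : \sum_(s <- S) (coef_fun a s - l * (s == s0)%:R) * chr x.1 w x.2 t s = 0 ->
    l * chr x.1 w x.2 t s0 = \sum_(s <- S) coef_fun a s * chr x.1 w x.2 t s.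
  under eq_bigr do rewrite mulrBl; rewrite sumrB.
  rewrite [X in _ - X](bigD1_seq s0)//= eqxx mulr1 [X in _ - (_ + X)]big1 ?addr0.
    by move/eqP; rewrite subr_eq0 => /eqP ->.
  by move=> s /negPf ->; rewrite mulr0 mul0r.
have e1 := K _ (vx _ cr (chr_u xw _ _)); have e2 := K _ (vy _ cr tE).
by apply: (mulIf (character_neq0 s0 cr)); rewrite e1 e2.
Qed.

Lemma all_curves_constant q L c : good L -> finite_valued c ->
  (forall x, x \in L -> ~ doubly_periodic (ops (rem x L) c) /\ doubly_periodic (op x (ops (rem x L) c))) ->
  (exists x y, [/\ x \in L, y \in L & det x.1 y.1 != 0]) -> q != 0 ->
  (forall g, \sum_(i < size q) q`_i * iter i T c g = 0) ->
  exists lam, forall x, x \in L -> vanishes S (fun s => coef_fun a s - lam * (s == s0)%:R) x.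
Proof.
move=> gL fc H [x0 [y0 [x0L y0L xy]]] q0 qT.
have one x : x \in L -> exists lam, vanishes S (fun s => coef_fun a s - lam * (s == s0)%:R) x.
  move=> xL; have [[_ [w xw]] xz] := gL _ xL; have [nd db] := H _ xL.
  have := @curve_constant q x.1 w x.2 (ops (rem x L) c) xw xz (finite_valued_ops _ fc) nd.
  rewrite -surjective_pairing => /(_ db q0); apply.
  exact: annihilator_ops.
have agree x y lam lam' : x \in L -> y \in L -> det x.1 y.1 != 0 ->
    vanishes S (fun s => coef_fun a s - lam * (s == s0)%:R) x ->
    vanishes S (fun s => coef_fun a s - lam' * (s == s0)%:R) y -> lam = lam'.
  move=> xL yL; have [[_ [w xw]] xz] := gL _ xL; have [_ yz] := gL _ yL.
  exact: (common_constant xw xz yz).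
have [lam vx0] := one _ x0L; have [lam' vy0] := one _ y0L.
exists lam => x xL; have [lx vx] := one _ xL.
(* A direction equal to that of x0 is independent of that of y0, so the comparison goes through
   y0. *)
have [e0|ne] := eqVneq (det x.1 x0.1) 0; last by rewrite -(agree _ _ _ _ xL x0L ne vx vx0).
have E : x.1 = x0.1 by apply: direction_det; [have [] := gL _ xL|have [] := gL _ x0L|].
have xy' : det x.1 y0.1 != 0 by rewrite E.
by rewrite (agree _ _ _ _ x0L y0L xy vx0 vy0) -(agree _ _ _ _ xL y0L xy' vx vy0).
Qed.

End Constants.

(** * The complexity of an aperiodic configuration *)

Section Erosion.
Variable V : numClosedFieldType.
Implicit Types (S : seq Z2) (L : seq (Z2 * V)) (e : Z2 -> V).

Lemma erode_cat S L L' : erode S (L ++ L') = erode (erode S L) L'.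
Proof. by elim: L S => //= x L IH S; rewrite IH. Qed.

Lemma erode_uniq S L : uniq S -> uniq (erode S L).
Proof. by elim: L S => //= x L IH S uS; apply: IH; apply: filter_uniq. Qed.

Lemma erode_lconv S L : lconv S -> lconv (erode S L).
Proof. by elim: L S => //= x L IH S uS; apply: IH; apply: lconv_shrink. Qed.

Lemma erode_sub S L : {subset erode S L <= S}.
Proof.
by elim: L S => [|x L IH] S s //= /IH; rewrite mem_filter => /andP[].
Qed.

Lemma erode_size S L : (size (erode S L) <= size S)%N.
Proof.
elim: L S => //= x L IH S; apply: leq_trans (IH _) _; rewrite size_filter; exact: count_size.
Qed.

Lemma erode_lt S L : good L -> L != [::] -> S != [::] -> (size (erode S L) < size S)%N.
Proof.
case: L => // x L gL _ S0 /=; apply: leq_ltn_trans (erode_size _ _) _.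
have [[_ [w xw]] _] := gL x (mem_head _ _).
(* A point of S farthest in direction u cannot be moved by u inside S. *)
have [s sS sm] := seq_argmax (fun s => x.1.1 * s.1 + x.1.2 * s.2) S0.
have ns : s + x.1 \notin S.
  apply/negP => /sm /=.
  have u0 : x.1.1 != 0 \/ x.1.2 != 0.
    case: (eqVneq x.1.1 0) => [E1|]; [right|by left].
    by apply/eqP => E2; move: xw; rewrite /det E1 E2 !mul0r.
  by case: u0; move: (x.1.1) (x.1.2) => p q; nia.
rewrite size_filter -[X in (_ < X)%N](count_predC (fun s => s + x.1 \in S)) -[X in (X < _)%N]addn0.
by rewrite ltn_add2l -has_count; apply/hasP; exists s.
Qed.

Lemma ops_local S L e p q : (forall s, s \in S -> e (p + s) = e (q + s)) ->
  forall s, s \in erode S L -> ops L e (p + s) = ops L e (q + s).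
Proof.
elim: L S e => //= x L IH S e H s; rewrite -ops_op; apply: IH => t.
by rewrite mem_filter => /andP[tx tS]; rewrite /op -!addrA !H.
Qed.

End Erosion.

(* L is a minimal product; x0, y0 in L have independent directions u1, u2; K1,
   K2, Lr are the factors with direction u1, u2, and the others. The bounds rk
   and bound, from the operators and from c' = Lr c, add up to the claim because
   eroding S' by K1 and K2 removes a point. *)
Lemma aperiodic_complexity (A : finType) (eta : Z2 -> A) (S : seq Z2) :
  (forall a, exists g, eta g = a) -> uniq S -> lconv S -> S != [::] ->
  (forall h, h != 0 -> ~ (forall g, eta (g + h) = eta g)) ->
  (size S + 2 * #|A| <= 2 * complexity (fun i j => eta (i, j)) S + 1)%N.
Proof.
move=> surj uS cS S0 ap; set P := complexity _ S; rewrite leqNgt; apply/negP => lt.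
have [s0 s0S] : exists s0, s0 \in S by case: (S) S0 => // s l _; exists s; rewrite inE eqxx.
(* This turns the assumed 2 P + 2 <= |S| + 2 |A| into P + 2 <= |S| + |A|, the hypothesis of
   [int_annihilator]. *)
have AP : (#|A| <= P)%N.
  have -> : #|A| = nvalues (fun g => eta (g + s0)).
    rewrite /nvalues -cardsT; congr #|pred_of_set _|; apply/setP => a; rewrite !inE.
    by apply/esym/asboolP; have [p <-] := surj a; exists (p - s0); rewrite subrK.
  by apply: nvalues_le => p q /patP/(_ s0 s0S).
have [|D [f [uD [v0 v0D fv0] ann]]] := int_annihilator surj uS S0.
  by rewrite -/P; lia.
pose phi (a : A) : int := (enum_rank a : nat)%:Z.
have [||L0 L00 L0E] := @difference_product D f (phi \o eta) #|A| v0 _ uD v0D fv0.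
- by move=> g; apply: ltnW; exact: ltn_ord.
- by move=> g; exact: (ann phi g).
pose c (g : Z2) : algC := (phi (eta g))%:~R.
have fc : finite_valued c by exists [seq (phi a)%:~R | a <- enum A] => g; apply: map_f; rewrite mem_enum.
have npc h : h != 0 -> ~ per h c.
  move=> h0 pc; apply: (ap _ h0) => g; have /eqP := pc g.
  by rewrite eqr_int /phi => /eqP [] /val_inj/enum_rank_inj.
have c0 g : difference_ops L0 c g = 0.
  have -> : difference_ops L0 c g = (difference_ops L0 (phi \o eta) g)%:~R.
    rewrite /c; have -> : (fun g => (phi (eta g))%:~R : algC) = fun g => ((phi \o eta) g)%:~R by [].
    elim: (L0) (phi \o eta) => //= w l IH e; rewrite -IH; congr (difference_ops l _ g).
    by apply: funext => x; rewrite rmorphB.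
  by rewrite L0E.
have [L [gL uL HL [x0 [y0 [x0L y0L xy]]]]] := minimal_product fc npc (good_product L00 c0).
set u1 := x0.1 in xy; set u2 := y0.1 in xy.
pose K1 := [seq x <- L | x.1 == u1]; pose K2 := [seq x <- L | x.1 == u2].
pose Lr := [seq x <- L | (x.1 != u1) && (x.1 != u2)].
have u12 : u1 != u2 by apply: contra_neq xy => ->; rewrite /det mulrC subrr.
have pL : perm_eq L (Lr ++ (K1 ++ K2)).
  apply: uniq_perm => //.
    rewrite !cat_uniq !filter_uniq// andbT /=; apply/andP; split.
      apply/hasPn => x; rewrite mem_cat !mem_filter => /orP[] /andP[/eqP -> _];
        by rewrite eqxx ?andbF.
    apply/hasPn => x; rewrite !mem_filter => /andP[/eqP -> _].
    by rewrite eq_sym (negPf u12).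
  move=> x; rewrite !mem_cat !mem_filter; case: (x \in L); rewrite ?andbF// !andbT.
  by case: eqP; case: eqP.
have gL' : good (Lr ++ (K1 ++ K2)) by move=> x; rewrite -(perm_mem pL); apply: gL.
have uL' : uniq (Lr ++ (K1 ++ K2)) by rewrite -(perm_uniq pL).
have aK1 : all (fun x => x.1 == u1) K1 by apply/allP => x; rewrite mem_filter => /andP[].
have aK2 : all (fun x => x.1 == u2) K2 by apply/allP => x; rewrite mem_filter => /andP[].
have x0K : x0 \in K1 by rewrite mem_filter eqxx.
have y0K : y0 \in K2 by rewrite mem_filter eqxx.
pose c' := ops Lr c; pose S' := erode S Lr.
have fc' : finite_valued c' := finite_valued_ops Lr fc.
have dL : doubly_periodic (ops K1 (ops K2 c')).
  have [_] := HL _ x0L.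
  rewrite -[op _ _]/(ops (x0 :: rem x0 L) c) -(ops_perm _ (perm_to_rem x0L)) (ops_perm _ pL).
  by rewrite ops_cat ops_catC ops_cat.
(* A period of c' along u passes to Ku c'. Undoing Ku' gives Ku c' a period along u' too, so it is
   already doubly periodic, against the minimality of L at x. *)
have key (u u' : Z2) Ku Ku' x K : all (fun x => x.1 == u') Ku' -> x \in Ku' -> x \in L ->
    det u u' != 0 -> perm_eq L (Lr ++ (Ku ++ Ku')) -> doubly_periodic (ops Ku' (ops Ku c')) ->
    (0 < K)%N -> ~ per (u *+ K) c'.
  move=> aKu' xKu' xL uu' pLu [N N0 dN] K0 pu.
  have [M M0 pM] := recurrence_list (finite_valued_ops Ku fc') aKu' N0 (dN u').
  have pf : per (u *+ K) (ops Ku c').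
    have opsp l : per (u *+ K) (ops l c').
      by elim: l => //= y l IH g; rewrite /op addrAC !IH.
    exact: opsp.
  have dd := doubly_periodic_ops (rem x Ku') (doubly_periodic_indep K0 M0 uu' pf pM).
  have [nd _] := HL _ xL; apply: nd.
  have pr : perm_eq (rem x L) (rem x Ku' ++ (Ku ++ Lr)).
    apply/permP => p; have /permP/(_ p) := pLu.
    have /permP/(_ p) := perm_to_rem xL; have /permP/(_ p) := perm_to_rem xKu'.
    rewrite /= !count_cat; clear.
    move: (nat_of_bool _) (count p (rem x L)) (count p (rem x Ku')) (count p L).
    by move: (count p Lr) (count p Ku) (count p Ku') => n1 n2 n3 n4 n5 n6 n7; lia.
  by rewrite (ops_perm _ pr) ops_cat ops_cat.
have [N N0 dN] := dL.
have [M M0 pM] := recurrence_list (finite_valued_ops K2 fc') aK1 N0 (dN u1).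
(* K2 c' has period M u1, so K2 kills e1 = (X^(M u1) - 1) c'; undoing K2 makes e1 periodic along u2,
   which is the required relation for c'. *)
pose e1 g := c' (g + u1 *+ M) - c' g.
have fe1 : finite_valued e1.
  have -> : e1 = op (u1 *+ M, 1) c' by apply: funext => g; rewrite /e1 /op mul1r.
  exact: finite_valued_op.
have [|M' M'0 pM'] := @recurrence_list _ u2 K2 e1 1 fe1 aK2 isT.
  have E0 g : ops K2 e1 g = 0.
    have -> : e1 = fun g => -1 * c' g + c' (g + u1 *+ M).
      by apply: funext => y; rewrite mulN1r addrC.
    by rewrite ops_lin ops_shift pM mulN1r addNr.
  by move=> g; rewrite !E0.
have [[_ [w u1w]] _] := gL _ x0L.
have rk : (size S + #|A| <= 1 + size (erode S' (K1 ++ K2)) + P)%N.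
  have [Af [rk AfP]] := pattern_operators algC surj s0S.
  apply: leq_trans rk _; rewrite leq_add2r -erode_cat.
  apply: (rank_bound gL' uL' uS cS s0S) => a /AfP[q q0 /(_ (fun a => (phi a)%:~R)) qT].
  have [lam H] := all_curves_constant uS s0S gL fc HL (ex_intro _ x0 (ex_intro _ y0 (And3 x0L y0L xy))) q0 qT.
  by exists lam => x; rewrite -(perm_mem pL); apply: H.
(* The row argument needs a nonempty S'. If S' is empty, [rk] alone gives P >= |S| + |A| - 1, which
   is enough. *)
have [S'0|S'n0] := eqVneq S' [::].
  move: rk; rewrite S'0 (_ : erode [::] _ = [::]).
    have szS : (0 < size S)%N by rewrite lt0n size_eq0.
    move: lt szS; rewrite /=; clear; move: P (size S) #|A| => p n k; lia.
  by apply/size0nil/eqP; rewrite -leqn0; apply: erode_size.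
have lt' : (size (erode S' (K1 ++ K2)) < size S')%N.
  apply: erode_lt => //; first by move=> x xK; apply: gL'; rewrite mem_cat xK orbT.
  by apply/eqP => E; have : x0 \in K1 ++ K2; [rewrite mem_cat x0K | rewrite E].
have [vals cvals] := fc'.
have ub : u1.1 * (u2 *+ M').2 - u1.2 * (u2 *+ M').1 != 0.
  by rewrite pairMn /= !mulrA -mulrBl mulf_neq0// eqz_nat -lt0n.
have bound : (size S' + #|A| <= P + 1)%N.
  apply: (@nonlinear_bound A eta algC c' vals surj cvals u1 w (u2 *+ M') M M0 u1w ub _ _ _ S S').
  - move=> g; have /eqP := pM' g; rewrite /e1 subr_eq => /eqP E.
    by rewrite (addrAC g) E; ring.
  - move=> K K0; apply: (key u1 u2 K1 K2 y0 K) => //.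
    by rewrite ops_catC.
  - move=> K K0; rewrite -mulrnA; apply: (key u2 u1 K2 K1 x0) => //.
    + by move: xy; rewrite /det -oppr_eq0 opprB (mulrC u1.2) (mulrC u1.1).
    + by rewrite (perm_trans pL)// perm_cat2l perm_catC.
    + by rewrite muln_gt0 M'0.
  - exact: erode_uniq.
  - exact: erode_lconv.
  - exact: S'n0.
  - exact: erode_sub.
  - move=> p q H; apply: ops_local => s sS; by rewrite /c H.
move: lt rk lt' bound; clear.
move: (size (erode _ _)) (size S') P (size S) #|A| => k k' p n m; lia.
Qed.

(** * From real convex hulls to lattice convexity *)

Section Convexity.
Variable R : realType.
Local Notation plane := (R^o * R^o)%type.

Lemma hull_segment (S : set Z2) (x y : plane) (t : R) : 0 <= t <= 1 ->
  hull S x -> hull S y -> hull S (t *: x + (1 - t) *: y).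
Proof.
move=> /andP[t0 t1] hx hy C [cC SC].
have itv : Itv.spec (@Itv.num_sem R) (Itv.Real `[0%Z, 1%Z]) t.
  by rewrite /= /Itv.num_sem /= num_real /= in_itv /= t0 t1.
have := cC x y (Itv.mk itv).
rewrite !inE; apply; [exact: hx|exact: hy].
Qed.

(* The homogenization of the hull: a cone, closed under addition. *)
Lemma convexZ2_lconv (S : {fset Z2}) : convexZ2 R [set` S] -> lconv (enum_fset S).
Proof.
move=> [_ SE]; pose H := @hull R [set` S]%classic.
(* The apex W = 0 is included because single weights may vanish. *)
pose cone (W : R) (v : plane) := W = 0 /\ v = 0 \/ 0 < W /\ H (W^-1 *: v).
have coneD W W' v v' : cone W v -> cone W' v' -> cone (W + W') (v + v').
  move=> [[-> ->]|[W0 Hv]]; first by rewrite !add0r.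
  move=> [[-> ->]|[W'0 Hv']]; first by rewrite !addr0; right.
  right; have WW : 0 < W + W' by rewrite addr_gt0.
  split=> //.
  have := @hull_segment _ _ _ (W / (W + W')) _ Hv Hv'.
  have -> : 1 - W / (W + W') = W' / (W + W') by field; rewrite gt_eqF.
  rewrite !scalerA !(mulrAC _ (_ + _)^-1) !divff ?gt_eqF// !mul1r -scalerDr; apply.
  apply/andP; split; first by rewrite divr_ge0 ?ltW.
  by rewrite (ler_pdivrMr _ _ WW) mul1r lerDl ltW.
have coneS (w : int) (q : Z2) : 0 <= w -> q \in enum_fset S ->
    cone w%:~R (w%:~R *: @embed R q).
  move=> w0 qS; have [->|wn] := eqVneq w 0; first by left; rewrite scale0r.
  have wp : 0 < w%:~R :> R by rewrite ltr0z lt_neqAle eq_sym wn.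
  right; split=> //; rewrite scalerA mulVf ?gt_eqF// scale1r.
  by apply: sub_gen_smallest; exists q.
move=> q1 q2 q3 q4 g w1 w2 w3 w4 s1 s2 s3 s4 p1 p2 p3 p4 W e1 e2.
have := coneD _ _ _ _ (coneD _ _ _ _ (coneD _ _ _ _ (coneS _ _ p1 s1) (coneS _ _ p2 s2)) (coneS _ _ p3 s3)) (coneS _ _ p4 s4).
rewrite -!rmorphD /=; set W' := (_%:~R : R); set v := (_ + _ : plane).
have W0 : 0 < W' by rewrite ltr0z.
have -> : v = W' *: embed R g.
  rewrite /v /W' /embed; congr (_, _); rewrite /= /GRing.scale /=.
    by rewrite -!intrM e1 !intrD.
  by rewrite -!intrM e2 !intrD.
move=> [[E _]|[_]]; first by rewrite E ltxx in W0.
rewrite scalerA mulVf ?gt_eqF// scale1r => Hg.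
have : [set` S]%classic g by rewrite SE.
by [].
Qed.

End Convexity.

Lemma pattern_complexityE (A : finType) (eta : Z2 -> A) (S : {fset Z2}) :
  pattern_complexity eta S = complexity (fun i j => eta (i, j)) (enum_fset S).
Proof.
transitivity (nvalues (fun u => restriction (translate u eta) S)).
  rewrite /nvalues /value_set cardsE; apply: eq_card => p; rewrite !inE.
  by apply/asboolP/asboolP => -[u e]; exists u.
apply: nvalues_eq => p q; split=> [e|/patP e].
  apply/patP => s sS; have := congr1 (fun f : {ffun S -> A} => f [` sS]%fset) e.
  by rewrite !ffunE /translate /= addrC (addrC _ q).
apply/ffunP => s; rewrite !ffunE /translate addrC (addrC _ q).
exact: (e _ (valP s)).
Qed.

Theorem theorem2p2 (R : realType) (A : finType) (eta : Z2 -> A) :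
  (1 < #|A|)%N ->
  (forall a : A, exists g : Z2, eta g = a) ->
  (exists S : {fset Z2},
      quasi_regular R S /\
      ((pattern_complexity eta S)%:R <= 2^-1 * #|` S|%:R + #|A|%:R - 1 :> R)) ->
  periodic eta.
Proof.
move=> A1 surj [S [[[S0 /convexZ2_lconv cS _] _] le]].
apply: contrapT => np.
have ap h : h != 0 -> ~ (forall g, eta (g + h) = eta g).
  by move=> h0 per; apply: np; exists h.
have S0' : enum_fset S != [::].
  by apply: contra_neq S0 => e; apply/fsetP => x; rewrite -[x \in S]/(x \in enum_fset S) e.
have := aperiodic_complexity surj (fset_uniq S) cS S0' ap.
rewrite -pattern_complexityE leqNgt => /negP; apply.
rewrite -(ltr_nat R) !natrD; move: le.
have -> : size (enum_fset S) = #|` S| by [].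
move: (pattern_complexity eta S)%:R (#|` S|%:R) (#|A|%:R) => p s a; lra.
Qed.
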